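(* The following conditions for a real function $f$ on $(-1,1)$ are equivalent: (i) $f$ is operator absolutely monotone on $(-1,1)$; (ii) $f$ is a non-negative operator monotone function on $(-1,1)$ whose representing measure is supported in $[0,1]$; (iii) $f$ admits the integral expression $$f(x)=\beta+\int_{[0,1]}\frac{1+x}{1-\lambda x}\,d\mu(\lambda),\qquad x\in(-1,1),$$ with $\beta\ge0$ and a (unique) finite positive measure $\mu$ on $[0,1]$.
   Context: $\mathbb{M}_n^{sa}(a,b)$ is the set of $n\times n$ Hermitian matrices with eigenvalues in $(a,b)$; $\mathbb{M}_n^+$ the set of $n\times n$ positive semidefinite matrices. A smooth ($C^\infty$) real function $f$ on $(a,b)$ is operator absolutely monotone if $$\frac{d^k}{dt^k}f(A+tX)\Big|_{t=0}\ge0,\qquad k=0,1,2,\dots,$$ for every $A\in\mathbb{M}_n^{sa}(a,b)$ and every $X\in\mathbb{M}_n^+$, for any $n\in\mathbb{N}$. A real function $f$ on $(a,b)$ is operator monotone if $A\le B$ implies $f(A)\le f(B)$ for all self-adjoint $A,B$ (equivalently, Hermitian matrices of every size) with spectra in $(a,b)$. The representing measure of an operator monotone function $f$ on $(-1,1)$ is the unique finite positive Borel measure $\mu$ on $[-1,1]$ such that, for every $\alpha\in(-1,1)$, $$f(x)=f(\alpha)+\int_{[-1,1]}\frac{x-\alpha}{(1-\lambda x)(1-\lambda\alpha)}\,d\mu(\lambda),\qquad x\in(-1,1).$$ (The measure $\mu$ in (iii) is not claimed to be this representing measure.) *)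

(* Defs.v *)
(* Conventions: R is an arbitrary realType, complex numbers are R[i], and a
   real function on an interval is a function R -> R of which only the values
   on that interval are ever used. *)
From mathcomp Require Export all_boot all_order all_algebra.
From mathcomp Require Export complex.
From mathcomp Require Export all_classical all_reals all_analysis.

Set Implicit Arguments.
Unset Strict Implicit.
Unset Printing Implicit Defensive.

Export Order.TTheory GRing.Theory Num.Theory numFieldNormedType.Exports.
Export Num.Def.

#[global] Open Scope classical_set_scope.
#[global] Open Scope ring_scope.
#[global] Open Scope sesquilinear_scope.
#[global] Open Scope complex_scope.

Definition psdmx (R : realType) (n : nat) (A : 'M[R[i]]_n) : Prop :=
  A \is hermsymmx /\ forall v : 'rV[R[i]]_n, 0 <= (v *m A *m v ^t*) 0 0.

Definition lemx (R : realType) (n : nat) (A B : 'M[R[i]]_n) : Prop :=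
  psdmx (B - A).

(* The order of R[i] makes a < z < b imply that z is real. *)
Definition Msa (R : realType) (n : nat) (a b : R) (A : 'M[R[i]]_n) : Prop :=
  A \is hermsymmx /\ forall z : R[i], eigenvalue A z -> a%:C < z < b%:C.

(* Functional calculus for Hermitian A: if A = U^-1 diag(d) U is the spectral
   decomposition (U unitary, d real) then f(A) = U^-1 diag(f(d)) U. *)
Definition fun_mx (R : realType) (f : R -> R) (n : nat) (A : 'M[R[i]]_n) :
    'M[R[i]]_n :=
  invmx (spectralmx A)
  *m diag_mx (map_mx (fun z : R[i] => (f (complex.Re z))%:C) (spectral_diag A))
  *m spectralmx A.

(* k-th derivative at t of a matrix-valued function of a real variable, taken
   entrywise on real and imaginary parts. *)
Definition derive1n_mx (R : realType) (n k : nat) (G : R -> 'M[R[i]]_n)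
    (t : R) : 'M[R[i]]_n :=
  \matrix_(i, j) (derive1n k (fun s : R => complex.Re (G s i j)) t +i*
                  derive1n k (fun s : R => complex.Im (G s i j)) t).

Definition smooth_on (R : realType) (a b : R) (f : R -> R) : Prop :=
  forall (k : nat) (x : R), x \in `]a, b[ -> derivable (derive1n k f) x 1.

(* The derivatives of t |-> f(A + tX) at 0 exist because f is smooth and the
   spectrum of A + tX stays in ]a, b[ for t near 0. *)
Definition operator_absolutely_monotone (R : realType) (a b : R)
    (f : R -> R) : Prop :=
  smooth_on a b f /\
  forall (n : nat) (A X : 'M[R[i]]_n), Msa a b A -> psdmx X ->
  forall k : nat, psdmx (derive1n_mx k (fun t => fun_mx f (A + t%:C *: X)) 0).

Definition operator_monotone (R : realType) (a b : R) (f : R -> R) : Prop :=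
  forall (n : nat) (A B : 'M[R[i]]_n), Msa a b A -> Msa a b B ->
  lemx A B -> lemx (fun_mx f A) (fun_mx f B).

(* A Borel measure on the closed interval D is encoded as a Borel measure on
   the line that vanishes off D. *)
Definition supported_in (R : realType)
    (mu : {finite_measure set (measurableTypeR R) -> \bar R}) (D : set R) :
    Prop :=
  mu (~` D) = 0%E.

Definition representing_measure (R : realType) (f : R -> R)
    (mu : {finite_measure set (measurableTypeR R) -> \bar R}) : Prop :=
  supported_in mu `[-1, 1] /\
  forall alpha x : R, alpha \in `]-1, 1[ -> x \in `]-1, 1[ ->
  ((f x)%:E = (f alpha)%:E +
    \int[mu]_(l in `[(-1)%R, 1%R])
      ((x - alpha) / ((1 - l * x) * (1 - l * alpha)))%:E)%E.

Definition integral_expression (R : realType) (f : R -> R) (beta : R)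
    (mu : {finite_measure set (measurableTypeR R) -> \bar R}) : Prop :=
  [/\ 0 <= beta, supported_in mu `[0, 1] &
  forall x : R, x \in `]-1, 1[ ->
  ((f x)%:E = beta%:E +
    \int[mu]_(l in `[0%R, 1%R]) ((1 + x) / (1 - l * x))%:E)%E].

(* Main.v *)
(* Restricted to scalars, (i) says that f is absolutely monotone on (-1,1), so by
   Bernstein's theorem f is the sum of its Taylor series at 0. The first and
   second derivatives at small diagonal A along the all-ones matrix X show that
   the shifted coefficients b_k = a_(k+1) and b_(k+1) have positive Hankel forms;
   since b does not grow geometrically it is completely monotone, hence by
   Hausdorff the moment sequence of a measure on [0,1]. This represents
   f(x) - f(0) as the integral of x/(1-lx).
   Conversely, positivity of a linear functional of the b_k may be checked on
   the extreme sequences b_k = l^k, that is, for the functions x/(1-lx), where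
   the derivatives along X are sandwiches of the resolvent R = (1-lA)^-1 or of X
   by powers of R X, and monotonicity follows from the resolvent identity.
   Uniqueness: the coefficients determine m_k + m_(k+1), and moments of measures
   on [0,1] converge, which excludes a non-zero alternating difference. *)

From HB Require Import structures.
Require Import Defs.
From mathcomp Require Import measurable_realfun ring lra zify.

Set Implicit Arguments.
Unset Strict Implicit.
Unset Printing Implicit Defensive.

(** * Power series *)

(** No matrix function is differentiated directly. A quadratic form of [f (A + tX)] is expanded
    through the Taylor series of [f] into words in [A] and [X]; its k-th derivative at 0 is read off
    from the coefficient of [t ^ k], and both directions become sign questions about these
    coefficients. The all-ones [X] has rank one, so each letter [X] cuts a word into scalar factors
    and word sums become convolutions. With weights whose moments along the diagonal of [A] are the
    coefficients of a polynomial p, the first order form tends to the functional of X p^2. At second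
    order the extra middle factor tends to the number of nodes times the unit sequence, which gives
    a positive multiple of the functional at X^2 p^2. The nodes must shrink because only finitely
    many moments can be prescribed and the others have to vanish in the limit. The kernel of the
    integral expression is reached through (1+x)/(1-lx) = 1 + x(1+l)/(1-lx), so the representing
    measure is divided by 1+l; the constant is non-negative as the limit of f at -1. *)

Definition geo_bounded (R : realType) (a : nat -> R) (r : R) : Prop :=
  forall s, 0 < s -> s < r -> exists K, forall k, `|a k| * s ^+ k <= K.

Section PowerSeries.
Variable R : realType.
Implicit Types (a : nat -> R) (r x s : R) (f : R -> R).

(** [geo_bounded a r] says that the radius of convergence is at least [r]. A point s strictly
    between [|x|] and [r] turns the margin into the rate q = |x|/s. *)
Lemma geo_bounded_split a r x : geo_bounded a r -> `|x| < r ->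
  exists K q, [/\ 0 <= K, 0 <= q, q < 1 & forall k, `|a k * x ^+ k| <= K * q ^+ k].
Proof.
move=> ga xr; have [s xs sr] : exists2 s, `|x| < s & s < r.
  by exists ((`|x| + r) / 2); lra.
have s0 := le_lt_trans (normr_ge0 x) xs.
have [K HK] := ga _ s0 sr.
have K0 : 0 <= K.
  by apply: le_trans (HK 0%N); rewrite mulr_ge0 ?exprn_ge0 // ltW.
exists K, (`|x| / s); split => //.
- by rewrite divr_ge0 // ltW.
- by rewrite ltr_pdivrMr // mul1r.
move=> k; rewrite normrM normrX expr_div_n.
rewrite [leRHS](_ : _ = `|x| ^+ k * (K / s ^+ k)); last by ring.
rewrite [leLHS](_ : _ = `|x| ^+ k * `|a k|); last by ring.
by rewrite ler_wpM2l ?exprn_ge0 // ler_pdivlMr ?exprn_gt0.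
Qed.

Lemma cvg_geometric_dominated (u : nat -> R) K q : 0 <= K -> 0 <= q -> q < 1 ->
  (forall k, `|u k| <= K * q ^+ k) -> cvgn (series u).
Proof.
move=> K0 q0 q1 uK; apply: normed_cvg.
apply: (@series_le_cvg _ _ (geometric K q)) => //=.
- by move=> n; rewrite mulr_ge0 ?exprn_ge0.
- by apply: is_cvg_geometric_series; rewrite ger0_norm.
Qed.

Lemma geo_cvg a r x : geo_bounded a r -> `|x| < r -> cvgn (pseries a x).
Proof.
move=> ga xr; have [K [q [K0 q0 q1 H]]] := geo_bounded_split ga xr.
exact: cvg_geometric_dominated H.
Qed.

(** Each of the k+1 copies of q^k is at most a term q^i of the geometric sum. *)
Lemma succ_geo_le (q : R) k : 0 <= q -> q < 1 -> k.+1%:R * q ^+ k <= (1 - q)^-1.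
Proof.
move=> q0 q1; have q10 : 0 < 1 - q by rewrite subr_gt0.
rewrite -[leRHS]mul1r ler_pdivlMr //.
have -> : k.+1%:R * q ^+ k * (1 - q) = (1 - q) * \sum_(i < k.+1) q ^+ k.
  by rewrite sumr_const card_ord -mulr_natl; ring.
apply: (@le_trans _ _ ((1 - q) * \sum_(i < k.+1) q ^+ i)).
  apply: ler_wpM2l; first exact: ltW.
  apply: ler_sum => i _; apply: ler_wiXn2l => //; first exact: ltW.
  by rewrite -ltnS.
by rewrite -opprB mulNr -subrX1 opprB gerBl exprn_ge0.
Qed.

(** The factor k+1 produced by differentiation is absorbed by moving from s to a larger t < r, since
    (k+1)(s/t)^k is bounded. *)
Lemma geo_bounded_diffs a r : geo_bounded a r -> geo_bounded (pseries_diffs a) r.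
Proof.
move=> ga s s0 sr; have [t st tr] : exists2 t, s < t & t < r.
  by exists ((s + r) / 2); lra.
have t0 := lt_trans s0 st.
have [K HK] := ga _ t0 tr.
have K0 : 0 <= K.
  by apply: le_trans (HK 0%N); rewrite mulr_ge0 ?exprn_ge0 // ltW.
pose q := s / t.
have q0 : 0 <= q by rewrite divr_ge0 // ltW.
have q1 : q < 1 by rewrite ltr_pdivrMr // mul1r.
exists (K / t * (1 - q)^-1) => k.
have -> : `|pseries_diffs a k| * s ^+ k =
    (`|a k.+1| * t ^+ k.+1) / t * (k.+1%:R * q ^+ k).
  rewrite /pseries_diffs normrM normr_nat /q expr_div_n exprS.
  have ? : t ^+ k != 0 by rewrite expf_neq0 // gt_eqF.
  have ? : t != 0 by rewrite gt_eqF.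
  by field; apply/andP.
apply: ler_pM.
- by rewrite divr_ge0 ?mulr_ge0 ?exprn_ge0 // ltW.
- by rewrite mulr_ge0 ?exprn_ge0.
- by rewrite ler_pM2r ?invr_gt0.
- exact: succ_geo_le.
Qed.

Lemma geo_bounded_iter_diffs a r k :
  geo_bounded a r -> geo_bounded (iter k (@pseries_diffs R) a) r.
Proof. by move=> ga; elim: k => //= k; exact: geo_bounded_diffs. Qed.

Lemma iter_pseries_diffs0 a k : iter k (@pseries_diffs R) a 0 = k`!%:R * a k.
Proof.
have H n : iter k (@pseries_diffs R) a n * n`!%:R = (n + k)`!%:R * a (n + k)%N.
  elim: k n => [|k IH] n /=; first by rewrite addn0 mulrC.
  by rewrite /pseries_diffs addnS -addSn -IH factS natrM; ring.
by have := H 0%N; rewrite fact0 mulr1.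
Qed.

Lemma lim_pseries0 a : limn (pseries a 0) = a 0%N.
Proof.
apply/cvg_lim => //; apply: cvg_near_cst; exists 1%N => // n /= n1.
rewrite /pseries /series /= big_ltn // expr0 mulr1 big_nat big1 ?addr0 //.
by move=> i /andP[i1 _]; rewrite expr0n eqn0Ngt i1 mulr0.
Qed.

Lemma derive_pseries a r x : geo_bounded a r -> `|x| < r ->
  is_derive x 1 (fun y => limn (pseries a y)) (limn (pseries (pseries_diffs a) x)).
Proof.
move=> ga xr; have [s xs sr'] : exists2 s, `|x| < s & s < r.
  by exists ((`|x| + r) / 2); lra.
have s0 := le_lt_trans (normr_ge0 x) xs.
have sr : `|s| < r by rewrite gtr0_norm.
apply: (@pseries_snd_diffs _ _ s).
- exact: geo_cvg ga sr.
- exact: geo_cvg (geo_bounded_diffs ga) sr.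
- exact: geo_cvg (geo_bounded_diffs (geo_bounded_diffs ga)) sr.
- by rewrite (gtr0_norm s0).
Qed.

Lemma near_norm_lt x r : `|x| < r -> \forall y \near x, `|y| < r.
Proof.
move=> xr; have : x \in `](- r), r[ by rewrite in_itv /= -ltr_norml.
move=> /near_in_itvoo; apply: filterS => y.
by rewrite in_itv /= -ltr_norml.
Qed.

(** The induction has to run on the whole disc: the next derivative at a point needs the identity
    for the previous one in a neighbourhood. *)
Lemma derive1n_pseries a r f : geo_bounded a r ->
  (forall x, `|x| < r -> f x = limn (pseries a x)) ->
  forall k x, `|x| < r ->
  derive1n k f x = limn (pseries (iter k (@pseries_diffs R) a) x) /\
  derivable (derive1n k f) x 1.
Proof.
move=> ga fa; pose d k := iter k (@pseries_diffs R) a.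
have step k : (forall y, `|y| < r -> derive1n k f y = limn (pseries (d k) y)) ->
    forall x, `|x| < r -> is_derive x 1 (derive1n k f) (limn (pseries (d k.+1) x)).
  move=> Hk x xr; apply: near_eq_is_derive (derive_pseries (geo_bounded_iter_diffs k ga) xr).
  by apply: filterS (near_norm_lt xr) => y yr; rewrite Hk.
have E k : forall y, `|y| < r -> derive1n k f y = limn (pseries (d k) y).
  elim: k => [|k IH] y yr; first exact: fa.
  by rewrite derive1nS derive1E; case: (step k IH y yr) => _ ->.
by move=> k x xr; split; [exact: E|case: (step k (E k) x xr)].
Qed.

Lemma derive1n_pseries0 a r f k : 0 < r -> geo_bounded a r ->
  (forall x, `|x| < r -> f x = limn (pseries a x)) ->
  derive1n k f 0 = k`!%:R * a k.
Proof.
move=> r0 ga fa; have [|-> _] := derive1n_pseries ga fa k (x := 0).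
  by rewrite normr0.
by rewrite lim_pseries0 iter_pseries_diffs0.
Qed.

End PowerSeries.

Lemma le_of_derive_ge0 (R : realType) (g dg : R -> R) (a b : R) : a <= b ->
  (forall x, a <= x <= b -> is_derive x 1 g (dg x)) ->
  (forall x, a <= x <= b -> 0 <= dg x) -> g a <= g b.
Proof.
move=> b0 Dg dg0; apply: (@ger0_derive1_le_cc _ g a b) => //.
- by move=> x /subset_itv_oo_cc; rewrite in_itv => /Dg [].
- move=> x /subset_itv_oo_cc; rewrite in_itv /= => xb.
  by rewrite derive1E; have [_ ->] := Dg x xb; exact: dg0.
- apply: derivable_within_continuous => x; rewrite in_itv /= => xb.
  by have [] := Dg x xb.
- by rewrite in_itv /= lexx.
- by rewrite in_itv /= lexx b0.
Qed.

Lemma is_derive_cmul (R : realType) (f : R -> R) (x c df : R) :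
  is_derive x 1 f df -> is_derive x 1 (fun y => c * f y) (c * df).
Proof. by move=> D; have := is_deriveZ c D; exact. Qed.

Lemma is_derive_monomial (R : realType) (x c : R) n :
  is_derive x 1 (fun y => c * y ^+ n) (c * (n%:R * x ^+ n.-1)).
Proof.
apply: is_derive_cmul.
by have := is_deriveX n (is_derive_id x 1); rewrite exprfctE /GRing.scale /= mulr1.
Qed.

(** * Bernstein's theorem on absolutely monotone functions *)

(* The Taylor remainder [rem n] of an absolutely monotone function satisfies
   [rem n (t * y) <= t ^ n * rem n y], because the derivative of [rem n.+1] is
   the [n]-th remainder of the (again absolutely monotone) derivative. *)
Section Bernstein.
Local Arguments derive1n : simpl never.
Variables (R : realType) (f : R -> R).
Hypothesis f_smooth : smooth_on (-1) 1 f.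
Hypothesis f_ge0 : forall k x, x \in `]-1, 1[ -> 0 <= derive1n k f x.

Let F k : R -> R := derive1n k f.
Let a k : R := F k 0 / k`!%:R.

(** Taylor polynomial at 0, with n terms, of the j-th derivative. Keeping j as an index lets
    inductions on n pass from a remainder to its derivative. *)
Fixpoint taylor n j (x : R) : R :=
  if n is n'.+1 then taylor n' j x + F (j + n') 0 / n'`!%:R * x ^+ n' else 0.
Let rem n j (x : R) : R := F j x - taylor n j x.

Let F_ge0 j (x : R) : `|x| < 1 -> 0 <= F j x.
Proof. by move=> x1; apply: f_ge0; rewrite in_itv /= -ltr_norml. Qed.

Let deriveF j (x : R) : `|x| < 1 -> is_derive x 1 (F j) (F j.+1 x).
Proof.
move=> x1; have /f_smooth D : x \in `]-1, 1[ by rewrite in_itv /= -ltr_norml.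
by apply: DeriveDef; [exact: D|rewrite /F derive1nS derive1E].
Qed.

Let derive_taylor n j (x : R) : is_derive x 1 (taylor n.+1 j) (taylor n j.+1 x).
Proof.
elim: n => [|n IH].
  rewrite (_ : taylor 1 j = cst (F (j + 0) 0 / 0`!%:R)); last first.
    by apply/funext => y /=; rewrite expr0 mulr1 add0r.
  exact: is_derive_cst.
pose c := F (j + n.+1) 0 / n.+1`!%:R.
apply: (is_derive_eq (is_deriveD IH (is_derive_monomial x c n.+1))); rewrite /=; congr (_ + _).
rewrite /c addnS factS natrM.
have n0 : n`!%:R != 0 :> R by rewrite pnatr_eq0 -lt0n fact_gt0.
have n1 : n.+1%:R != 0 :> R by rewrite pnatr_eq0.
by field; rewrite n0 nat1r n1.
Qed.

Let derive_rem n j (x : R) : `|x| < 1 -> is_derive x 1 (rem n.+1 j) (rem n j.+1 x).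
Proof.
move=> x1; have D1 := deriveF j x1; have D2 := derive_taylor n j x.
exact: is_deriveB.
Qed.

Let rem0 n j : rem n.+1 j 0 = 0.
Proof.
rewrite /rem; suff -> : taylor n.+1 j 0 = F j 0 by rewrite subrr.
elim: n => [|n IH]; first by rewrite /= expr0 addn0 fact0 divr1 mulr1 add0r.
by rewrite [LHS]/= -/(taylor n.+1 j 0) IH expr0n /= mulr0 addr0.
Qed.

Let abs_lt1 (x y : R) : 0 <= x <= y -> y < 1 -> `|x| < 1.
Proof. by move=> /andP[x0 xy] y1; rewrite ger0_norm // (le_lt_trans xy). Qed.

Let rem_ge0 n j (y : R) : 0 <= y < 1 -> 0 <= rem n j y.
Proof.
elim: n j y => [|n IH] j y /andP[y0 y1].
  by rewrite /rem subr0 F_ge0 // ger0_norm.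
rewrite -(rem0 n j); apply: (le_of_derive_ge0 (dg := rem n j.+1)) => // x xy.
  exact/derive_rem/abs_lt1/y1.
by apply: IH; have /andP[-> /le_lt_trans ->] := xy.
Qed.

Let rem_homo n j (t y : R) : 0 <= t <= 1 -> 0 <= y < 1 ->
  rem n j (t * y) <= t ^+ n * rem n j y.
Proof.
move=> t01; have /andP[t0 t1] := t01.
have ty x y' : 0 <= x <= y' -> y' < 1 -> 0 <= t * x <= y'.
  move=> /andP[x0 xy] y1; rewrite mulr_ge0 //= (le_trans _ xy) //.
  by rewrite ler_piMl.
elim: n j y => [|n IH] j y /andP[y0 y1].
  rewrite expr0 mul1r /rem !subr0.
  have /andP[ty0 tyy] : 0 <= t * y <= y by apply: ty; rewrite ?y0 ?lexx.
  apply: (le_of_derive_ge0 (g := F j) (dg := F j.+1) tyy) => x /andP[x1 x2].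
    by apply/deriveF/(@abs_lt1 _ y); rewrite ?(le_trans ty0).
  by apply/F_ge0/(@abs_lt1 _ y); rewrite ?(le_trans ty0).
pose g x := t ^+ n.+1 * rem n.+1 j x - rem n.+1 j (t * x).
rewrite -subr_ge0 -/(g y); have <- : g 0 = 0 by rewrite /g mulr0 rem0 mulr0 subrr.
pose dg x := t ^+ n.+1 * rem n j.+1 x - t * rem n j.+1 (t * x).
apply: (le_of_derive_ge0 (g := g) (dg := dg) y0) => x xy.
  have x1 := abs_lt1 xy y1.
  have tx1 := abs_lt1 (ty _ _ xy y1) y1.
  have D1 := derive_rem n j x1; have D2 := derive_rem n j tx1.
  have D3 : is_derive x 1 (rem n.+1 j \o ( *%R t)) (rem n j.+1 (t * x) * t).
    apply: is_derive1_comp.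
    by have := is_derive_cmul t (is_derive_id x 1); rewrite mulr1.
  apply: (is_derive_eq (is_deriveB (is_derive_cmul (t ^+ n.+1) D1) D3)).
  by rewrite /dg [rem _ _ _ * t]mulrC.
rewrite /dg exprS -mulrA -mulrBr mulr_ge0 // subr_ge0 IH //.
by have /andP[-> /le_lt_trans ->] := xy.
Qed.

(** Lagrange's bound to the left of 0: [F (j + n)] is nondecreasing, so on [-y, 0] it is at most its
    value at 0, and n integrations give the power of y. *)
Let norm_rem_opp n j (y : R) : 0 <= y < 1 ->
  `|rem n j (- y)| <= F (j + n) 0 / n`!%:R * y ^+ n.
Proof.
elim: n j y => [|n IH] j y /andP[y0 y1].
  rewrite expr0 addn0 fact0 divr1 mulr1 /rem subr0 ger0_norm; last first.
    by rewrite F_ge0 // normrN ger0_norm.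
  apply: (le_of_derive_ge0 (dg := F j.+1)) => [|x /andP[x1 x2]|x /andP[x1 x2]].
  - by rewrite oppr_le0.
  - by apply: deriveF; rewrite ler0_norm // (le_lt_trans _ y1) // lerNl.
  - by apply: F_ge0; rewrite ler0_norm // (le_lt_trans _ y1) // lerNl.
set c := F _ _; pose b := c / n`!%:R.
have n0 : n`!%:R != 0 :> R by rewrite pnatr_eq0 -lt0n fact_gt0.
have n1 : n.+1%:R != 0 :> R by rewrite pnatr_eq0.
(* The signs e = 1 and e = -1 give the two halves of the absolute value at once. *)
have key (e : R) : `|e| = 1 -> 0 <= c / n.+1`!%:R * y ^+ n.+1 - e * rem n.+1 j (- y).
  move=> e1; pose g x := c / n.+1`!%:R * x ^+ n.+1 - e * rem n.+1 j (- x).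
  rewrite -/(g y); have <- : g 0 = 0.
    by rewrite /g oppr0 rem0 expr0n /= !mulr0 subrr.
  pose dg x := b * x ^+ n + e * rem n j.+1 (- x).
  apply: (le_of_derive_ge0 (g := g) (dg := dg) y0) => x xy.
    have x1 : `|- x| < 1 by rewrite normrN (abs_lt1 xy).
    have D2 := derive_rem n j x1.
    have D3 : is_derive x 1 (rem n.+1 j \o -%R) (rem n j.+1 (- x) * -1).
      by apply: is_derive1_comp.
    apply: (is_derive_eq (is_deriveB (is_derive_monomial x _ n.+1)
      (is_derive_cmul e D3))).
    rewrite /dg /b factS natrM mulrN1 mulrN opprK; congr (_ + _).
    by rewrite /=; field; rewrite n0 nat1r n1.
  have x1 : 0 <= x < 1 by have /andP[-> /le_lt_trans ->] := xy.
  rewrite /dg addrC -lerBlDl sub0r.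
  apply: (@le_trans _ _ `|rem n j.+1 (- x)|).
    by rewrite -[leRHS]mul1r -[in leRHS]e1 -normrM -normrN ler_norm.
  by apply: le_trans (IH j.+1 x x1) _; rewrite /b /c addSnnS.
rewrite ler_norml -subr_ge0 opprK; apply/andP; split.
  by have := key (-1); rewrite normrN1 mulN1r opprK addrC; exact.
by rewrite -subr_ge0; have := key 1; rewrite normr1 mul1r; exact.
Qed.

Let taylorE n x : taylor n 0 x = series (fun k => a k * x ^+ k) n.
Proof.
elim: n => [|n IH]; first by rewrite /series /= big_geq.
by rewrite /series /= big_nat_recr //= IH.
Qed.

Let a_ge0 k : 0 <= a k.
Proof. by rewrite divr_ge0 // F_ge0 // normr0. Qed.

Let term_ge0 k (x : R) : 0 <= x -> 0 <= a k * x ^+ k.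
Proof. by move=> x0; rewrite mulr_ge0 ?exprn_ge0. Qed.

(** A single term at s is at most the Taylor polynomial, which is at most f s because the remainder
    is non-negative. *)
Lemma bernstein_bounded : geo_bounded a 1.
Proof.
move=> s s0 s1; exists (f s) => k; rewrite ger0_norm //.
have := @rem_ge0 k.+1 0 s; rewrite ltW // s1 => /(_ isT).
rewrite /rem subr_ge0 => /(le_trans _); apply => /=.
rewrite add0n lerDr taylorE; apply: sumr_ge0 => i _.
by apply: term_ge0; exact: ltW.
Qed.

Lemma bernstein x : `|x| < 1 -> f x = limn (pseries a x).
Proof.
move=> x1; apply/esym/cvg_lim => //.
suff H : rem ^~ 0%N ^~ x @ \oo --> (0 : R).
  have -> : pseries a x = fun n => f x - rem n 0 x.
    by apply/funext => n; rewrite /rem opprB addrC subrK taylorE.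
  by rewrite -[X in _ --> X]subr0; apply: cvgB => //; exact: cvg_cst.
have [x0|x0] := leP 0 x.
  (* With room up to y, homogeneity bounds the remainder at x by (x/y)^n f(y). *)
  have [y xy y1] : exists2 y, x < y & y < 1.
    by exists ((x + 1) / 2); move: x1; rewrite ger0_norm //; lra.
  have y0 := le_lt_trans x0 xy.
  have q0 : 0 <= x / y by rewrite divr_ge0 // ltW.
  have q1 : x / y < 1 by rewrite ltr_pdivrMr // mul1r.
  apply: (@squeeze_cvgr _ _ _ _ (cst 0) (geometric (f y) (x / y))) => //.
  - near=> n; apply/andP; split.
      by apply: rem_ge0; rewrite x0 -(ger0_norm x0).
    have := @rem_homo n 0 (x / y) y; rewrite divfK ?gt_eqF // => H.
    rewrite /geometric /= mulrC; apply: le_trans (H _ _) _.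
    + by rewrite q0 ltW.
    + by rewrite ltW.
    rewrite ler_wpM2l ?exprn_ge0 // /rem lerBlDr lerDl taylorE.
    by apply: sumr_ge0 => i _; apply: term_ge0; exact: ltW.
  - exact: cvg_cst.
  - by apply: cvg_geometric; rewrite ger0_norm.
(* For negative x the Lagrange bound is the n-th term of the series at -x, which converges and so
   has vanishing terms. *)
have A : (fun n => a n * (- x) ^+ n) @ \oo --> (0 : R).
  apply: cvg_series_cvg_0; apply: (geo_cvg bernstein_bounded).
  by rewrite normrN.
apply/norm_cvg0P.
apply: (@squeeze_cvgr _ _ _ _ (cst 0) (fun n => a n * (- x) ^+ n)) => //.
  near=> n; rewrite /= normr_ge0 /=.
  have := @norm_rem_opp n 0 (- x); rewrite opprK; apply.
  by rewrite oppr_ge0 ltW //= -(ltr0_norm x0).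
exact: cvg_cst.
Unshelve. all: by end_near. Qed.

End Bernstein.

(** * Closure properties of the growth bound *)

Section GeoBounded.
Variable R : realType.
Implicit Types (a b : nat -> R) (r : R).

Lemma geo_boundedD a b r : geo_bounded a r -> geo_bounded b r ->
  geo_bounded (fun k => a k + b k) r.
Proof.
move=> ga gb s s0 sr; have [K HK] := ga s s0 sr; have [L HL] := gb s s0 sr.
exists (K + L) => k; apply: le_trans (lerD (HK k) (HL k)).
by rewrite -mulrDl ler_wpM2r ?exprn_ge0 ?ler_normD // ltW.
Qed.

Lemma geo_boundedZ c a r : geo_bounded a r -> geo_bounded (fun k => c * a k) r.
Proof.
move=> ga s s0 sr; have [K HK] := ga s s0 sr.
by exists (`|c| * K) => k; rewrite normrM -mulrA ler_wpM2l.
Qed.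

Lemma geo_bounded_shift i a r :
  geo_bounded a r -> geo_bounded (fun k => a (k + i)%N) r.
Proof.
move=> ga s s0 sr; have [K HK] := ga s s0 sr.
exists (K / s ^+ i) => k.
by rewrite ler_pdivlMr ?exprn_gt0 // -mulrA -exprD.
Qed.

Lemma geo_bounded_sum n (c : 'I_n -> nat -> R) r :
  (forall i, geo_bounded (c i) r) -> geo_bounded (fun k => \sum_i c i k) r.
Proof.
elim: n c => [|n IH] c gc.
  by move=> s s0 sr; exists 0 => k; rewrite big_ord0 normr0 mul0r.
have -> : (fun k => \sum_i c i k) = fun k => \sum_i c (widen_ord (leqnSn n) i) k + c ord_max k.
  by apply/funext => k; rewrite big_ord_recr.
by apply: geo_boundedD => //; apply: IH.
Qed.

End GeoBounded.

(** * Hankel positivity and complete monotonicity *)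

Section MomentFunctional.
Variable R : realType.
Implicit Types (b : nat -> R) (p q : {poly R}).

(** The Riesz functional of the sequence: ['X^i] is sent to [b i]. Shifts and differences of [b]
    become multiplication by polynomials. *)
Definition moment b p : R := \sum_(i < size p) p`_i * b i.

Lemma moment_widen b p n : (size p <= n)%N -> moment b p = \sum_(i < n) p`_i * b i.
Proof.
move=> pn; rewrite /moment (big_ord_widen n (fun i => p`_i * b i)) //.
rewrite big_mkcond /=; apply: eq_bigr => i _; case: ltnP => // pi.
by rewrite nth_default ?mul0r.
Qed.

Lemma momentD b p q : moment b (p + q) = moment b p + moment b q.
Proof.
pose n := maxn (size p) (size q).
rewrite (@moment_widen _ (p + q) n) ?size_polyD //.
rewrite (@moment_widen _ p n) ?leq_maxl // (@moment_widen _ q n) ?leq_maxr //.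
by rewrite -big_split; apply: eq_bigr => i _ /=; rewrite coefD mulrDl.
Qed.

Lemma momentZ b c p : moment b (c *: p) = c * moment b p.
Proof.
rewrite (@moment_widen _ (c *: p) (size p)) ?size_scale_leq // mulr_sumr.
by apply: eq_bigr => i _; rewrite coefZ mulrA.
Qed.

Lemma moment0 b : moment b 0 = 0.
Proof. by rewrite /moment size_poly0 big_ord0. Qed.

Lemma momentN b p : moment b (- p) = - moment b p.
Proof. by rewrite -scaleN1r momentZ mulN1r. Qed.

Lemma moment_sum b n (p : 'I_n -> {poly R}) :
  moment b (\sum_i p i) = \sum_i moment b (p i).
Proof. exact: (big_morph _ (momentD b) (moment0 b)). Qed.

Lemma momentMX b p : moment b ('X * p) = moment (fun k => b k.+1) p.
Proof.
rewrite (@moment_widen _ ('X * p) (size p).+1); last first.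
  by rewrite (leq_trans (size_polyMleq _ _)) // size_polyX.
rewrite big_ord_recl coefXM mul0r add0r; apply: eq_bigr => i _.
by rewrite coefXM.
Qed.

Lemma momentMXn b k p : moment b ('X^k * p) = moment (fun i => b (i + k)%N) p.
Proof.
elim: k b => [|k IH] b.
  by rewrite expr0 mul1r; congr moment; apply/funext => i; rewrite addn0.
rewrite exprS -mulrA momentMX IH; congr moment.
by apply/funext => i; rewrite addnS.
Qed.

Lemma moment_seqB b b' p :
  moment (fun k => b k - b' k) p = moment b p - moment b' p.
Proof. by rewrite -sumrB; apply: eq_bigr => i _ /=; rewrite mulrBr. Qed.

Lemma momentXn b k : moment b 'X^k = b k.
Proof.
rewrite -[X in moment _ X]mulr1 momentMXn /moment size_poly1 big_ord1.
by rewrite coef1 mul1r.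
Qed.

(** The value at X^j (1-X)^m is the m-th alternating difference of [b] at j, so this is Hausdorff's
    condition. *)
Definition completely_monotone b := forall j m,
  0 <= moment b ('X^j * (1 - 'X) ^+ m).

End MomentFunctional.

Section HankelPositive.
Variable R : realType.
Implicit Types (b : nat -> R) (p q : {poly R}).

(** The two positivity conditions are Stieltjes' conditions for a measure on the half-line; the
    growth bound is what confines it to [0,1]. *)
Definition hankel_pos b := [/\ geo_bounded b 1, forall p, 0 <= moment b (p ^+ 2) &
  forall p, 0 <= moment b ('X * p ^+ 2)].

Lemma hankel_pos_Xn b k p : hankel_pos b -> 0 <= moment b ('X^k * p ^+ 2).
Proof.
move=> [_ H0 H1]; rewrite -(odd_double_half k) exprD -muln2 exprM -mulrA -exprMn.
by case: (odd k); rewrite ?expr1 ?expr0 ?mul1r.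
Qed.

(* Positivity on ['X^k * p^2 * (t - 'X)^2] makes the sequence
   [moment b ('X^k * p^2)] log-convex; if it ever increased it would grow
   geometrically with a ratio > 1. *)
Lemma hankel_pos_nonincr b p : hankel_pos b ->
  moment b ('X * p ^+ 2) <= moment b (p ^+ 2).
Proof.
move=> Hb; pose s k := moment b ('X^k * p ^+ 2).
have s_ge0 k : 0 <= s k by exact: hankel_pos_Xn.
have s_conv t k : 0 <= t ^+ 2 * s k - 2 * t * s k.+1 + s k.+2.
  have := hankel_pos_Xn k ((t%:P - 'X) * p) Hb.
  have -> : 'X^k * ((t%:P - 'X) * p) ^+ 2 =
     t ^+ 2 *: ('X^k * p ^+ 2) - (2 * t) *: ('X^(k.+1) * p ^+ 2) + 'X^(k.+2) * p ^+ 2.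
    by rewrite -!mul_polyC !exprS !polyCM; ring.
  by rewrite !momentD momentN !momentZ.
have gs : geo_bounded s 1.
  have [gb _ _] := Hb.
  have -> : s = fun k => \sum_(i < size (p ^+ 2)) (p ^+ 2)`_i * b (k + i)%N.
    apply/funext => k; rewrite /s momentMXn; apply: eq_bigr => i _.
    by rewrite addnC.
  by apply: geo_bounded_sum => i; apply: geo_boundedZ; apply: geo_bounded_shift.
rewrite -[X in _ <= moment b X]mul1r -['X in leLHS]expr1 -(expr0 'X) -/(s 0) -/(s 1).
rewrite leNgt; apply/negP => s01.
have s1 : 0 < s 1%N by apply: le_lt_trans s01.
(* The ratio is s 1 / s 0; when s 0 vanishes any t > 1 serves. *)
have [t t1 st] : exists2 t, 1 < t & t * s 0%N <= s 1%N.
  have [s00|s0] := eqVneq (s 0%N) 0; first by exists 2; rewrite ?s00 ?mulr0 ?ltW; lra.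
  exists (s 1%N / s 0%N); last by rewrite divfK.
  by rewrite ltr_pdivlMr ?mul1r // lt0r s0 s_ge0.
have t0 : 0 < t by lra.
(* By induction s (k+2) >= 2t s (k+1) - t^2 s k >= t s (k+1). *)
have sS k : t * s k <= s k.+1.
  elim: k => // k IH; have := s_conv t k.
  have := ler_wpM2l (ltW t0) IH; rewrite mulrA -expr2; lra.
have sk k : s 1%N * t ^+ k <= s k.+1.
  elim: k => [|k IH]; first by rewrite expr0 mulr1.
  by rewrite exprS mulrCA (le_trans _ (sS k.+1)) // ler_wpM2l // ltW.
(* At 1/t < 1 the growth bound forces s k / t^k to 0, while growth keeps it at least s 1 / t from k
   = 1 on. *)
have ti1 : `|t^-1| < 1 by rewrite ger0_norm ?invr_ge0 ?ltW // invf_lt1.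
have [K [q [K0 q0 q1 H]]] := geo_bounded_split gs ti1.
have /cvgrPdist_lt : geometric K q @ \oo --> (0 : R).
  by apply: cvg_geometric; rewrite ger0_norm.
move=> /(_ (s 1%N / t) (divr_gt0 s1 t0)) [n _ /(_ n.+1 (leqnSn n))] /=.
rewrite sub0r normrN ger0_norm ?mulr_ge0 ?exprn_ge0 //.
apply/negP; rewrite -leNgt; apply: le_trans (H n.+1).
apply: le_trans (ler_norm _).
rewrite exprVn ler_pdivlMr ?exprn_gt0 // mulrAC ler_pdivrMr //.
by rewrite exprS mulrCA [leRHS]mulrC ler_wpM2l // ltW.
Qed.

(** Its functional is that of [b] after multiplication by 1-X. Positivity on p^2 and X p^2 is the
    monotonicity just proved, for [b] and for its shift; the shift is Hankel positive because X^2
    p^2 is a square. *)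
Lemma hankel_pos_diff b : hankel_pos b -> hankel_pos (fun k => b k - b k.+1).
Proof.
move=> Hb; have [gb H0 H1] := Hb; split.
- have -> : (fun k => b k - b k.+1) = fun k => b k + (-1) * b (k + 1)%N.
    by apply/funext => k; rewrite mulN1r addn1.
  by apply: geo_boundedD => //; apply/geo_boundedZ/geo_bounded_shift.
- by move=> p; rewrite moment_seqB -momentMX subr_ge0 hankel_pos_nonincr.
move=> p; rewrite moment_seqB -momentMX subr_ge0.
have Hb1 : hankel_pos (fun k => b k.+1).
  split.
  - rewrite (_ : (fun k => _) = fun k => b (k + 1)%N); first exact: geo_bounded_shift.
    by apply/funext => k; rewrite addn1.
  - by move=> q; rewrite -momentMX.
  - move=> q; rewrite -momentMX mulrA -expr2; exact: hankel_pos_Xn.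
by rewrite momentMX [leRHS]momentMX; apply: hankel_pos_nonincr.
Qed.

Lemma completely_monotone_hankel b : hankel_pos b -> completely_monotone b.
Proof.
move=> Hb j m; elim: m b Hb => [|m IH] b Hb.
  by have := hankel_pos_Xn j 1 Hb; rewrite expr0 expr1n.
have := IH _ (hankel_pos_diff Hb); rewrite moment_seqB -momentMX -momentN -momentD.
by rewrite exprS; congr (0 <= moment b _); ring.
Qed.

End HankelPositive.

(** * Hausdorff's moment theorem *)

Section StieltjesMeasure.
Variables (R : realType) (G : R -> R).
Hypothesis G_homo : {homo G : x y / x <= y}.
Hypothesis G_lt0 : forall x, x < 0 -> G x = 0.

(** Right-continuous regularisation of [G]: a pointwise limit of distribution functions may fail to
    be right-continuous at its jumps. *)
Let H x := inf [set G y | y in `]x, +oo[].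

Let H_has_inf x : has_inf [set G y | y in `]x, +oo[].
Proof.
split; first by exists (G (x + 1)); exists (x + 1) => //=; rewrite in_itv /= ltrDl ltr01.
by exists (G x) => _ [y /= xy <-]; apply: G_homo; move: xy; rewrite in_itv /= andbT => /ltW.
Qed.

Let H_le x y : x < y -> H x <= G y.
Proof.
move=> xy; apply: ge_inf; first by have [] := H_has_inf x.
by exists y => //=; rewrite in_itv /= xy.
Qed.

Let H_ge x : G x <= H x.
Proof.
apply: lb_le_inf; first by have [] := H_has_inf x.
by move=> _ [y /= xy <-]; apply: G_homo; move: xy; rewrite in_itv /= andbT => /ltW.
Qed.

Let H_nd : {homo H : x y / x <= y}.
Proof.
move=> x y; rewrite le_eqVlt => /predU1P[->//|xy].
by apply: le_trans (H_le xy) (H_ge y).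
Qed.

Let H_rc : right_continuous H.
Proof.
move=> x; apply/cvgrPdist_lt => e e0.
have [_ [y /= xy <-] Hy] := inf_adherent e0 (H_has_inf x).
rewrite in_itv /= andbT in xy.
near=> z.
have xz : x <= z by apply: ltW; near: z; exact: nbhs_right_gt.
have zy : z < y by near: z; exact: nbhs_right_lt.
rewrite distrC ger0_norm ?subr_ge0 ?H_nd // ltrBlDl.
exact: le_lt_trans (H_le zy) Hy.
Unshelve. all: by end_near. Qed.

(** At a jump the distribution function [F] may differ from [G], so only the sandwich is claimed; on
    a grid it costs one step. *)
Lemma stieltjes_measure01 :
  exists (mu : {finite_measure set (measurableTypeR R) -> \bar R}) (F : R -> R),
  [/\ supported_in mu `[0, 1],
      forall x, 0 <= x <= 1 -> mu `[0, x]%classic = (F x)%:E &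
      forall x y, x < y -> G x <= F x <= G y].
Proof.
pose Hc : cumulative R R := HB.pack H (isCumulative.Build R _ R H H_nd H_rc).
pose mu0 := lebesgue_stieltjes_measure Hc.
have mu0E a b : a <= b -> mu0 `]a, b]%classic = (H b - H a)%:E.
  move=> ab; rewrite /mu0 /lebesgue_stieltjes_measure /measure_extension.
  rewrite measurable_mu_extE; last exact: is_ocitv.
  by rewrite /= wlength_itv_bnd.
have H_lt0 x : x < 0 -> H x = 0.
  move=> x0; apply/eqP; rewrite eq_le; apply/andP; split.
    by rewrite -(G_lt0 (x := x / 2)) ?H_le //; lra.
  by rewrite -(G_lt0 x0) H_ge.
(* The interval starts to the left of 0 so that a jump at 0 becomes an atom of the restricted
   measure. *)
have mD : measurable (`]-1, 1]%classic : set (measurableTypeR R)).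
  exact: measurable_itv.
have finD : (mu0 `](-1)%R, 1%R]%classic < +oo)%E by rewrite mu0E ?ltry //; lra.
pose mu : {finite_measure set (measurableTypeR R) -> \bar R} := mfrestr mD finD.
have muE (A : set R) : mu A = mu0 (A `&` `]-1, 1]) by [].
(* Half-open intervals ending at -1/(n+1) have mass 0 and cover ]-1, 0[, so nothing is lost or added
   left of 0. *)
have null : mu0 `]-1, 0[%classic = 0%E.
  apply/eqP; rewrite eq_le measure_ge0 andbT.
  pose A n := `](-1 : R), - n.+1%:R^-1]%classic.
  have A0 n : mu0 (A n) = 0%E.
    have n1 : n.+1%:R^-1 <= 1 :> R by rewrite invf_le1 ?ler1n.
    by rewrite mu0E ?lerN2 // !H_lt0 ?subrr // oppr_lt0.
  suff : (mu0 `](-1)%R, 0%R[%classic <= \sum_(0 <= n <oo) mu0 (A n))%E.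
    by rewrite eseries0 // => n _ _; exact: A0.
  apply: measure_sigma_subadditive => [n||x /=]; [exact: measurable_itv..|].
  rewrite in_itv /= => /andP[x1 x0].
  have [n xn] := ltr_add_invr x0.
  by exists n => //; rewrite /A /= in_itv /= x1 -subr_le0 opprK ltW.
have mI (i : interval R) : measurable ([set` i] : set (measurableTypeR R)).
  exact: measurable_itv.
exists mu, H; split.
- rewrite /supported_in muE -[RHS]null; congr (mu0 _); apply/seteqP.
  split=> x /=; rewrite !in_itv /=.
    by move=> [/negP]; rewrite negb_and -!ltNge => /orP[]; lra.
  by move=> /andP[x1 x0]; split; [apply/negP; rewrite negb_and -!ltNge x0|lra].
- move=> x /andP[x0 x1]; rewrite muE.
  have -> : (`[0, x] `&` `]-1, 1] = `[0, x])%classic.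
    by apply/seteqP; split=> y /=; rewrite !in_itv /=; [case|move=> ?; split=> //; lra].
  have := mu0E (-1) x; rewrite (@H_lt0 (-1)) ?subr0; last by lra.
  move=> <-; last by lra.
  rewrite -[LHS]add0e -{1}null -measureU //.
    congr (mu0 _); apply/seteqP; split=> y /=; rewrite !in_itv /=.
      by case; lra.
    by move=> y1; case: (ltP y 0) => y0; [left|right]; lra.
  by apply/seteqP; split=> y //=; rewrite !in_itv /=; case; lra.
- by move=> x y xy; rewrite H_ge H_le.
Qed.

End StieltjesMeasure.

Lemma integrable_continuous_itv (R : realType)
    (mu : {finite_measure set (measurableTypeR R) -> \bar R}) (a b : R) (g : R -> R) :
  {within `[a, b], continuous g} -> mu.-integrable `[a, b]%classic (EFin \o g).
Proof.
move=> cg; have mab : measurable (`[a, b]%classic : set (measurableTypeR R)).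
  exact: measurable_itv.
apply: measurable_bounded_integrable => //.
- by rewrite ltey_eq fin_num_measure.
- exact: subspace_continuous_measurable_fun.
have /compact_bounded [C [Cr HC]] : compact (g @` `[a, b]).
  by apply: continuous_compact => //; exact: segment_compact.
exists C; split => // M CM x xab.
by apply: (HC M CM); exists x.
Qed.

Section Integral01.
Variables (R : realType) (mu : {finite_measure set (measurableTypeR R) -> \bar R}).
Implicit Types (g h : R -> R).

Definition I01 : set (measurableTypeR R) := `[0%R, 1%R]%classic.
Definition int01 g : R := \int[mu]_(x in I01) g x.
Definition integrable01 g := mu.-integrable I01 (EFin \o g).

Lemma I01E x : I01 x = (0 <= x <= 1) :> Prop.
Proof. by rewrite /I01 /= in_itv. Qed.

Lemma measurable_I01 : measurable I01. Proof. exact: measurable_itv. Qed.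
Hint Resolve measurable_I01 : core.

Lemma finite_I01 : (mu I01 < +oo)%E.
Proof. by rewrite ltey_eq fin_num_measure. Qed.

Lemma integrable01_bounded g C : measurable_fun I01 g ->
  (forall x, 0 <= x <= 1 -> `|g x| <= C) -> integrable01 g.
Proof.
move=> mg gC; apply: measurable_bounded_integrable => //; first exact: finite_I01.
exists C; split; first exact: num_real.
move=> y Cy x; rewrite /= I01E => x01; exact: le_trans (gC x x01) (ltW Cy).
Qed.

Lemma integrable01_continuous g : {within I01, continuous g} -> integrable01 g.
Proof. exact: integrable_continuous_itv. Qed.

Lemma int01_ext g h : (forall x, 0 <= x <= 1 -> g x = h x) -> int01 g = int01 h.
Proof.
by move=> gh; apply: eq_Rintegral => x; rewrite inE I01E => /gh.
Qed.

Lemma int01D g h : integrable01 g -> integrable01 h ->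
  int01 (fun x => g x + h x) = int01 g + int01 h.
Proof. by move=> ig ih; rewrite /int01 RintegralD. Qed.

Lemma int01B g h : integrable01 g -> integrable01 h ->
  int01 (fun x => g x - h x) = int01 g - int01 h.
Proof. by move=> ig ih; rewrite /int01 RintegralB. Qed.

Lemma int01Z c g : integrable01 g -> int01 (fun x => c * g x) = c * int01 g.
Proof. by move=> ig; rewrite /int01 RintegralZl. Qed.

Lemma integrable01D g h : integrable01 g -> integrable01 h ->
  integrable01 (fun x => g x + h x).
Proof. by move=> ig ih; have := integrableD measurable_I01 ig ih; exact. Qed.

Lemma integrable01Z c g : integrable01 g -> integrable01 (fun x => c * g x).
Proof. by move=> ig; have := integrableZl measurable_I01 c ig; exact. Qed.

Lemma integrable01_cst c : integrable01 (fun=> c).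
Proof. by have := finite_measure_integrable_cst mu c measurable_I01; exact. Qed.

Definition mass01 : R := fine (mu I01).

Lemma mass01_ge0 : 0 <= mass01. Proof. exact: fine_ge0. Qed.

Lemma int01_cst c : int01 (fun=> c) = c * mass01.
Proof. by rewrite /int01 Rintegral_cst. Qed.

Lemma le_int01 g h : integrable01 g -> integrable01 h ->
  (forall x, 0 <= x <= 1 -> g x <= h x) -> int01 g <= int01 h.
Proof.
move=> ig ih gh; apply: le_Rintegral => // x; rewrite I01E; exact: gh.
Qed.

Lemma int01_ge0 g : (forall x, 0 <= x <= 1 -> 0 <= g x) -> 0 <= int01 g.
Proof. by move=> g0; apply: Rintegral_ge0 => x; rewrite I01E; exact: g0. Qed.

Lemma int01_dist_le g h C : integrable01 g -> integrable01 h ->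
  (forall x, 0 <= x <= 1 -> `|g x - h x| <= C) -> `|int01 g - int01 h| <= C * mass01.
Proof.
move=> ig ih gh; rewrite -int01_cst ler_distl -int01B -?int01D //; last 2 first.
- exact: integrable01_cst.
- exact: integrable01_cst.
have iB := integrable01D ih (integrable01Z (-1) (integrable01_cst C)).
apply/andP; split.
  apply: le_int01 => // [|x /gh].
    by have := iB; under eq_fun do rewrite mulN1r; exact.
  by rewrite ler_distl => /andP[].
apply: le_int01 => // [|x /gh].
  by apply: integrable01D => //; exact: integrable01_cst.
by rewrite ler_distl => /andP[].
Qed.

Lemma integrable01_sum n (g : 'I_n -> R -> R) :
  (forall i, integrable01 (g i)) -> integrable01 (fun x => \sum_i g i x).
Proof.
elim: n g => [|n IH] g ig.
  by under eq_fun do rewrite big_ord0; exact: integrable01_cst.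
under eq_fun do rewrite big_ord_recr.
by apply: integrable01D => //; exact: IH.
Qed.

Lemma int01_sum n (g : 'I_n -> R -> R) : (forall i, integrable01 (g i)) ->
  int01 (fun x => \sum_i g i x) = \sum_i int01 (g i).
Proof.
elim: n g => [|n IH] g ig.
  by under eq_fun do rewrite big_ord0; rewrite int01_cst mul0r big_ord0.
under eq_fun do rewrite big_ord_recr.
rewrite int01D //; last exact: integrable01_sum.
by rewrite IH // big_ord_recr.
Qed.

Lemma integrable01_indic (c : R) : integrable01 (fun x => (x <= c)%R%:R).
Proof.
apply: (@integrable01_bounded _ 1) => [|x _]; last by case: (x <= c); rewrite ?normr1 ?normr0.
have -> : (fun x : R => (x <= c)%R%:R) = \1_(`]-oo, c]%classic) :> (R -> R).
  by apply/funext => x; rewrite indicE mem_setE in_itv.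
by apply: measurable_indic; exact: measurable_itv.
Qed.

Lemma int01_indic (c : R) : c <= 1 ->
  int01 (fun x => (x <= c)%R%:R) = fine (mu `[0, c]%classic).
Proof.
move=> c1; rewrite /int01 /Rintegral; congr fine.
have -> : (fun x : R => ((x <= c)%R%:R)%:E) = fun x => (\1_(`]-oo, c]%classic) x)%:E :> \bar R.
  by apply/funext => x; rewrite indicE mem_setE in_itv.
rewrite integral_indic //.
congr (mu _); apply/seteqP; split=> x; rewrite /setI /= I01E !in_itv /=; first by case; lra.
by move=> /andP[x0 xc]; rewrite xc x0 (le_trans xc).
Qed.

Lemma int01_expand g : integrable01 g ->
  (\int[mu]_(x in I01) (g x)%:E)%E = (int01 g)%:E.
Proof.
by move=> ig; rewrite /int01 /Rintegral fineK //; exact: integrable_fin_num.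
Qed.

End Integral01.
Arguments I01 {R}.
#[global] Hint Resolve measurable_I01 : core.

(** * Step approximations of powers *)

Section PowerSteps.
Variable R : realType.
Implicit Types x y : R.

Lemma exprn_lipschitz k x y : 0 <= x -> x <= y -> y <= 1 ->
  0 <= y ^+ k - x ^+ k <= k%:R * (y - x).
Proof.
move=> x0 xy y1; elim: k => [|k /andP[IH0 IH]]; first by rewrite !expr0 subrr mul0r lexx.
have y0 := le_trans x0 xy.
have -> : y ^+ k.+1 - x ^+ k.+1 = y * (y ^+ k - x ^+ k) + x ^+ k * (y - x).
  by rewrite !exprS; ring.
have xk : x ^+ k <= 1 by rewrite exprn_ile1 // (le_trans xy).
have xk0 : 0 <= x ^+ k by rewrite exprn_ge0.
have d0 : 0 <= y - x by rewrite subr_ge0.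
apply/andP; split; first by rewrite addr_ge0 ?mulr_ge0.
rewrite -nat1r mulrDl mul1r addrC; apply: lerD; first exact: ler_piMl.
by apply: le_trans IH; exact: ler_piMl.
Qed.

(** On [0,1] this rounds x up to the grid before taking the power. Summation by parts writes it with
    indicators of x <= i/N, so that its integral involves only the distribution function. *)
Definition pow_step k N x : R :=
  1 - \sum_(i < N) ((i.+1%:R / N%:R) ^+ k - (i%:R / N%:R) ^+ k) * (x <= i%:R / N%:R)%R%:R.

Lemma pow_step_dist k N x : (0 < N)%N -> 0 <= x <= 1 ->
  `|pow_step k N x - x ^+ k| <= k%:R / N%:R.
Proof.
move=> N0 /andP[x0 x1].
have NR : 0 < N%:R :> R by rewrite ltr0n.
pose g i : R := (i%:R / N%:R) ^+ k.
have exN : exists i, x <= i%:R / N%:R by exists N; rewrite divff // gt_eqF.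
(* m is the rounded-up index; the increments with i >= m survive and telescope to 1 - (m/N)^k. *)
case: (ex_minnP exN) => m xm minm.
have mN : (m <= N)%N by apply: minm; rewrite divff // gt_eqF.
have -> : pow_step k N x = g m.
  rewrite /pow_step (eq_bigr (fun i : 'I_N => if (m <= i)%N then g i.+1 - g i else 0)); last first.
    move=> i _; case: leqP => mi.
      by rewrite (le_trans xm) ?mulr1 // ler_pM2r ?invr_gt0 // ler_nat.
    by case: leP => [xi|_]; [have := minm i xi; lia|rewrite mulr0].
  rewrite -(big_mkord xpredT (fun i => if (m <= i)%N then g i.+1 - g i else 0)).
  rewrite (@big_cat_nat _ _ _ m) //= big_nat_cond big1 ?add0r; last first.
    by move=> i /andP[/andP[_ im] _]; rewrite leqNgt im.
  rewrite (eq_big_nat _ _ (F2 := fun i => g i.+1 - g i)); last first.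
    by move=> i /andP[mi _]; rewrite mi.
  rewrite telescope_sumr // /g divff ?gt_eqF // expr1n.
  by rewrite opprB addrC subrK.
have mN1 : m%:R / N%:R <= 1 :> R by rewrite ler_pdivrMr // mul1r ler_nat.
have /andP[g0 g1] := exprn_lipschitz k x0 xm mN1.
rewrite ger0_norm // (le_trans g1) // ler_wpM2l // lerBlDr.
case: m xm minm {mN mN1 g0 g1} => [|m] _ minm.
  by rewrite mul0r addr_ge0 // invr_ge0 ltW.
have /negP : ~ (x <= m%:R / N%:R) by move=> /minm; rewrite ltnn.
by rewrite -ltNge -natr1 mulrDl div1r addrC lerD2l => /ltW.
Qed.

End PowerSteps.

(** * Bernstein polynomials and approximate moments *)

Section BernsteinWeights.
Variable R : realType.
Implicit Types (b : nat -> R).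

(** The functional at the j-th Bernstein basis polynomial of degree n: the mass to be placed at
    j/n. *)
Definition bernstein_weight b n j : R :=
  moment b ('C(n, j)%:R *: ('X^j * (1 - 'X) ^+ (n - j))).

Lemma bernstein_weight_ge0 b n j : completely_monotone b -> 0 <= bernstein_weight b n j.
Proof. by move=> cb; rewrite /bernstein_weight momentZ mulr_ge0. Qed.

Lemma mul_bin_bin k m i : (i <= m)%N ->
  ('C(k + i, k) * 'C(k + m, k + i) = 'C(k + m, k) * 'C(m, i))%N.
Proof.
move=> im.
have p0 : (0 < k`! * (i`! * (m - i)`!))%N by rewrite !muln_gt0 !fact_gt0.
apply/eqP; rewrite -(eqn_pmul2r p0); apply/eqP.
have e1 := @bin_fact (k + i) k (leq_addr _ _).
have e2 : ('C(k + m, k + i) * ((k + i)`! * (m - i)`!) = (k + m)`!)%N.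
  have := @bin_fact (k + m) (k + i); rewrite leq_add2l im => /(_ isT).
  by rewrite subnDl.
have e3 := @bin_fact (k + m) k (leq_addr _ _).
have e4 := bin_fact im.
rewrite addKn in e1; rewrite addKn in e3.
transitivity (k + m)`!.
  by rewrite -e2 -e1; ring.
by rewrite -e3 -e4; ring.
Qed.

(** Binomial moments, unlike powers, are reproduced exactly: the Bernstein polynomials weighted by
    C(j,k) sum to C(n,k) X^k by the binomial theorem. *)
Lemma bernstein_moment b n k : (k <= n)%N ->
  \sum_(j < n.+1) 'C(j, k)%:R * bernstein_weight b n j = 'C(n, k)%:R * b k.
Proof.
move=> kn; rewrite -(subnKC kn); move: (n - k)%N => m {n kn}.
rewrite -addnS big_split_ord /= big1 ?add0r => [|i _]; last by rewrite bin_small ?mul0r.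
rewrite -(momentXn b k) -momentZ.
rewrite (eq_bigr (fun i : 'I_m.+1 =>
   moment b (('C(k + m, k))%:R *: ('X^k * ((1 - 'X) ^+ (m - i) * 'X^i *+ 'C(m, i)))))); last first.
  move=> i _; have im : (i <= m)%N by rewrite -ltnS.
  rewrite /bernstein_weight -momentZ; congr moment.
  rewrite scalerA -natrM mul_bin_bin // natrM -scalerA subnDl exprD.
  rewrite mulrnAr -[(_ * _) *+ _]scaler_nat; congr (_ *: (_ *: _)).
  by ring.
rewrite -moment_sum -scaler_sumr -mulr_sumr -exprDn subrK expr1n mulr1.
by [].
Qed.

Lemma bernstein_weight_sum b n : \sum_(j < n.+1) bernstein_weight b n j = b 0%N.
Proof.
have := bernstein_moment b (leq0n n); rewrite bin0 mul1r => <-.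
by apply: eq_bigr => j _; rewrite bin0 mul1r.
Qed.

(** The ratio is a product of factors (j-i)/(n-i) in [0,1], each within i/(n-i) of j/n, so the
    errors add up. *)
Lemma ffact_ratio_dist j n k : (j <= n)%N -> (k < n)%N ->
  `|(j ^_ k)%:R / (n ^_ k)%:R - (j%:R / n%:R) ^+ k| <= (k * k)%:R / (n - k)%:R :> R.
Proof.
move=> jn; have j01 : 0 <= (j%:R / n%:R : R) <= 1.
  rewrite divr_ge0 //=; case: n jn => [|n] jn; first by rewrite invr0 mulr0.
  by rewrite ler_pdivrMr // mul1r ler_nat.
have /andP[u0 u1] := j01.
elim: k => [|k IH] kn.
  by rewrite !ffactn0 expr0 divff // subrr normr0 mul0r.
have kn' : (k < n)%N by lia.
have n0 : 0 < n%:R :> R by rewrite ltr0n; lia.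
have nk0 : 0 < (n - k)%:R :> R by rewrite ltr0n; lia.
set u := j%:R / n%:R in u0 u1 IH *.
pose t : R := (j - k)%:R / (n - k)%:R.
pose r : R := (j ^_ k)%:R / (n ^_ k)%:R.
rewrite !ffactnSr !natrM invfM.
have -> : (j ^_ k)%:R * (j - k)%:R * ((n ^_ k)%:R^-1 / (n - k)%:R) - u ^+ k.+1 =
   (r - u ^+ k) * t + u ^+ k * (t - u).
  by rewrite /r /t exprS; ring.
have t0 : 0 <= t by rewrite divr_ge0.
have t1 : t <= 1 by rewrite ler_pdivrMr // mul1r ler_nat leq_sub2r.
have tu : `|t - u| <= k%:R / (n - k)%:R.
  have [kj|jk] := leqP k j.
    have -> : t - u = - (k%:R / (n - k)%:R * ((n%:R - j%:R) / n%:R)).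
      rewrite /t /u !natrB //; last by lia.
      rewrite natrB in nk0; last by lia.
      by field; rewrite !gt_eqF.
    rewrite normrN ger0_norm; last by rewrite !mulr_ge0 ?invr_ge0 // subr_ge0 ler_nat.
    rewrite ler_piMr ?divr_ge0 // ler_pdivrMr // mul1r gerBl //.
  (* For j < k the truncated difference is 0, and the error is j/n itself. *)
  rewrite /t (_ : (j - k)%N = 0%N); last by lia.
  rewrite mul0r sub0r normrN ger0_norm // /u.
  apply: ler_pM; rewrite ?invr_ge0 //; first by rewrite ler_nat; lia.
  by rewrite lef_pV2 ?posrE // ler_nat leq_subr.
rewrite (le_trans (ler_normD _ _)) // (normrM _ t) (normrM (u ^+ k)) (ger0_norm t0) normrX (ger0_norm u0).
apply: (@le_trans _ _ ((k * k)%:R / (n - k)%:R + k%:R / (n - k)%:R)).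
  apply: lerD.
    by apply: le_trans (IH kn'); rewrite ler_piMr.
  by apply: le_trans tu; rewrite ler_piMl // exprn_ile1.
rewrite -mulrDl -natrD; apply: ler_pM => //; first by rewrite -natrM ler_nat; nia.
by rewrite lef_pV2 ?posrE // ?ler_nat ?ltr0n; lia.
Qed.

Lemma bernstein_moment_dist b n k : completely_monotone b -> (k < n)%N ->
  `|\sum_(j < n.+1) bernstein_weight b n j * (j%:R / n%:R) ^+ k - b k|
    <= (k * k)%:R / (n - k)%:R * b 0%N.
Proof.
move=> cb kn.
have cnk : 'C(n, k)%:R != 0 :> R by rewrite pnatr_eq0 -lt0n bin_gt0 ltnW.
have -> : b k = \sum_(j < n.+1) bernstein_weight b n j * ((j ^_ k)%:R / (n ^_ k)%:R).
  apply: (mulfI cnk); rewrite -bernstein_moment ?(ltnW kn) // mulr_sumr.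
  apply: eq_bigr => j _; rewrite -!bin_ffact !natrM.
  have kf : k`!%:R != 0 :> R by rewrite pnatr_eq0 -lt0n fact_gt0.
  by field; apply/andP.
rewrite -sumrB (le_trans (ler_norm_sum _ _ _)) // -(bernstein_weight_sum b n) mulr_sumr.
apply: ler_sum => j _; rewrite -mulrBr normrM ger0_norm ?bernstein_weight_ge0 //.
rewrite mulrC ler_wpM2r ?bernstein_weight_ge0 // distrC ffact_ratio_dist //.
by rewrite -ltnS.
Qed.

End BernsteinWeights.

Section CvgSum.
Variables (R : realType) (T : Type) (F : set_system T).
Hypothesis FF : Filter F.

Lemma cvg_sum_ord n (f : 'I_n -> T -> R) (l : 'I_n -> R) :
  (forall i, f i x @[x --> F] --> l i) ->
  \sum_i f i x @[x --> F] --> \sum_i l i.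
Proof. by move=> fl; apply: cvg_big => [|i _]; [exact: add_continuous|exact: fl]. Qed.

End CvgSum.

(** By compactness the image ultrafilter has a cluster point, and an ultrafilter converges to its
    cluster points. No subsequence has to be extracted, so all x can share one [U]. *)
Lemma ultra_bounded_cvg (R : realType) (T : Type) (U : set_system T) (u : T -> R) (a b : R) :
  UltraFilter U -> (forall n, a <= u n <= b) -> exists l : R, u @ U --> l.
Proof.
move=> UU uab; have UP : ProperFilter U by exact: ultra_proper.
have [|p [_ clp]] := @segment_compact _ a b (u @ U) _.
  suff : U (u @^-1` `[a, b]) by [].
  rewrite (_ : u @^-1` _ = setT); first exact: filterT.
  by apply/seteqP; split => n _ //=; rewrite in_itv /=; exact: uab.
exists p => A Ap; have [//|UA] := in_ultra_setVsetC (u @^-1` A) UU.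
by have [x [nAx Ax]] := clp (~` A) A UA Ap; case: (nAx Ax).
Qed.

(* Helly's selection argument: along an ultrafilter the distribution functions
   of the Bernstein approximations converge pointwise. *)
Theorem hausdorff_moment (R : realType) (b : nat -> R) : completely_monotone b ->
  exists mu : {finite_measure set (measurableTypeR R) -> \bar R},
    supported_in mu `[0, 1] /\ forall k, int01 mu (fun x => x ^+ k) = b k.
Proof.
move=> cb.
pose w n j := bernstein_weight b n.+1 j.
(* Distribution function of the Bernstein masses; degree n+1 keeps the nodes j/(n+1) defined at n =
   0. *)
pose F n (x : R) := \sum_(j < n.+2) w n j * (j%:R / n.+1%:R <= x)%R%:R.
have w0 n j : 0 <= w n j by exact: bernstein_weight_ge0.
have wS n : \sum_(j < n.+2) w n j = b 0%N by exact: bernstein_weight_sum.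
have b00 : 0 <= b 0%N by rewrite -(wS 0%N) sumr_ge0.
have F01 n x : 0 <= F n x <= b 0%N.
  rewrite sumr_ge0 /= => [|j _]; last by rewrite mulr_ge0.
  by rewrite -(wS n) ler_sum // => j _; rewrite ler_piMr // lern1 leq_b1.
have [U [UU Uoo]] := ultraFilterLemma eventually_filter.
have UP : ProperFilter U by exact: ultra_proper.
have /choice[G FG] : forall x, exists l : R, F ^~ x @ U --> l.
  by move=> x; apply: ultra_bounded_cvg UU (fun n => F01 n x).
have G_homo : {homo G : x y / x <= y}.
  move=> x y xy; apply: (ler_cvg_to (FG x) (FG y)); apply: nearW => n.
  apply: ler_sum => j _; rewrite ler_wpM2l // ler_nat.
  by case: leP => // jx; rewrite (le_trans jx).
have G_lt0 x : x < 0 -> G x = 0.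
  move=> x0; apply: (cvg_unique _ (FG x)) => //.
  rewrite (_ : F^~ x = cst 0); first exact: cvg_cst.
  apply/funext => n; rewrite /F big1 // => j _.
  by rewrite leNgt (lt_le_trans x0) ?mulr0 // divr_ge0.
have G_ge1 x : 1 <= x -> G x = b 0%N.
  move=> x1; apply: (cvg_unique _ (FG x)) => //.
  rewrite (_ : F^~ x = cst (b 0%N)); first exact: cvg_cst.
  apply/funext => n; rewrite /F -[RHS](wS n); apply: eq_bigr => j _.
  rewrite (le_trans _ x1) ?mulr1 // ler_pdivrMr // mul1r ler_nat.
  by rewrite -ltnS.
have [mu [H [mu01 muH GH]]] := stieltjes_measure01 G_homo G_lt0.
exists mu; split => // k.
(* [G] is constant from 1 on, so the sandwich is tight at 1 and the mass is not lost in the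
   limit. *)
have H1 : H 1 = b 0%N.
  have := GH 1 2; rewrite !G_ge1 ?lexx //; last by lra.
  by move=> /(_ ltac:(lra)) /le_anti.
have mass : mass01 mu = b 0%N by rewrite /mass01 muH ?lexx ?ler01.
pose d N i : R := (i.+1%:R / N%:R) ^+ k - (i%:R / N%:R) ^+ k.
have dN N i : (i < N)%N -> 0 <= d N i <= k%:R / N%:R.
  move=> iN; have N0 : 0 < N%:R :> R by rewrite ltr0n; lia.
  have /andP[-> /le_trans ->] // : 0 <= d N i <= k%:R * (i.+1%:R / N%:R - i%:R / N%:R).
    apply: exprn_lipschitz; first by rewrite divr_ge0.
      by rewrite ler_pM2r ?invr_gt0 // ler_nat.
    by rewrite ler_pdivrMr // mul1r ler_nat.
  by rewrite -mulrBl -natrB // subSnn mul1r.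
have intX : integrable01 mu (fun x => x ^+ k).
  by apply: integrable01_continuous; apply: continuous_subspaceT; exact: exprn_continuous.
(* Stieltjes sums for the k-th moment after summation by parts. The chain is: integral, sum for [H],
   sum for [G], then [b k]. *)
pose SH N := b 0%N - \sum_(i < N) d N i * H (i%:R / N%:R).
pose SG N := b 0%N - \sum_(i < N) d N i * G (i%:R / N%:R).
have node01 N (i : 'I_N) : 0 <= (i%:R / N%:R : R) <= 1.
  have N0 : 0 < N%:R :> R by rewrite ltr0n; case: i => i; lia.
  by rewrite divr_ge0 //= ler_pdivrMr // mul1r ler_nat ltnW.
have boundH N : (0 < N)%N -> `|int01 mu (fun x => x ^+ k) - SH N| <= k%:R / N%:R * b 0%N.
  move=> N0; rewrite -mass.
  have iI i : integrable01 mu (fun x => d N i * (x <= i%:R / N%:R)%R%:R).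
    by apply: integrable01Z; exact: integrable01_indic.
  have iS : integrable01 mu (fun x => \sum_(i < N) d N i * (x <= i%:R / N%:R)%R%:R).
    by apply: integrable01_sum.
  have -> : SH N = int01 mu (pow_step k N).
    rewrite /pow_step int01B //; last exact: integrable01_cst.
    rewrite int01_sum; last by move=> i; exact: iI.
    rewrite int01_cst mul1r mass; congr (_ - _); apply: eq_bigr => i _.
    rewrite int01Z ?int01_indic //; last exact: integrable01_indic.
      by rewrite muH.
    by have /andP[] := node01 N i.
  apply: int01_dist_le => // [|x x01]; last by rewrite distrC pow_step_dist.
  have := integrable01D (integrable01_cst mu 1) (integrable01Z (-1) iS).
  by under eq_fun do rewrite mulN1r; exact.
(* At each node H - G is at most the next increment of [G]; these telescope to at most b 0, and each
   coefficient is at most k/N. *)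
have boundHG N : (0 < N)%N -> `|SH N - SG N| <= k%:R / N%:R * b 0%N.
  move=> N0; rewrite /SH /SG opprD opprK addrACA subrr add0r addrC distrC -sumrB.
  have N0R : 0 < N%:R :> R by rewrite ltr0n.
  pose g i := G (i%:R / N%:R).
  have dGH (i : 'I_N) : 0 <= H (i%:R / N%:R) - g i <= g i.+1 - g i.
    have /GH /andP[h1 h2] : (i%:R / N%:R : R) < i.+1%:R / N%:R.
      by rewrite ltr_pM2r ?invr_gt0 // ltr_nat.
    by rewrite subr_ge0 h1 lerD2r.
  rewrite ger0_norm; last first.
    apply: sumr_ge0 => i _; rewrite -mulrBr mulr_ge0 //.
      by have /andP[] := dN N i (ltn_ord i).
    by have /andP[] := dGH i.
  apply: (@le_trans _ _ (\sum_(i < N) k%:R / N%:R * (g i.+1 - g i))).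
    apply: ler_sum => i _; rewrite -mulrBr.
    have /andP[? ?] := dN N i (ltn_ord i); have /andP[? ?] := dGH i.
    exact: ler_pM.
  rewrite -mulr_sumr ler_wpM2l ?divr_ge0 //.
  rewrite -(big_mkord xpredT (fun i => g i.+1 - g i)) telescope_sumr // /g.
  rewrite divff ?gt_eqF // G_ge1 // gerBl // mul0r.
  by apply: le_trans (G_homo (-1) 0 _); [rewrite G_lt0 //|]; lra.
have boundG N : (0 < N)%N -> `|SG N - b k| <= (2 * k)%:R / N%:R * b 0%N.
  move=> N0; pose SF n := b 0%N - \sum_(i < N) d N i * F n (i%:R / N%:R).
  have SFE n : SF n = \sum_(j < n.+2) w n j * pow_step k N (j%:R / n.+1%:R).
    rewrite /SF /pow_step -(wS n); under [RHS]eq_bigr do rewrite mulrBr mulr1.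
    rewrite sumrB; congr (_ - _).
    under [RHS]eq_bigr do rewrite mulr_sumr.
    rewrite exchange_big; apply: eq_bigr => i _; rewrite mulr_sumr.
    by apply: eq_bigr => j _; rewrite mulrCA.
  have SFG : SF @ U --> SG N.
    apply: cvgB; first exact: cvg_cst.
    by apply: cvg_sum_ord => i; apply: cvgMr; exact: FG.
  apply: (cvgr_to_le (cvg_norm (cvgB SFG (cvg_cst (b k))))).
  (* From this n on, the Bernstein error k^2/(n+1-k) is at most k/N, matching the rounding error. *)
  apply: Uoo; exists (k + k * N)%N => // n /= nk.
  have N0R : 0 < N%:R :> R by rewrite ltr0n.
  rewrite (_ : (2 * k)%:R / N%:R * b 0%N = k%:R / N%:R * b 0%N + k%:R / N%:R * b 0%N); last first.
    by rewrite natrM; ring.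
  rewrite -[leLHS]/(`|SF n - b k|) SFE; pose T := \sum_(j < n.+2) w n j * (j%:R / n.+1%:R) ^+ k.
  rewrite -(subrK T (\sum_(j < _) _)) -addrA (le_trans (ler_normD _ _)) //.
  apply: lerD.
    rewrite /T -sumrB (le_trans (ler_norm_sum _ _ _)) // -[b 0%N](wS n) mulr_sumr.
    apply: ler_sum => j _; rewrite -mulrBr normrM ger0_norm // mulrC ler_wpM2r //.
    apply: pow_step_dist => //; rewrite divr_ge0 //= ler_pdivrMr // mul1r ler_nat.
    by rewrite -ltnS.
  apply: le_trans (bernstein_moment_dist cb _) _; first by lia.
  rewrite ler_wpM2r // ler_pdivlMr // mulrAC ler_pdivrMr; last by rewrite ltr0n; lia.
  by rewrite -!natrM ler_nat; nia.
have bound N : (0 < N)%N -> `|int01 mu (fun x => x ^+ k) - b k| <= (4 * k)%:R * b 0%N / N%:R.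
  move=> N0; have := boundH N N0; have := boundHG N N0; have := boundG N N0.
  rewrite !ler_norml (_ : (4 * k)%:R * b 0%N / N%:R = 4 * (k%:R / N%:R * b 0%N)); last first.
    by rewrite natrM; ring.
  rewrite (_ : (2 * k)%:R / N%:R * b 0%N = 2 * (k%:R / N%:R * b 0%N)); last first.
    by rewrite natrM; ring.
  by lra.
apply/eqP; rewrite -subr_eq0 -normr_eq0 eq_le normr_ge0 andbT leNgt; apply/negP => e0.
set e := `|_| in bound e0.
have C0 : 0 <= (4 * k)%:R * b 0%N / e by rewrite divr_ge0 ?mulr_ge0 // ltW.
have CN := archi_boundP C0; set N := Num.bound _ in CN.
have N0 : (0 < N)%N by rewrite -(ltr0n R) (le_lt_trans C0).
have := bound N N0; rewrite ler_pdivlMr ?ltr0n // leNgt => /negP; apply.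
by rewrite [ltRHS]mulrC -ltr_pdivrMr.
Qed.

(** * Hermitian matrices and their quadratic forms *)

Section QuadraticForm.
Variable R : realType.
Implicit Types (n : nat) (f g : R -> R).

Lemma conjC_conjc (z : R[i]) : conjC z = conjc z. Proof. by []. Qed.

Lemma hermP n (M : 'M[R[i]]_n) :
  reflect (forall i j, M i j = conjC (M j i)) (M \is hermsymmx).
Proof.
apply: (iffP (is_hermitianmxP _ _ _)); rewrite expr0 scale1r.
  by move=> HM i j; rewrite {1}HM !mxE.
by move=> HM; apply/matrixP => i j; rewrite !mxE HM.
Qed.

(** Taking the real part makes the form a real-valued, real-linear function of every matrix,
    including the non-Hermitian words below; on Hermitian matrices nothing is lost. *)
Definition qf n (v : 'rV[R[i]]_n) (M : 'M[R[i]]_n) : R :=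
  complex.Re ((v *m M *m v ^t*) 0 0).

Lemma ReD (x y : R[i]) : complex.Re (x + y) = complex.Re x + complex.Re y.
Proof. by case: x => ? ?; case: y. Qed.

Lemma ReM_real (a : R) (x : R[i]) : complex.Re (a%:C * x) = a * complex.Re x.
Proof. by case: x => x y /=; rewrite mul0r subr0. Qed.

Lemma Re_sum (I : finType) (F : I -> R[i]) :
  complex.Re (\sum_i F i) = \sum_i complex.Re (F i).
Proof. exact: (big_morph _ ReD). Qed.

Section Linear.
Variables (n : nat) (v : 'rV[R[i]]_n).
Implicit Types M N : 'M[R[i]]_n.

Lemma qfD M N : qf v (M + N) = qf v M + qf v N.
Proof. by rewrite /qf mulmxDr mulmxDl mxE ReD. Qed.

Lemma qfZ a M : qf v (a%:C *: M) = a * qf v M.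
Proof. by rewrite /qf -scalemxAr -scalemxAl mxE ReM_real. Qed.

Lemma qf0 : qf v 0 = 0.
Proof. by rewrite /qf mulmx0 mul0mx mxE. Qed.

Lemma qfN M : qf v (- M) = - qf v M.
Proof. by apply/eqP; rewrite -subr_eq0 opprK addrC -qfD subrr qf0. Qed.

Lemma qfB M N : qf v (M - N) = qf v M - qf v N.
Proof. by rewrite qfD qfN. Qed.

Lemma qf_sum (I : finType) (F : I -> 'M[R[i]]_n) :
  qf v (\sum_i F i) = \sum_i qf v (F i).
Proof. exact: (big_morph _ qfD qf0). Qed.

Lemma qf_entries M : qf v M = \sum_i \sum_j complex.Re (v 0 i * conjC (v 0 j) * M i j).
Proof.
rewrite /qf mxE Re_sum exchange_big /=; apply: eq_bigr => j _.
rewrite !mxE mulr_suml Re_sum; apply: eq_bigr => i _; congr complex.Re.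
by rewrite -!mulrA [M i j * _]mulrC.
Qed.

End Linear.

Lemma conjC_mxM m n p (A : 'M[R[i]]_(m, n)) (B : 'M[R[i]]_(n, p)) :
  (A *m B) ^t* = B ^t* *m A ^t*.
Proof. by rewrite trmx_mul map_mxM. Qed.

Lemma herm_trC n (M : 'M[R[i]]_n) : (M \is hermsymmx) = (M ^t* == M).
Proof.
apply/hermP/eqP => [HM|HM i j]; last by rewrite -{1}HM !mxE.
by apply/matrixP => i j; rewrite !mxE -HM.
Qed.

Lemma qf_conj n p (v : 'rV[R[i]]_p) (S : 'M[R[i]]_(p, n)) (M : 'M[R[i]]_n) :
  qf v (S *m M *m S ^t*) = qf (v *m S) M.
Proof. by rewrite /qf conjC_mxM !mulmxA. Qed.

Lemma herm_qf n (M : 'M[R[i]]_n) (v : 'rV[R[i]]_n) : M \is hermsymmx ->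
  (v *m M *m v ^t*) 0 0 = (qf v M)%:C.
Proof.
rewrite herm_trC => /eqP HM; rewrite /qf; set z := (_ *m _) 0 0.
have : conjC z = z.
  transitivity ((v *m M *m v ^t*) ^t* 0 0); first by rewrite [RHS]mxE; congr conjC; rewrite [RHS]mxE.
  by rewrite conjC_mxM conjC_mxM HM trmxCK mulmxA.
case: z => a b; rewrite conjC_conjc => -[] bb.
by have -> : b = 0 by lra.
Qed.

Lemma psdmxP n (M : 'M[R[i]]_n) :
  psdmx M <-> M \is hermsymmx /\ forall v, 0 <= qf v M.
Proof.
split=> -[HM H]; split=> // v; have := H v.
  by rewrite herm_qf // ler0c.
by rewrite herm_qf // ler0c.
Qed.

Lemma hermD n (M N : 'M[R[i]]_n) : M \is hermsymmx -> N \is hermsymmx ->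
  M + N \is hermsymmx.
Proof.
move=> /hermP HM /hermP HN; apply/hermP => i j.
by rewrite !mxE rmorphD /= -HM -HN.
Qed.

Lemma hermZ n (a : R) (M : 'M[R[i]]_n) : M \is hermsymmx -> a%:C *: M \is hermsymmx.
Proof.
move=> /hermP HM; apply/hermP => i j; rewrite !mxE rmorphM /= -HM.
by rewrite conjC_conjc conjc_real.
Qed.

Lemma hermN n (M : 'M[R[i]]_n) : M \is hermsymmx -> - M \is hermsymmx.
Proof. by move=> /hermP HM; apply/hermP => i j; rewrite !mxE rmorphN /= -HM. Qed.

(** Polarisation, which transfers expansions of quadratic forms to the entries where [derive1n_mx]
    is defined. *)
Lemma herm_polar n (M : 'M[R[i]]_n) i j : M \is hermsymmx ->
  complex.Re (M i j) = (qf (delta_mx 0 i + delta_mx 0 j) M - qf (delta_mx 0 i) M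
     - qf (delta_mx 0 j) M) / 2 /\
  complex.Im (M i j) = (qf (delta_mx 0 i + 'i *: delta_mx 0 j) M - qf (delta_mx 0 i) M
     - qf (delta_mx 0 j) M) / 2.
Proof.
move=> /hermP HM.
have E (x : R[i]) : qf (delta_mx 0 i + x *: delta_mx 0 j) M =
   complex.Re (M i i + conjC x * M i j + x * M j i + x * conjC x * M j j).
  rewrite /qf raddfD map_mxD /= linearZ /= map_mxZ !trmx_delta !map_delta_mx.
  rewrite !mulmxDl !mulmxDr -!scalemxAl -!scalemxAr !scalerA -!rowE -!colE.
  by rewrite !mxE -!addrA; congr (complex.Re (_ + _)); ring.
have E1 k : qf (delta_mx 0 k) M = complex.Re (M k k).
  by rewrite /qf trmx_delta map_delta_mx -rowE -colE !mxE.
rewrite -[X in qf (_ + X)]scale1r !E !E1 [M j i]HM.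
rewrite !ReD !conjC_conjc; case: (M i j) (M i i) (M j j) => a b [c d] [e g] /=.
by split; field.
Qed.

End QuadraticForm.

(** * Functional calculus and expansions along a line of matrices *)

Section FunctionalCalculus.
Variables (R : realType) (n : nat).
Implicit Types (A B M : 'M[R[i]]_n) (f g : R -> R) (v : 'rV[R[i]]_n).

Definition spec A l : R := complex.Re (spectral_diag A 0 l).

(** The mass that the spectral measure of [v] gives to the l-th eigenvector: the squared modulus of
    a coordinate in the eigenbasis. *)
Definition spec_weight A v l : R :=
  complex.Re ((v *m (spectralmx A) ^t*) 0 l * conjC ((v *m (spectralmx A) ^t*) 0 l)).

Definition fun_diag f A : 'M[R[i]]_n := diag_mx (\row_l (f (spec A l))%:C).

Lemma fun_mxE f A : fun_mx f A = (spectralmx A) ^t* *m fun_diag f A *m spectralmx A.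
Proof.
have -> : fun_diag f A = diag_mx (map_mx (fun z => (f (complex.Re z))%:C) (spectral_diag A)).
  by congr diag_mx; apply/rowP => l; rewrite !mxE.
by rewrite -(invmx_unitary (spectral_unitarymx A)).
Qed.

Lemma Re_mul_conj_ge0 (z : R[i]) : 0 <= complex.Re (z * conjC z).
Proof. by case: z => a b /=; rewrite mulrN opprK addr_ge0 // -expr2 sqr_ge0. Qed.

Lemma spec_weight_ge0 A v l : 0 <= spec_weight A v l.
Proof. exact: Re_mul_conj_ge0. Qed.

Lemma qf_diag v (d : 'I_n -> R) :
  qf v (diag_mx (\row_l (d l)%:C)) = \sum_l d l * complex.Re (v 0 l * conjC (v 0 l)).
Proof.
rewrite qf_entries; apply: eq_bigr => l _.
rewrite (bigD1 l) //= big1 ?addr0 => [|j jl].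
  by rewrite !mxE eqxx mulr1n mulrC ReM_real.
by rewrite !mxE eq_sym (negbTE jl) mulr0n mulr0.
Qed.

Lemma qf_fun_mx f A v : qf v (fun_mx f A) = \sum_l f (spec A l) * spec_weight A v l.
Proof. by rewrite fun_mxE -{2}(trmxCK (spectralmx A)) qf_conj qf_diag. Qed.

Lemma fun_diagM f g A : fun_diag f A *m fun_diag g A = fun_diag (fun x => f x * g x) A.
Proof.
rewrite /fun_diag mulmx_diag; congr diag_mx; apply/rowP => l.
by rewrite !mxE -rmorphM.
Qed.

Lemma fun_mxM f g A : fun_mx f A *m fun_mx g A = fun_mx (fun x => f x * g x) A.
Proof.
rewrite (fun_mxE f) (fun_mxE g) (fun_mxE (fun x => _)).
have /unitarymxP H := spectral_unitarymx A.
rewrite -(fun_diagM f g) !mulmxA; set P := spectralmx A in H *.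
by rewrite -(mulmxA (P ^t* *m fun_diag f A) P (P ^t*)) H mulmx1.
Qed.

Lemma fun_mxD f g A : fun_mx f A + fun_mx g A = fun_mx (fun x => f x + g x) A.
Proof.
rewrite (fun_mxE f) (fun_mxE g) (fun_mxE (fun x => _)) -mulmxDl -mulmxDr.
have -> // : fun_diag f A + fun_diag g A = fun_diag (fun x => f x + g x) A.
rewrite /fun_diag -raddfD; congr diag_mx; apply/rowP => l.
by rewrite !mxE -rmorphD.
Qed.

Lemma fun_mxZ c f A : c%:C *: fun_mx f A = fun_mx (fun x => c * f x) A.
Proof.
rewrite (fun_mxE f) (fun_mxE (fun x => _)) scalemxAl scalemxAr.
have -> // : c%:C *: fun_diag f A = fun_diag (fun x => c * f x) A.
rewrite /fun_diag -linearZ; congr diag_mx; apply/rowP => l.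
by rewrite !mxE -rmorphM.
Qed.

Lemma fun_mx1 A : fun_mx (fun=> 1) A = 1%:M.
Proof.
rewrite fun_mxE (_ : fun_diag _ A = 1%:M).
  by rewrite mulmx1 -invmx_unitary ?spectral_unitarymx // mulVmx ?spectral_unit.
by rewrite -diag_const_mx; congr diag_mx; apply/rowP => l; rewrite !mxE.
Qed.

Lemma eq_fun_mx f g A : (forall l, f (spec A l) = g (spec A l)) ->
  fun_mx f A = fun_mx g A.
Proof.
move=> fg; rewrite (fun_mxE f) (fun_mxE g).
have -> // : fun_diag f A = fun_diag g A.
by congr diag_mx; apply/rowP => l; rewrite !mxE fg.
Qed.

Lemma herm_fun_mx f A : fun_mx f A \is hermsymmx.
Proof.
rewrite herm_trC fun_mxE !conjC_mxM trmxCK -!mulmxA.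
have -> // : fun_diag f A ^t* = fun_diag f A.
rewrite /fun_diag tr_diag_mx map_diag_mx; congr diag_mx; apply/rowP => l.
by rewrite !mxE; exact: conjc_real.
Qed.

Lemma spectral_diagE A l : A \is hermsymmx -> spectral_diag A 0 l = (spec A l)%:C.
Proof.
move=> /hermitian_spectral_diag_real /mxOverP /(_ 0 l) H.
by rewrite /spec RRe_real.
Qed.

Lemma fun_mx_id A : A \is hermsymmx -> fun_mx id A = A.
Proof.
move=> HA; have /orthomx_spectralP {2}-> := hermitian_normalmx HA.
have <- : map_mx (fun z => (complex.Re z)%:C) (spectral_diag A) = spectral_diag A; last by [].
by apply/rowP => l; rewrite mxE spectral_diagE.
Qed.

Lemma fun_mxXn A m : A \is hermsymmx -> A ^+ m = fun_mx (fun x => x ^+ m) A.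
Proof.
move=> HA; elim: m => [|m IH]; first by rewrite expr0; apply/esym; exact: fun_mx1.
rewrite exprS IH -{1}(fun_mx_id HA) [LHS]fun_mxM.
by apply: eq_fun_mx => l; rewrite exprS.
Qed.

Lemma eigenvalue_spec A l : A \is hermsymmx -> eigenvalue A (spec A l)%:C.
Proof.
move=> HA; apply/eigenvalueP; exists (row l (spectralmx A)).
  rewrite -spectral_diagE //; have /orthomx_spectralP {2}-> := hermitian_normalmx HA.
  rewrite -row_mul !mulmxA mulmxV ?spectral_unit // mul1mx.
  by rewrite row_mul row_diag_mx -scalemxAl -rowE.
apply/negP => /eqP r0; have := spectral_unitarymx A => /unitarymxP /matrixP /(_ l l).
rewrite !mxE eqxx big1 => [/eqP|j _]; first by rewrite eq_sym oner_eq0.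
by have /rowP /(_ j) := r0; rewrite !mxE => ->; rewrite mul0r.
Qed.

Lemma Msa_spec (a b : R) A l : Msa a b A -> a < spec A l < b.
Proof. by move=> [HA /(_ _ (eigenvalue_spec l HA))]; rewrite !ltcR. Qed.

End FunctionalCalculus.

(** * Word sums, row-sum norms and expansion in the parameter *)

Section Words.
Variable T : pzRingType.
Implicit Types a x c p q : T.

(* The sum of all words with [m] letters, [k] of which are [x] and the others
   [a]: the coefficient of [t ^ k] in [(a + t x) ^ m]. *)
Fixpoint words a x m k : T :=
  match m, k with
  | 0, 0 => 1
  | 0, _.+1 => 0
  | m'.+1, 0 => a * words a x m' 0
  | m'.+1, k'.+1 => a * words a x m' k + x * words a x m' k'
  end.

Lemma words_small a x m k : (m < k)%N -> words a x m k = 0.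
Proof.
elim: m k => [|m IH] [|k] //= mk.
by rewrite !IH ?mulr0 ?addr0 // ltnW.
Qed.

Lemma wordsSS a x m k :
  words a x m.+1 k.+1 = a * words a x m k.+1 + x * words a x m k.
Proof. by []. Qed.

Lemma words0 a x m : words a x m 0 = a ^+ m.
Proof. by elim: m => [|m IH] //=; rewrite IH exprS. Qed.

Lemma words_expr a x c m : (forall y, c * y = y * c) ->
  (a + c * x) ^+ m = \sum_(k < m.+1) c ^+ k * words a x m k.
Proof.
move=> cC; have cX k y : c ^+ k * y = y * c ^+ k.
  by elim: k y => [|k IH] y; [rewrite mul1r mulr1|rewrite exprS -mulrA IH mulrA cC mulrA].
elim: m => [|m IH]; first by rewrite big_ord1 /= mulr1.
rewrite exprS IH mulrDl !mulr_sumr [RHS]big_ord_recl.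
rewrite [X in X + _]big_ord_recl -!addrA; congr (_ + _); first by rewrite /= !mul1r.
under [RHS]eq_bigr do rewrite /= mulrDr.
rewrite big_split /=; congr (_ + _).
  rewrite big_ord_recr /= words_small // mulr0 mulr0 addr0.
  by apply: eq_bigr => i _; rewrite /bump leq0n add1n !mulrA cX.
apply: eq_bigr => i _; rewrite /bump leq0n add1n exprS -!mulrA; congr (c * _).
by rewrite !mulrA cX.
Qed.

Lemma words_conj p q a x m k : p * q = 1 -> q * p = 1 ->
  words (q * a * p) (q * x * p) m k = q * words a x m k * p.
Proof.
move=> pq qp; elim: m k => [|m IH] [|k] /=.
- by rewrite mulr1 qp.
- by rewrite mulr0 mul0r.
- by rewrite IH !mulrA -(mulrA (q * a)) pq mulr1.
- rewrite !IH !mulrA -(mulrA (q * a)) pq -(mulrA (q * x)) pq !mulr1.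
  by rewrite mulrDr mulrDl !mulrA.
Qed.

(** The words are sorted by the position i of their first letter [x]; for a rank-one [x] this
    becomes a convolution. *)
Lemma wordsS a x m k :
  words a x m.+1 k.+1 = \sum_(i < m.+1) a ^+ i * x * words a x (m - i) k.
Proof.
elim: m => [|m IH].
  by rewrite big_ord1 /= mulr0 add0r expr0 mul1r.
rewrite wordsSS IH [RHS]big_ord_recl subn0 expr0 mul1r addrC.
congr (_ + _); rewrite mulr_sumr; apply: eq_bigr => i _.
by rewrite lift0 subSS exprS !mulrA.
Qed.

End Words.

Section RowSumBound.
Variable R : realType.

(** A bound on the maximal row-sum norm. It is submultiplicative, dominates eigenvalues, and on a
    diagonal matrix it is the largest modulus of an entry. *)
Definition row_bounded n p (M : 'M[R[i]]_(n, p)) (q : R) : Prop :=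
  forall i, \sum_j `|M i j| <= q%:C.

Lemma row_bounded_ex n p (M : 'M[R[i]]_(n, p)) : exists2 q, 0 <= q & row_bounded M q.
Proof.
pose s := \sum_i \sum_j `|M i j|.
have s0 : 0 <= s by apply: sumr_ge0 => i _; apply: sumr_ge0.
exists (complex.Re s); first by rewrite -ler0c RRe_real // ger0_real.
move=> i; rewrite RRe_real ?ger0_real // /s (bigD1 i) //= lerDl.
by apply: sumr_ge0 => j _; apply: sumr_ge0.
Qed.

Lemma row_boundedM n (M N : 'M[R[i]]_n) q r : row_bounded M q -> row_bounded N r ->
  0 <= r -> row_bounded (M *m N) (q * r).
Proof.
move=> HM HN r0 i; rewrite rmorphM /=.
apply: (@le_trans _ _ (\sum_j \sum_k `|M i k| * `|N k j|)).
  apply: ler_sum => j _; rewrite mxE (le_trans (ler_norm_sum _ _ _)) //.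
  by apply: ler_sum => k _; rewrite normrM.
rewrite exchange_big /=.
apply: (@le_trans _ _ (\sum_k `|M i k| * r%:C)).
  by apply: ler_sum => k _; rewrite -mulr_sumr ler_wpM2l.
by rewrite -mulr_suml ler_wpM2r // ler0c.
Qed.

Lemma row_boundedD n (M N : 'M[R[i]]_n) q r : row_bounded M q -> row_bounded N r ->
  row_bounded (M + N) (q + r).
Proof.
move=> HM HN i; rewrite rmorphD /= (le_trans _ (lerD (HM i) (HN i))) // -big_split /=.
by apply: ler_sum => j _; rewrite mxE ler_normD.
Qed.

Lemma row_boundedZ n (M : 'M[R[i]]_n) t q : row_bounded M q ->
  row_bounded (t%:C *: M) (`|t| * q).
Proof.
move=> HM i; rewrite rmorphM /= (_ : `|t|%:C = `|t%:C|); last first.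
  by rewrite normc_def /= expr0n addr0 sqrtr_sqr.
apply: le_trans (ler_wpM2l _ (HM i)) => //; rewrite mulr_sumr.
by apply: ler_sum => j _; rewrite mxE normrM.
Qed.

Lemma row_bounded1 n : row_bounded (1%:M : 'M[R[i]]_n) 1.
Proof.
move=> i; rewrite (bigD1 i) //= big1 ?addr0 => [|j ji].
  by rewrite mxE eqxx normr1.
by rewrite mxE eq_sym (negbTE ji) normr0.
Qed.

Lemma row_bounded0 n : row_bounded (0 : 'M[R[i]]_n) 0.
Proof. by move=> i; rewrite big1 // => j _; rewrite mxE normr0. Qed.

Lemma words_ge0 (a x : R) m k : 0 <= a -> 0 <= x -> 0 <= words a x m k.
Proof.
move=> a0 x0; elim: m k => [|m IH] [|k] //=; first by rewrite mulr_ge0.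
by rewrite addr_ge0 // mulr_ge0.
Qed.

(** Norm bounds reduce noncommutative word sums to scalar ones, which are the coefficients of (a + t
    x)^m. *)
Lemma row_bounded_words n (A X : 'M[R[i]]_n) a x m k : 0 <= a -> 0 <= x ->
  row_bounded A a -> row_bounded X x -> row_bounded (words A X m k) (words a x m k).
Proof.
move=> a0 x0 HA HX; elim: m k => [|m IH] [|k] /=.
- exact: row_bounded1.
- exact: row_bounded0.
- by apply: row_boundedM => //; exact: words_ge0.
- apply: row_boundedD.
    by apply: (row_boundedM HA (IH k.+1)); exact: words_ge0.
  by apply: (row_boundedM HX (IH k)); exact: words_ge0.
Qed.

Lemma qf_row_bounded n (v : 'rV[R[i]]_n) : exists2 K, 0 <= K &
  forall M q, row_bounded M q -> `|qf v M| <= K * q.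
Proof.
pose s := \sum_i `|v 0 i|.
have s0 : 0 <= s by apply: sumr_ge0.
have s20 : 0 <= s ^+ 2 by rewrite exprn_ge0.
exists (complex.Re (s ^+ 2)); first by rewrite -ler0c RRe_real // ger0_real.
move=> M q HM; rewrite -lecR rmorphM /= RRe_real ?ger0_real // /qf.
apply: le_trans (normc_ge_Re _) _; rewrite mxE (le_trans (ler_norm_sum _ _ _)) //.
apply: (@le_trans _ _ (\sum_j \sum_i `|v 0 i| * `|M i j| * s)).
  apply: ler_sum => j _; rewrite !mxE normrM norm_conjC.
  rewrite -mulr_suml; apply: ler_pM => //.
    by rewrite (le_trans (ler_norm_sum _ _ _)) //; apply: ler_sum => i _; rewrite normrM.
  by rewrite /s (bigD1 j) //= lerDl; apply: sumr_ge0.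
rewrite exchange_big /= expr2 -mulrA mulr_suml; apply: ler_sum => i _.
rewrite -mulr_suml -mulr_sumr -mulrA [s * _]mulrC ler_wpM2l // ler_wpM2r //.
Qed.

(** [eigenvalue] speaks of row vectors, so row sums of [M] pair with the sum norm of the
    eigenvector. *)
Lemma eigenvalue_row_bounded n (M : 'M[R[i]]_n) z q : row_bounded M q ->
  eigenvalue M z -> `|z| <= q%:C.
Proof.
move=> HM /eigenvalueP [v vM v0].
have s0 : 0 < \sum_i `|v 0 i|.
  rewrite lt0r sumr_ge0 // andbT; apply: contra v0 => /eqP H.
  apply/eqP/rowP => j; rewrite mxE; apply/eqP; rewrite -normr_eq0.
  by have /psumr_eq0P -> := H.
rewrite -(ler_pM2r s0) mulr_sumr mulr_sumr.
apply: (@le_trans _ _ (\sum_j \sum_i `|v 0 i| * `|M i j|)).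
  apply: ler_sum => j _; rewrite -normrM.
  have -> : z * v 0 j = (v *m M) 0 j by rewrite vM mxE.
  rewrite mxE (le_trans (ler_norm_sum _ _ _)) //.
  by apply: ler_sum => i _; rewrite normrM.
rewrite exchange_big /=; apply: ler_sum => i _.
by rewrite -mulr_sumr mulrC ler_wpM2r.
Qed.

Lemma row_bounded_diag n (d : 'I_n -> R) q : (forall l, `|d l| <= q) ->
  row_bounded (diag_mx (\row_l (d l)%:C)) q.
Proof.
move=> dq i; rewrite (bigD1 i) //= big1 ?addr0 => [|j ji].
  rewrite !mxE eqxx mulr1n normc_def /= expr0n addr0 sqrtr_sqr.
  by rewrite lecR.
by rewrite !mxE eq_sym (negbTE ji) mulr0n normr0.
Qed.

End RowSumBound.

Section DoubleSeries.
Variables (R : realType) (x : nat -> nat -> R) (K q : R).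
Hypotheses (K0 : 0 <= K) (q0 : 0 <= q) (q1 : q < 1).
Hypothesis x_small : forall m k, (m < k)%N -> x m k = 0.
Hypothesis x_bound : forall m, \sum_(k < m.+1) `|x m k| <= K * q ^+ m.

Let x_row m n : \sum_(k < n) `|x m k| <= K * q ^+ m.
Proof.
have [nm|mn] := leqP n m.+1.
  apply: le_trans (x_bound m).
  by rewrite (big_ord_widen m.+1 (fun k => `|x m k|)) // [leRHS](bigID (fun k : 'I__ => (k < n)%N)) /= lerDl sumr_ge0.
apply: le_trans (x_bound m); rewrite -(subnKC (ltnW mn)) big_split_ord /=.
by rewrite [X in _ + X]big1 ?addr0 // => i _; rewrite x_small ?normr0 // addSn ltnS leq_addr.
Qed.

Let x_le m k : `|x m k| <= K * q ^+ m.
Proof.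
apply: le_trans (x_row m k.+1).
by rewrite big_ord_recr lerDr sumr_ge0.
Qed.

Lemma cvg_column k : cvgn (series (fun m => x m k)).
Proof. exact: (cvg_geometric_dominated K0 q0 q1 (fun m => x_le m k)). Qed.

Lemma geometric_sum_le m n : \sum_(m <= i < n) K * q ^+ i <= K * q ^+ m / (1 - q).
Proof.
have q10 : 0 < 1 - q by rewrite subr_gt0.
have [nm|mn] := leqP n m.
  by rewrite big_geq // divr_ge0 ?mulr_ge0 ?exprn_ge0 // ltW.
rewrite -mulr_sumr -mulrA ler_wpM2l //.
rewrite -{1}[m]add0n big_addn.
under eq_bigr do rewrite exprD mulrC.
rewrite -mulr_sumr ler_wpM2l ?exprn_ge0 // big_mkord -[leRHS]mul1r ler_pdivlMr // mulrC.
by rewrite -opprB mulNr -subrX1 opprB gerBl exprn_ge0.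
Qed.

Let s m := \sum_(k < m.+1) x m k.
Let c k := limn (series (fun m => x m k)).

Lemma column_le k : `|c k| <= K / (1 - q).
Proof.
have := cvgr_to_le (cvg_norm (@cvg_column k)); apply.
apply: nearW => n; rewrite /series /=; apply: le_trans (ler_norm_sum _ _ _) _.
apply: le_trans (ler_sum _ (fun i _ => x_le i k)) _.
by apply: le_trans (geometric_sum_le 0 n) _; rewrite expr0 mulr1.
Qed.

(** Row m < n lies within the first n columns, so the two partial sums differ only by rows m >= n, a
    geometric tail. *)
Let partial_dist n : `|series c n - series s n| <= K * q ^+ n / (1 - q).
Proof.
have H : (fun M => \sum_(k < n) series (fun m => x m k) M) @ \oo --> \sum_(k < n) c k.
  by apply: cvg_sum_ord => k; exact: cvg_column.
have E : series c n = \sum_(k < n) c k by rewrite /series /= big_mkord.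
rewrite E; have := cvgr_to_le (cvg_norm (cvgB H (cvg_cst (series s n)))); apply.
exists n => // M /= nM; rewrite -[leLHS]/(`|_ - _|).
rewrite /series /= exchange_big /= (@big_cat_nat _ _ _ n) //=.
have -> : \sum_(0 <= m < n) \sum_(k < n) x m k = \sum_(0 <= m < n) s m.
  apply: eq_big_nat => m /andP[_ mn].
  rewrite /s -(subnKC mn) big_split_ord /= [X in _ + X]big1 ?addr0 // => i _.
  by rewrite x_small // addSn ltnS leq_addr.
rewrite addrAC subrr add0r (le_trans (ler_norm_sum _ _ _)) //.
apply: le_trans (geometric_sum_le n M); apply: ler_sum => m _.
by apply: le_trans (ler_norm_sum _ _ _) (x_row m n).
Qed.

Lemma double_series : limn (series s) = limn (series c).
Proof.
have s_cvg : cvgn (series s).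
  apply: (cvg_geometric_dominated K0 q0 q1) => m.
  exact: le_trans (ler_norm_sum _ _ _) (x_bound m).
apply/esym/cvg_lim => //.
have D : (fun n => series c n - series s n) @ \oo --> (0 : R).
  apply/norm_cvg0P.
  apply: (@squeeze_cvgr _ _ _ _ (cst 0) (geometric (K / (1 - q)) q)).
  - apply: nearW => n; rewrite normr_ge0 /= (le_trans (partial_dist n)) //.
    by rewrite mulrAC.
  - exact: cvg_cst.
  - by apply: cvg_geometric; rewrite ger0_norm.
rewrite (_ : series c = fun n => (series c n - series s n) + series s n); last first.
  by apply/funext => n; rewrite subrK.
by have := cvgD D s_cvg; rewrite add0r; exact.
Qed.

End DoubleSeries.

Section MatrixExpansion.
Variables (R : realType) (f : R -> R) (a : nat -> R).
Hypothesis a_bounded : geo_bounded a 1.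
Hypothesis f_series : forall x, `|x| < 1 -> f x = limn (pseries a x).

Lemma exists_spec_bound n (A : 'M[R[i]]_n) : Msa (-1) 1 A ->
  exists2 r, 0 <= r < 1 & forall l, `|spec A l| <= r.
Proof.
move=> HA; exists (\big[maxr/0]_l `|spec A l|).
  apply/andP; split.
    by elim/big_ind : _ => // x y x0 _; rewrite le_max x0.
  elim/big_ind : _ => [|x y x1 y1|l _]; [exact: ltr01|by rewrite gt_max x1|].
  by rewrite ltr_norml (Msa_spec l HA).
by move=> l; rewrite (bigD1 l) //= le_max lexx.
Qed.

Lemma qf_fun_mx_series n (B : 'M[R[i]]_n) (v : 'rV[R[i]]_n) : Msa (-1) 1 B ->
  qf v (fun_mx f B) = limn (series (fun m => a m * qf v (B ^+ m))).
Proof.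
move=> HB; rewrite qf_fun_mx; apply/esym/cvg_lim => //.
have -> : series (fun m => a m * qf v (B ^+ m)) =
    fun n => \sum_l pseries a (spec B l) n * spec_weight B v l.
  apply/funext => N; rewrite /pseries /series /=.
  under [RHS]eq_bigr do rewrite mulr_suml.
  rewrite exchange_big /=; apply: eq_bigr => m _.
  rewrite fun_mxXn; last by case: HB.
  by rewrite qf_fun_mx mulr_sumr; apply: eq_bigr => l _; rewrite mulrA.
apply: cvg_sum_ord => l; apply: cvgMl; have xl : `|spec B l| < 1.
  by rewrite ltr_norml (Msa_spec l HB).
by rewrite f_series //; exact: geo_cvg a_bounded xl.
Qed.

Lemma herm_trC_eq n (M : 'M[R[i]]_n) : M \is hermsymmx -> M ^t* = M.
Proof. by rewrite herm_trC => /eqP. Qed.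

Variables (n : nat) (A X : 'M[R[i]]_n).
Hypotheses (HA : Msa (-1) 1 A) (HX : X \is hermsymmx).

(** The coefficient of [t ^ k] in the form of [f (A + tX)], collected over all powers m. *)
Definition words_coef v k := limn (series (fun m => a m * qf v (words A X m k))).

(** In the eigenbasis of [A] its row norm is its spectral radius, which is below 1; in the original
    basis the row norm may exceed 1 and the series bounds would fail. *)
Let P := spectralmx A.
Let D : 'M[R[i]]_n := diag_mx (\row_l (spec A l)%:C).
Let X' := P *m X *m P ^t*.

Let PPC : P *m P ^t* = 1%:M.
Proof. exact/unitarymxP/spectral_unitarymx. Qed.

Let PCP : P ^t* *m P = 1%:M.
Proof. exact: mulmx1C PPC. Qed.

Let AE : A = P ^t* *m D *m P.
Proof. by rewrite -[LHS](fun_mx_id (proj1 HA)) fun_mxE. Qed.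

Let XE : X = P ^t* *m X' *m P.
Proof. by rewrite /X' !mulmxA PCP mul1mx -mulmxA PCP mulmx1. Qed.

Let qf_words v m k : qf v (words A X m k) = qf (v *m P ^t*) (words D X' m k).
Proof.
rewrite {1}AE {1}XE.
have := @words_conj _ P (P ^t*) D X' m k PPC PCP.
rewrite -[LHS]/(words (_ *m _ *m _) (_ *m _ *m _) m k).
move=> ->; rewrite -[P ^t* * _ * P]/(P ^t* *m _ *m P).
by rewrite -{2}(trmxCK P) qf_conj.
Qed.

Let line_Msa t r q : row_bounded D r -> row_bounded X' q -> 0 <= q ->
  r + `|t| * q < 1 -> Msa (-1) 1 (A + t%:C *: X).
Proof.
move=> HD HX' q00 rq; have HAh := proj1 HA.
have HAX : A + t%:C *: X \is hermsymmx by exact: hermD HAh (hermZ t HX).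
split => // z Hz; have /eigenvalueP [v vE v0] := Hz.
have Hz' : eigenvalue (D + t%:C *: X') z.
  apply/eigenvalueP; exists (v *m P ^t*).
    rewrite scalemxAl -vE -!mulmxA; congr (v *m _).
    have -> : A + t%:C *: X = P ^t* *m (D + t%:C *: X') *m P.
      by rewrite {1}AE {1}XE mulmxDr mulmxDl -scalemxAr -scalemxAl.
    by rewrite -!mulmxA PPC mulmx1.
  apply: contra v0 => /eqP /(congr1 (mulmx^~ P)).
  by rewrite -mulmxA PCP mulmx1 mul0mx => ->.
have zq := eigenvalue_row_bounded (row_boundedD HD (row_boundedZ t HX')) Hz'.
have zr : (complex.Re z)%:C = z.
  have qv : 0 < qf v 1%:M.
    have -> : qf v 1%:M = complex.Re (\sum_i `|v 0 i| ^+ 2).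
      rewrite /qf mulmx1 mxE; congr complex.Re; apply: eq_bigr => i _.
      by rewrite !mxE -normCK.
    have s0 : 0 <= \sum_i `|v 0 i| ^+ 2 by apply: sumr_ge0 => i _; exact: exprn_ge0.
    rewrite -ltcR RRe_real ?ger0_real // lt0r s0 andbT.
    apply: contra v0 => /eqP H; apply/eqP/rowP => j; rewrite mxE; apply/eqP.
    rewrite -normr_eq0 -sqrf_eq0; apply/eqP.
    by have /psumr_eq0P -> // := H => i _; exact: exprn_ge0.
  have zE : z * (qf v 1%:M)%:C = (qf v (A + t%:C *: X))%:C.
    rewrite -!herm_qf ?hermitian1mx_subproof // vE mulmx1 -scalemxAl.
    by rewrite [RHS]mxE.
  suff -> : z = (qf v (A + t%:C *: X) / qf v 1%:M)%:C by [].
  rewrite rmorphM fmorphV /= -zE mulfK // -(rmorph0 (real_complex R)).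
  by rewrite (inj_eq (@complexI _)) gt_eqF.
have : `|complex.Re z| <= r + `|t| * q by rewrite -lecR (le_trans (normc_ge_Re _)).
by rewrite -zr !ltcR ler_norml; move: rq; lra.
Qed.

(** A Cauchy estimate: the scalar word sum times t^k is one term of (r + t x)^m, and t keeps r + t x
    at most (1+r)/2. The denominator x+1 covers x = 0. *)
Lemma qf_words_bound v k : exists K q, [/\ 0 <= K, 0 <= q, q < 1 &
  forall m, `|qf v (words A X m k)| <= K * q ^+ m].
Proof.
have [r /andP[r0 r1] Hr] := exists_spec_bound HA.
have HD : row_bounded D r by exact: row_bounded_diag.
have [x x0 HX'] := row_bounded_ex X'.
have [K K0 HK] := qf_row_bounded (v *m P ^t*).
pose t := (1 - r) / 2 / (x + 1).
have x10 : 0 < x + 1 by rewrite ltr_wpDl.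
have t0 : 0 < t by rewrite !divr_gt0 ?subr_gt0.
have tx : t * x <= (1 - r) / 2.
  by rewrite /t mulrAC ler_pdivrMr // ler_wpM2l ?lerDl // divr_ge0 // subr_ge0 ltW.
exists (K / t ^+ k), (r + t * x); split.
- by rewrite divr_ge0 // exprn_ge0 // ltW.
- by rewrite addr_ge0 // mulr_ge0 // ltW.
- by move: r1 tx; lra.
move=> m; rewrite qf_words mulrAC ler_pdivlMr ?exprn_gt0 //.
apply: (@le_trans _ _ (K * words r x m k * t ^+ k)).
  by rewrite ler_wpM2r ?exprn_ge0 ?(ltW t0) // HK //; exact: row_bounded_words.
rewrite -mulrA ler_wpM2l // words_expr => [|y]; last by rewrite mulrC.
have [mk|km] := ltnP m k.
  by rewrite words_small // mul0r sumr_ge0 // => j _; rewrite mulr_ge0 ?exprn_ge0 ?words_ge0 // ltW.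
rewrite (bigD1 (Ordinal (km : (k < m.+1)%N))) //= mulrC lerDl sumr_ge0 // => j _.
by rewrite mulr_ge0 ?exprn_ge0 ?words_ge0 // ltW.
Qed.

(** In absolute value the double expansion is dominated by the series of |a m| (r + |t| q)^m. The
    radius keeps the base below 1, so summing by powers of t instead of m is legitimate. *)
Lemma exists_radius : exists r : R, [/\ 0 < r,
  forall t, `|t| < r -> Msa (-1) 1 (A + t%:C *: X),
  forall v, geo_bounded (words_coef v) r &
  forall v t, `|t| < r ->
    qf v (fun_mx f (A + t%:C *: X)) = limn (pseries (words_coef v) t)].
Proof.
have [r /andP[r0 r1] Hr] := exists_spec_bound HA.
have HD : row_bounded D r by exact: row_bounded_diag.
have [q q0 HX'] := row_bounded_ex X'.
pose e := (1 - r) / (q + 1).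
have e0 : 0 < e by rewrite divr_gt0 ?subr_gt0 // ltr_wpDl.
have te t : 0 <= t -> t < e -> r + t * q < 1.
  move=> t0 te; rewrite -ltrBrDl; apply: le_lt_trans (_ : t * (q + 1) < _).
    by rewrite ler_wpM2l // lerDl.
  by rewrite -ltr_pdivlMr // ltr_wpDl.
have eM t : `|t| < e -> Msa (-1) 1 (A + t%:C *: X).
  by move=> t1; apply: (line_Msa HD HX') => //; exact: te.
suff H v : geo_bounded (words_coef v) e /\ forall t, `|t| < e ->
    qf v (fun_mx f (A + t%:C *: X)) = limn (pseries (words_coef v) t).
  by exists e; split=> // v; case: (H v).
have [K K0 HK] := qf_row_bounded (v *m P ^t*).
have key t : `|t| < e -> exists L p, [/\ 0 <= L, 0 <= p, p < 1 &
    forall m, \sum_(k < m.+1) `|a m * qf v (words A X m k) * t ^+ k| <= L * p ^+ m].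
  move=> /(te _ (normr_ge0 t)) t1.
  have t1' : `|r + `|t| * q| < 1 by rewrite ger0_norm // addr_ge0 // mulr_ge0.
  have [L [p [L0 p0 p1 Hp]]] := geo_bounded_split a_bounded t1'.
  exists (K * L), p; split => // [|m]; first exact: mulr_ge0.
  apply: (@le_trans _ _ (K * `|a m * (r + `|t| * q) ^+ m|)); last first.
    by rewrite -mulrA ler_wpM2l.
  have -> : `|a m * (r + `|t| * q) ^+ m| = \sum_(k < m.+1) `|a m| * (`|t| ^+ k * words r q m k).
    rewrite normrM (@ger0_norm _ (_ ^+ _)) ?exprn_ge0 ?addr_ge0 ?mulr_ge0 //.
    by rewrite words_expr ?mulr_sumr // => y; rewrite mulrC.
  rewrite mulr_sumr; apply: ler_sum => k _.
  rewrite !normrM normrX mulrCA -mulrA ler_wpM2l // mulrC mulrCA ler_wpM2l ?exprn_ge0 //.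
  by rewrite qf_words HK //; exact: row_bounded_words.
have small t m k : (m < k)%N -> a m * qf v (words A X m k) * t ^+ k = 0.
  by move=> mk; rewrite words_small // qf0 mulr0 mul0r.
(* Any nonzero t inside the radius would do: the column converges with its factor t^k, which is then
   divided out. *)
have words_cvg k : cvgn (series (fun m => a m * qf v (words A X m k))).
  have t1 : `|e / 2| < e by rewrite gtr0_norm; lra.
  have [L [p [L0 p0 p1 Hp]]] := key _ t1.
  have E : ((e / 2) ^+ k)^-1 *: (fun m => a m * qf v (words A X m k) * (e / 2) ^+ k) =
      fun m => a m * qf v (words A X m k).
    apply/funext => m; rewrite -[LHS]/(_ * _) mulrC mulfK // expf_neq0 // gt_eqF //.
    by lra.
  rewrite -E; apply: is_cvg_seriesZ.
  exact: (@cvg_column _ _ _ _ L0 p0 p1 (small (e / 2)) Hp k).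
have coefE t k : `|t| < e -> limn (series (fun m => a m * qf v (words A X m k) * t ^+ k)) =
    words_coef v k * t ^+ k.
  move=> t1; rewrite mulrC -[RHS]/(_ *: _) -lim_seriesZ //.
  by congr (limn (series _)); apply/funext => m; rewrite mulrC.
split.
  move=> s s0 se; have s1 : `|s| < e by rewrite gtr0_norm.
  have [L [p [L0 p0 p1 Hp]]] := key s s1.
  exists (L / (1 - p)) => k.
  rewrite -(ger0_norm (exprn_ge0 k (ltW s0))) -normrM -coefE //.
  exact: (column_le L0 p0 p1 (small s) Hp).
move=> t t1; rewrite qf_fun_mx_series; last exact: eM.
have [L [p [L0 p0 p1 Hp]]] := key t t1.
have := double_series L0 p0 p1 (small t) Hp.
have -> : (fun k => limn (series (fun m => a m * qf v (words A X m k) * t ^+ k))) =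
    fun k => words_coef v k * t ^+ k by apply/funext => k; rewrite coefE.
move=> <-; congr (limn (series _)); apply/funext => m.
have scalE (c : R[i]) (M : 'M[R[i]]_n) : c *: M = c%:M * M.
  by rewrite -[RHS]/(c%:M *m M) mul_scalar_mx.
rewrite scalE words_expr; last first.
  by move=> y; rewrite -scalE -[RHS]/(y *m _) mul_mx_scalar.
rewrite qf_sum mulr_sumr; apply: eq_bigr => k _.
have -> : (t%:C)%:M ^+ k * words A X m k = (t ^+ k)%:C *: words A X m k.
  elim: (k : nat) (words A X m k) => [|j IH] M; first by rewrite mul1r scale1r.
  by rewrite exprS -mulrA IH -scalE scalerA -rmorphM exprS.
by rewrite qfZ mulrCA mulrC.
Qed.

End MatrixExpansion.

(** * Entrywise derivatives from expansions of quadratic forms *)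

Section Expandable.
Variables (R : realType) (r : R).
Hypothesis r0 : 0 < r.

Definition expands (g : R -> R) (c : nat -> R) : Prop :=
  geo_bounded c r /\ forall t, `|t| < r -> g t = limn (pseries c t).

Lemma expands_derive g c k : expands g c -> derive1n k g 0 = k`!%:R * c k.
Proof. by case=> gc gE; exact: derive1n_pseries0 r0 gc gE. Qed.

Lemma expandsD g h c d : expands g c -> expands h d ->
  expands (fun t => g t + h t) (fun k => c k + d k).
Proof.
move=> [gc gE] [hd hE]; split; first exact: geo_boundedD.
move=> t tr; rewrite gE // hE //.
rewrite -lim_seriesD; [|exact: geo_cvg gc tr|exact: geo_cvg hd tr].
by congr (limn (series _)); apply/funext => k; rewrite [RHS]mulrDl.
Qed.

Lemma expandsZ x g c : expands g c -> expands (fun t => x * g t) (fun k => x * c k).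
Proof.
move=> [gc gE]; split; first exact: geo_boundedZ.
move=> t tr; rewrite gE // -[LHS]/(_ *: _) -lim_seriesZ; last exact: geo_cvg gc tr.
by congr (limn (series _)); apply/funext => k; exact: mulrA.
Qed.

Lemma expands_sum n (g : 'I_n -> R -> R) (c : 'I_n -> nat -> R) :
  (forall i, expands (g i) (c i)) ->
  expands (fun t => \sum_i g i t) (fun k => \sum_i c i k).
Proof.
elim: n g c => [|n IH] g c gc.
  rewrite (_ : (fun t => _) = fun=> 0); last by apply/funext => t; rewrite big_ord0.
  rewrite (_ : (fun k => _) = fun=> 0); last by apply/funext => t; rewrite big_ord0.
  split=> [s s0 sr|t tr]; first by exists 0 => k; rewrite normr0 mul0r.
  apply/esym/cvg_lim => //; rewrite (_ : pseries _ _ = fun=> 0); first exact: cvg_cst.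
  by apply/funext => N; rewrite /pseries /series /= big1 // => k _; rewrite mul0r.
rewrite (_ : (fun t => _) = fun t => \sum_(i < n) g (widen_ord (leqnSn n) i) t + g ord_max t); last first.
  by apply/funext => t; rewrite big_ord_recr.
rewrite (_ : (fun k => _) = fun k => \sum_(i < n) c (widen_ord (leqnSn n) i) k + c ord_max k); last first.
  by apply/funext => t; rewrite big_ord_recr.
by apply: expandsD => //; exact: IH.
Qed.

Variables (n : nat) (G : R -> 'M[R[i]]_n) (c : 'rV[R[i]]_n -> nat -> R).
Hypothesis hermG : forall t, G t \is hermsymmx.
Hypothesis qfG : forall v, expands (fun t => qf v (G t)) (c v).

Let expands_Re i j : exists d, expands (fun t => complex.Re (G t i j)) d.
Proof.
eexists; rewrite (_ : (fun t => _) = fun t => 2^-1 * (qf (delta_mx 0 i + delta_mx 0 j) (G t) +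
    (-1) * qf (delta_mx 0 i) (G t) + (-1) * qf (delta_mx 0 j) (G t))).
  by apply: expandsZ; apply: expandsD; [apply: expandsD|]; [|apply: expandsZ..].
by apply/funext => t; rewrite (herm_polar i j (hermG t)).1 !mulN1r mulrC.
Qed.

Let expands_Im i j : exists d, expands (fun t => complex.Im (G t i j)) d.
Proof.
eexists; rewrite (_ : (fun t => _) = fun t => 2^-1 * (qf (delta_mx 0 i + 'i *: delta_mx 0 j) (G t) +
    (-1) * qf (delta_mx 0 i) (G t) + (-1) * qf (delta_mx 0 j) (G t))).
  by apply: expandsZ; apply: expandsD; [apply: expandsD|]; [|apply: expandsZ..].
by apply/funext => t; rewrite (herm_polar i j (hermG t)).2 !mulN1r mulrC.
Qed.

Lemma herm_derive1n_mx k : derive1n_mx k G 0 \is hermsymmx.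
Proof.
apply/hermP => i j; rewrite !mxE conjC_conjc /=; congr Complex.
  congr (derive1n k _ 0); apply/funext => t.
  by have /hermP -> := hermG t; rewrite conjC_conjc; case: (G t j i).
have [d Hd] := expands_Im j i.
rewrite (expands_derive k Hd) -mulrN -mulN1r.
have : expands (fun t => complex.Im (G t i j)) (fun k => (-1) * d k).
  rewrite (_ : (fun t => _) = fun t => (-1) * complex.Im (G t j i)); first exact: expandsZ.
  apply/funext => t; have /hermP -> := hermG t.
  by rewrite mulN1r conjC_conjc; case: (G t j i).
by move=> /(expands_derive k) ->.
Qed.

(** The form is a real combination of real and imaginary parts of entries, whose expansions give a
    second expansion of the same function; both compute its k-th derivative at 0. *)
Lemma qf_derive1n_mx k v : qf v (derive1n_mx k G 0) = k`!%:R * c v k.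
Proof.
have /choice[d Hd] : forall ij : 'I_n * 'I_n, exists d,
    expands (fun t => complex.Re (G t ij.1 ij.2)) d by move=> ij; exact: expands_Re.
have /choice[e He] : forall ij : 'I_n * 'I_n, exists e,
    expands (fun t => complex.Im (G t ij.1 ij.2)) e by move=> ij; exact: expands_Im.
pose x i j : R := complex.Re (v 0 i * conjC (v 0 j)).
pose y i j : R := complex.Im (v 0 i * conjC (v 0 j)).
have qfE M : qf v M = \sum_i \sum_j (x i j * complex.Re (M i j) + (- y i j) * complex.Im (M i j)).
  rewrite qf_entries; apply: eq_bigr => i _; apply: eq_bigr => j _.
  by rewrite /x /y; case: (v 0 i * _) (M i j) => p q [p' q'] /=; rewrite mulNr.
have E : expands (fun t => qf v (G t))
    (fun k => \sum_i \sum_j (x i j * d (i, j) k + (- y i j) * e (i, j) k)).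
  rewrite (_ : (fun t => qf v _) = fun t =>
    \sum_i \sum_j (x i j * complex.Re (G t i j) + (- y i j) * complex.Im (G t i j))); last first.
    by apply/funext => t; exact: qfE.
  apply: (expands_sum (c := fun i k => _)) => i; apply: (expands_sum (c := fun j k => _)) => j.
  by apply: expandsD; apply: expandsZ; [exact: (Hd (i, j))|exact: (He (i, j))].
rewrite -(expands_derive k (qfG v)) (expands_derive k E) qfE mulr_sumr.
apply: eq_bigr => i _; rewrite mulr_sumr; apply: eq_bigr => j _.
rewrite !mxE /= (expands_derive k (Hd (i, j))) (expands_derive k (He (i, j))).
by rewrite mulrDr !(mulrCA k`!%:R).
Qed.

End Expandable.

Lemma psd_derive1n_fun_mx (R : realType) (f : R -> R) (a : nat -> R) :
  geo_bounded a 1 -> (forall x, `|x| < 1 -> f x = limn (pseries a x)) ->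
  forall n (A X : 'M[R[i]]_n) k, Msa (-1) 1 A -> X \is hermsymmx ->
  psdmx (derive1n_mx k (fun t => fun_mx f (A + t%:C *: X)) 0) <->
  forall v, 0 <= words_coef a A X v k.
Proof.
move=> ga fa n A X k HA HX.
have [r [r0 _ gr qr]] := exists_radius ga fa HA HX.
have hG t : fun_mx f (A + t%:C *: X) \is hermsymmx by exact: herm_fun_mx.
have qG v : expands r (fun t => qf v (fun_mx f (A + t%:C *: X))) (words_coef a A X v).
  by split; [exact: gr|exact: qr].
have kf : 0 < k`!%:R :> R by rewrite ltr0n fact_gt0.
rewrite psdmxP; split=> [[_ H] v|H].
  by have := H v; rewrite (qf_derive1n_mx r0 hG qG) pmulr_rge0.
split; first exact: (herm_derive1n_mx r0 hG qG).
by move=> v; rewrite (qf_derive1n_mx r0 hG qG) pmulr_rge0.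
Qed.

Section Scalar.
Variables (R : realType) (f : R -> R).
Hypothesis oamf : operator_absolutely_monotone (-1) 1 f.

Lemma derive1n_shift (g : R -> R) x k :
  derive1n k (fun t => g (x + t)) = fun t => derive1n k g (x + t).
Proof.
elim: k => [//|k IH]; rewrite !derive1nS IH; apply/funext => t.
rewrite /derive1.
suff -> : (fun h => h^-1 *: (derive1n k g (x + (h + t)) - derive1n k g (x + t))) =
  (fun h => h^-1 *: (derive1n k g (h + (x + t)) - derive1n k g (x + t))) by [].
by apply/funext => h; rewrite (addrCA x h t).
Qed.

Lemma fun_mx_scalar (y : R) : fun_mx f ((y%:C)%:M : 'M[R[i]]_1) = ((f y)%:C)%:M.
Proof.
set B := _%:M.
have hB : B \is hermsymmx.
  by apply/hermP => i j; rewrite !ord1 !mxE eqxx conjC_conjc conjc_real.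
(* The diagonalisation is not computed; taking g = id identifies the single eigenvalue as y. *)
have E g : fun_mx g B = ((g (spec B 0))%:C)%:M.
  rewrite (eq_fun_mx (g := fun=> g (spec B 0) * 1)).
    by rewrite -fun_mxZ fun_mx1 scalemx1.
  by move=> l; rewrite ord1 mulr1.
have := E id; rewrite fun_mx_id // E => /matrixP /(_ 0 0).
by rewrite !mxE eqxx !mulr1n => /complexI ->.
Qed.

(** The 1-by-1 case with direction X = 1, where the matrix derivative is a translate of the scalar
    one. *)
Lemma oam_derive1n_ge0 k x : x \in `]-1, 1[ -> 0 <= derive1n k f x.
Proof.
rewrite in_itv /= => x1; have [_ H] := oamf.
have MA : Msa (-1) 1 ((x%:C)%:M : 'M[R[i]]_1).
  split; first by apply/hermP => i j; rewrite !ord1 !mxE eqxx conjC_conjc conjc_real.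
  move=> z /eigenvalueP [v vE v0].
  have v00 : v 0 0 != 0.
    by apply: contra v0 => /eqP v00; apply/eqP/rowP => j; rewrite ord1 v00 mxE.
  have := congr1 (fun M : 'M[R[i]]_(_,_) => M 0 0) vE.
  by rewrite mul_mx_scalar !mxE => /(mulIf v00) <-; rewrite !ltcR.
have PX : psdmx (1%:M : 'M[R[i]]_1).
  apply/psdmxP; split; first exact: hermitian1mx_subproof.
  by move=> v; rewrite -(fun_mx1 1%:M) qf_fun_mx sumr_ge0 // => l _; rewrite mul1r spec_weight_ge0.
have := H 1%N _ _ MA PX k => /psdmxP [_ /(_ 1%:M)].
rewrite /qf mul1mx trmx1 map_mx1 mulmx1 mxE /=.
have -> : (fun s : R => complex.Re (fun_mx f ((x%:C)%:M + s%:C *: (1%:M : 'M[R[i]]_1)) 0 0)) =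
    (fun s : R => f (x + s)).
  apply/funext => s; rewrite scalemx1 -raddfD /= -rmorphD /=.
  by rewrite fun_mx_scalar mxE eqxx.
by rewrite derive1n_shift addr0.
Qed.

End Scalar.

(** * Word sums for a diagonal matrix and the all-ones matrix *)

Section RankOne.
Variables (R : realType) (n : nat) (y w : 'I_n -> R).

Let A : 'M[R[i]]_n := diag_mx (\row_l (y l)%:C).
Let u : 'rV[R[i]]_n := const_mx 1.
Let X : 'M[R[i]]_n := u ^t* *m u.
Let v : 'rV[R[i]]_n := \row_l (w l)%:C.

Definition wsum i : R := \sum_l w l * y l ^+ i.
Definition psum i : R := \sum_l y l ^+ i.

Let bil (s : 'rV[R[i]]_n) (M : 'M[R[i]]_n) (t : 'rV[R[i]]_n) : R[i] := (s *m M *m t ^t*) 0 0.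

Lemma diag_expr i : A ^+ i = diag_mx (\row_l (y l ^+ i)%:C).
Proof.
elim: i => [|i IH].
  by apply/matrixP => j k; rewrite expr0 !mxE expr0; case: eqP.
rewrite exprS IH -[LHS]/(_ *m _) mulmx_diag; congr diag_mx; apply/rowP => l.
by rewrite !mxE -rmorphM exprS.
Qed.

Let bil_diag (s t : 'I_n -> R) i :
  bil (\row_l (s l)%:C) (A ^+ i) (\row_l (t l)%:C) = (\sum_l s l * t l * y l ^+ i)%:C.
Proof.
rewrite /bil diag_expr mul_mx_diag mxE rmorph_sum; apply: eq_bigr => l _.
by rewrite !mxE conjC_conjc conjc_real -!rmorphM mulrAC.
Qed.

Let uE : u = \row_l ((fun=> 1) l)%:C.
Proof. by apply/rowP => l; rewrite !mxE. Qed.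

Let bil_vu i : bil v (A ^+ i) u = (wsum i)%:C.
Proof. by rewrite uE bil_diag; congr (_%:C); apply: eq_bigr => l _; rewrite mulr1. Qed.

Let bil_uv i : bil u (A ^+ i) v = (wsum i)%:C.
Proof. by rewrite uE bil_diag; congr (_%:C); apply: eq_bigr => l _; rewrite mul1r. Qed.

Let bil_uu i : bil u (A ^+ i) u = (psum i)%:C.
Proof. by rewrite uE bil_diag; congr (_%:C); apply: eq_bigr => l _; rewrite !mul1r. Qed.

Let bil_sum s t (I : finType) (F : I -> 'M[R[i]]_n) :
  bil s (\sum_i F i) t = \sum_i bil s (F i) t.
Proof. by rewrite /bil mulmx_sumr mulmx_suml summxE. Qed.

(** Rank one of [X] splits the form at the letter [X] into a product of two scalars. *)
Let bilX s t M N : bil s (M *m X *m N) t = bil s M u * bil u N t.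
Proof.
rewrite /bil /X !mulmxA -(mulmxA _ u N) -(mulmxA _ (u *m N)) mxE.
by rewrite big_ord1.
Qed.

Let bil_words s t m k : bil s (words A X m.+1 k.+1) t =
  \sum_(i < m.+1) bil s (A ^+ i) u * bil u (words A X (m - i) k) t.
Proof. by rewrite wordsS bil_sum; apply: eq_bigr => i _; exact: bilX. Qed.

(** The form between [u] and [v] of the words of length m with one letter [X]; the empty word has
    none, hence 0 at m = 0. *)
Definition mixed_sum m : R :=
  if m is m'.+1 then \sum_(i < m'.+1) psum i * wsum (m' - i) else 0.

Lemma qf_words1 m : qf v (words A X m.+1 1) = \sum_(i < m.+1) wsum i * wsum (m - i).
Proof.
rewrite /qf -/(bil v _ v) bil_words Re_sum; apply: eq_bigr => i _.
by rewrite words0 bil_vu bil_uv -rmorphM.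
Qed.

Let bil_mixed m : bil u (words A X m 1) v = (mixed_sum m)%:C.
Proof.
case: m => [|m]; first by rewrite /bil mulmx0 mul0mx mxE.
rewrite bil_words rmorph_sum; apply: eq_bigr => i _.
by rewrite words0 bil_uu bil_uv -rmorphM.
Qed.

Lemma qf_words2 m : qf v (words A X m.+1 2) = \sum_(i < m.+1) wsum i * mixed_sum (m - i).
Proof.
rewrite /qf -/(bil v _ v) bil_words Re_sum; apply: eq_bigr => i _.
by rewrite bil_vu bil_mixed -rmorphM.
Qed.

Lemma psd_ones : psdmx X.
Proof.
apply/psdmxP; split; first by rewrite herm_trC /X conjC_mxM trmxCK.
move=> s; rewrite /qf /X !mulmxA -mulmxA mxE big_ord1.
rewrite -[u]trmxCK -conjC_mxM trmxCK [X in _ * X]mxE [X in conjC X]mxE.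
exact: Re_mul_conj_ge0.
Qed.

Lemma Msa_diag : (forall l, `|y l| < 1) -> Msa (-1) 1 A.
Proof.
move=> y1; have hA : A \is hermsymmx.
  apply/hermP => i j; rewrite !mxE conjC_conjc eq_sym; case: eqP => [->|_].
    by rewrite !mulr1n conjc_real.
  by rewrite !mulr0n conjc0.
split=> // z /eigenvalueP [s sE s0].
have [l sl] : exists l, s 0 l != 0.
  apply/existsP; apply: contraNT s0; rewrite negb_exists => /forallP H.
  by apply/eqP/rowP => l; rewrite mxE; apply/eqP; rewrite -[_ == _]negbK H.
have := congr1 (fun M : 'rV[R[i]]_n => M 0 l) sE; rewrite mul_mx_diag !mxE mulrC.
by move=> /(mulIf sl) <-; rewrite !ltcR -ltr_norml.
Qed.

End RankOne.

(** * Hankel positivity of the Taylor coefficients *)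

Section Limits.
Variable R : realType.

Lemma lim_series_tail (u : nat -> R) K q n :
  0 <= K -> 0 <= q -> q < 1 -> (forall m, `|u m| <= K * q ^+ m) ->
  limn (series u) - K * q ^+ n / (1 - q) <= series u n.
Proof.
move=> K0 q0 q1 uK; rewrite lerBlDl.
apply: (cvgr_to_le (cvg_geometric_dominated K0 q0 q1 uK)); exists n => // M /= nM.
rewrite /series /= (@big_cat_nat _ _ _ n) //= addrC lerD2r.
apply: le_trans (geometric_sum_le K0 q0 q1 n M).
by apply: ler_sum => m _; apply: le_trans (ler_norm _) (uK m).
Qed.

Lemma cvg_geometric_tail (K q : R) : 0 <= q -> q < 1 ->
  (fun n => - (K * q ^+ n / (1 - q))) @ \oo --> (0 : R).
Proof.
move=> q0 q1; rewrite -oppr0; apply: cvgN.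
rewrite (_ : (fun n => _) = geometric (K / (1 - q)) q).
  by apply: cvg_geometric; rewrite ger0_norm.
by apply/funext => n; rewrite /= mulrAC.
Qed.

(** Dominated convergence: the tails are uniformly small, so each partial sum of the limit is at
    least minus a tail. *)
Lemma series_ge0_limit (u : nat -> nat -> R) (w : nat -> R) K q :
  0 <= K -> 0 <= q -> q < 1 -> (forall N m, `|u N m| <= K * q ^+ m) ->
  (forall m, u ^~ m @ \oo --> w m) -> (forall N, 0 <= limn (series (u N))) ->
  0 <= limn (series w).
Proof.
move=> K0 q0 q1 uK uw u0.
have wK m : `|w m| <= K * q ^+ m.
  by apply: (cvgr_to_le (cvg_norm (uw m))); apply: nearW => N; exact: uK.
have cw := cvg_geometric_dominated K0 q0 q1 wK.
pose e n := K * q ^+ n / (1 - q).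
have tail N n := lim_series_tail n K0 q0 q1 (uK N).
have part n : - e n <= series w n.
  have H : (fun N => series (u N) n) @ \oo --> series w n.
    rewrite /series /= big_mkord; under eq_fun do rewrite big_mkord.
    by apply: cvg_sum_ord => i; exact: uw.
  apply: (cvgr_to_ge H); apply: nearW => N.
  by apply: le_trans (tail N n); rewrite lerDr.
have e0 : (fun n => - e n) @ \oo --> (0 : R) by exact: cvg_geometric_tail.
by apply: (ler_cvg_to e0 cw); exact: nearW.
Qed.

Lemma lim_moment (a : nat -> R) (p : {poly R}) :
  limn (series (fun m => a m * p`_m)) = moment a p.
Proof.
apply/cvg_lim => //; apply: cvg_near_cst; exists (size p) => // n /= pn.
rewrite /series /= big_mkord (moment_widen a pn).
by apply: eq_bigr => i _; rewrite mulrC.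
Qed.

End Limits.

Section HankelWeights.
Variables (R : realType) (p : {poly R}).

(* Nodes shrinking to 0 and weights whose first moments are exactly the
   coefficients of [p]; the higher moments then tend to 0. *)
Lemma exists_shrinking_nodes (q : R) : 0 < q -> q <= 1 ->
  exists n (y w : nat -> 'I_n.+1 -> R) L,
  [/\ forall N l, 0 <= y N l < q,
      forall N i, `|wsum (y N) (w N) i| <= L * q ^+ i,
      forall i, (fun N => wsum (y N) (w N) i) @ \oo --> p`_i,
      forall N i, `|psum (y N) i| <= L * q ^+ i &
      forall i, (fun N => psum (y N) i) @ \oo --> (if i == 0%N then n.+1%:R else 0 : R)].
Proof.
move=> q0 q1; pose n := size p.
(* Fixed distinct nodes make the Vandermonde matrix invertible once and for all; only the scale e N
   shrinks. *)
pose x (l : 'I_n.+1) : R := l%:R / n.+1%:R.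
have n0 : 0 < n.+1%:R :> R by rewrite ltr0n.
have x01 l : 0 <= x l < 1.
  by rewrite divr_ge0 //= ltr_pdivrMr // mul1r ltr_nat ltn_ord.
pose V := Vandermonde n.+1 (\row_l x l).
have Vunit : V \in unitmx.
  rewrite unitmxE det_Vandermonde unitfE; apply/prodf_neq0 => i _.
  apply/prodf_neq0 => j ij; rewrite !mxE subr_eq0 /x.
  apply/negP => /eqP /(mulIf (invr_neq0 (lt0r_neq0 n0))) /eqP.
  by rewrite eqr_nat => /eqP ji; rewrite ji ltnn in ij.
pose e N : R := q / N.+1%:R.
have e0 N : 0 < e N by rewrite divr_gt0.
have eq N : e N <= q by rewrite ler_pdivrMr ?ltr0n // ler_peMr ?ler1n // ltW.
have e1 N : e N <= 1 by exact: le_trans (eq N) q1.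
have y0 N l : 0 <= e N * x l.
  by have /andP[x0 _] := x01 l; rewrite mulr_ge0 // ltW.
have ye N l : e N * x l <= e N.
  by have /andP[_ x1] := x01 l; rewrite ger_pMr // ltW.
(* Dividing by the i-th power of the scale turns the moment conditions at the shrunken nodes into a
   system at the fixed ones. *)
pose c N : 'cV[R]_n.+1 := \col_i (p`_i / e N ^+ i).
pose w N (l : 'I_n.+1) := (invmx V *m c N) l 0.
pose y N l := e N * x l.
have wE N (i : nat) : (i < n.+1)%N -> wsum (y N) (w N) i = p`_i.
  move=> ni; have := congr1 (fun M : 'cV[R]_n.+1 => M (Ordinal ni) 0) (mulKVmx Vunit (c N)).
  rewrite !mxE => H; rewrite /wsum.
  have ei : e N ^+ i != 0 by rewrite expf_neq0 // gt_eqF.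
  apply: (mulIf (invr_neq0 ei)); rewrite -H mulr_suml; apply: eq_bigr => l _.
  rewrite /y /V !mxE exprMn -/V /= (_ : w N l = \sum_j invmx V l j * c N j 0); last first.
    by rewrite /w mxE.
  by field.
have e_lim : e @ \oo --> (0 : R).
  rewrite -(mulr0 q); apply: cvgMr.
  exact: cvg_harmonic.
pose C := \sum_(l < n.+1) \sum_(i < n.+1) `|invmx V l i| * `|p`_i|.
have C0 : 0 <= C by do 2![apply: sumr_ge0 => ? _]; rewrite mulr_ge0.
have w_le N : \sum_l `|w N l| <= C / e N ^+ n.
  rewrite /C mulr_suml; apply: ler_sum => l _; rewrite /w mxE mulr_suml.
  apply: le_trans (ler_norm_sum _ _ _) _; apply: ler_sum => i _.
  rewrite normrM -mulrA ler_wpM2l // mxE normrM ler_wpM2l //.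
  rewrite gtr0_norm ?invr_gt0 ?exprn_gt0 //.
  rewrite lef_pV2 ?posrE ?exprn_gt0 // ler_wiXn2l // ?(ltW (e0 N)) //.
  by rewrite -ltnS.
have wi_le N i : `|wsum (y N) (w N) i| <= e N ^+ i * (\sum_l `|w N l|).
  apply: le_trans (ler_norm_sum _ _ _) _; rewrite mulr_sumr; apply: ler_sum => l _.
  rewrite normrM mulrC ler_wpM2r // normrX (ger0_norm (y0 N l)).
  by rewrite lerXn2r ?nnegrE ?(ltW (e0 N)) ?y0 ?ye //.
(* The weights may grow like e^(-n) while the i-th powers of the nodes are at most e^i, so a
   positive power of e remains beyond order n. *)
have wi_big N i : (n < i)%N -> `|wsum (y N) (w N) i| <= C * e N ^+ (i - n).
  move=> ni; apply: le_trans (wi_le N i) _.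
  apply: le_trans (ler_wpM2l _ (w_le N)) _; first by rewrite exprn_ge0 // ltW.
  rewrite mulrCA ler_wpM2l // -{1}(subnK (ltnW ni)) exprD mulfK //.
  by rewrite expf_neq0 // gt_eqF.
have psum_le_e N i : `|psum (y N) i| <= n.+1%:R * e N ^+ i.
  apply: le_trans (ler_norm_sum _ _ _) _.
  rewrite -[n.+1 in leRHS]card_ord mulr_natl -sumr_const; apply: ler_sum => l _.
  rewrite normrX (ger0_norm (y0 N l)).
  by rewrite lerXn2r ?nnegrE ?(ltW (e0 N)) ?y0 ?ye //.
have psum_le N i : `|psum (y N) i| <= n.+1%:R * q ^+ i.
  apply: le_trans (psum_le_e N i) _.
  by rewrite ler_wpM2l // lerXn2r ?nnegrE // ltW.
pose P := \sum_(i < n.+1) `|p`_i|.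
have P0 : 0 <= P by exact: sumr_ge0.
have qn : 0 < q ^+ n by rewrite exprn_gt0.
exists n, y, w, ((C + P) / q ^+ n + n.+1%:R); split.
- move=> N l; have /andP[x0 x1] := x01 l.
  rewrite /y y0 /=; apply: lt_le_trans (eq N).
  by rewrite gtr_pMr.
- move=> N i; apply: (@le_trans _ _ ((C + P) / q ^+ n * q ^+ i)); last first.
    by rewrite ler_wpM2r ?exprn_ge0 ?(ltW q0) // lerDl.
  rewrite mulrAC ler_pdivlMr //.
  have [ni|ni] := ltnP n i.
    apply: (@le_trans _ _ (C * e N ^+ (i - n) * q ^+ n)).
      by rewrite ler_wpM2r ?wi_big // ltW.
    rewrite -[in leRHS](subnK (ltnW ni)) exprD mulrA ler_wpM2r ?(ltW qn) //.
    apply: ler_pM => //; first by rewrite exprn_ge0 // ltW.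
      by rewrite lerDl.
    by rewrite lerXn2r ?nnegrE // ltW.
  rewrite wE //; apply: ler_pM => //; rewrite ?(ltW qn) //.
    rewrite /P (bigD1 (Ordinal (ni : (i < n.+1)%N))) //= addrCA lerDl addr_ge0 //.
    exact: sumr_ge0.
  by rewrite ler_wiXn2l // ltW.
- move=> i; have [ni|ni] := ltnP n i; last first.
    rewrite (_ : (fun N => _) = cst p`_i); first exact: cvg_cst.
    by apply/funext => N; rewrite wE.
  rewrite nth_default; last by rewrite ltnW.
  apply/norm_cvg0P.
  apply: (@squeeze_cvgr _ _ _ _ (cst 0) (fun N => C * e N)).
  + apply: nearW => N; rewrite normr_ge0 /= (le_trans (wi_big N i ni)) // ler_wpM2l //.
    by rewrite -[leRHS]expr1 ler_wiXn2l ?(ltW (e0 N)) // subn_gt0.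
  + exact: cvg_cst.
  + by rewrite -(mulr0 C); apply: cvgMr.
- move=> N i; apply: (@le_trans _ _ (n.+1%:R * q ^+ i)); last first.
    by rewrite ler_wpM2r ?exprn_ge0 ?(ltW q0) // lerDr divr_ge0 ?addr_ge0 // ltW.
  exact: psum_le.
- move=> [|i] /=.
    rewrite (_ : (fun N => _) = cst n.+1%:R); first exact: cvg_cst.
    apply/funext => N; rewrite /psum; under eq_bigr do rewrite expr0.
    by rewrite sumr_const card_ord.
  apply/norm_cvg0P.
  apply: (@squeeze_cvgr _ _ _ _ (cst 0) (fun N => n.+1%:R * e N)).
  + apply: nearW => N; rewrite normr_ge0 /= (le_trans (psum_le_e N i.+1)) // ler_wpM2l //.
    by rewrite -[leRHS]expr1 ler_wiXn2l // ltW.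
  + exact: cvg_cst.
  + by rewrite -(mulr0 n.+1%:R); apply: cvgMr.
Qed.

End HankelWeights.

Section Convolution.
Variable R : realType.
Implicit Types (x y : nat -> R).

(** All m+1 products have size q^m; the count is at most 2 * 2^m, by the geometric bound at ratio
    1/2. *)
Lemma convolution_bound x y Bx By q m : 0 <= q ->
  (forall i, `|x i| <= Bx * q ^+ i) -> (forall i, `|y i| <= By * q ^+ i) ->
  `|\sum_(i < m.+1) x i * y (m - i)%N| <= 2 * Bx * By * (2 * q) ^+ m.
Proof.
move=> q0 xB yB; have Bx0 : 0 <= Bx by have := xB 0%N; rewrite mulr1; apply: le_trans.
have By0 : 0 <= By by have := yB 0%N; rewrite mulr1; apply: le_trans.
apply: (@le_trans _ _ (\sum_(i < m.+1) Bx * By * q ^+ m)).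
  apply: le_trans (ler_norm_sum _ _ _) _; apply: ler_sum => i _.
  have -> : Bx * By * q ^+ m = (Bx * q ^+ i) * (By * q ^+ (m - i)).
    rewrite -{1}(subnKC (_ : i <= m)%N) ?exprD; last by rewrite -ltnS.
    by ring.
  by rewrite normrM ler_pM.
rewrite sumr_const card_ord -[leLHS]mulr_natl.
have := @succ_geo_le R (2^-1) m; rewrite invr_ge0 ler0n invf_lt1 // => /(_ isT).
rewrite ltr1n => /(_ isT) H.
have {}H : m.+1%:R <= 2 * 2 ^+ m :> R.
  rewrite -ler_pdivrMr ?exprn_gt0 // -exprVn; apply: le_trans H _.
  by rewrite (_ : 1 - 2^-1 = 2^-1) ?invrK //; field.
have -> : 2 * Bx * By * (2 * q) ^+ m = 2 * 2 ^+ m * (Bx * By * q ^+ m).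
  by rewrite exprMn; ring.
by rewrite ler_wpM2r ?mulr_ge0 ?exprn_ge0.
Qed.

Lemma convolution_cvg (x y : nat -> nat -> R) x' y' m :
  (forall i, x ^~ i @ \oo --> x' i) -> (forall i, y ^~ i @ \oo --> y' i) ->
  (fun N => \sum_(i < m.+1) x N i * y N (m - i)%N) @ \oo -->
  (\sum_(i < m.+1) x' i * y' (m - i)%N : R).
Proof. by move=> xl yl; apply: cvg_sum_ord => i; apply: cvgM; [exact: xl|exact: yl]. Qed.

(** The rate 1/8 leaves room for [a], which may grow like 2^m at the sampled radius 1/2: the product
    decays at rate 1/4. The limit of z is shifted by one index, whence the factor X. *)
Lemma moment_ge0_limit (a : nat -> R) (z : nat -> nat -> R) (p : {poly R}) B :
  geo_bounded a 1 -> (forall N, z N 0%N = 0) ->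
  (forall N m, `|z N m.+1| <= B * 8^-1 ^+ m) ->
  (forall m, (fun N => z N m.+1) @ \oo --> p`_m) ->
  (forall N, 0 <= limn (series (fun m => a m * z N m))) -> 0 <= moment a ('X * p).
Proof.
move=> ga z0 zB zl zge0; rewrite -lim_moment.
have [K HK] : exists K, forall k, `|a k| * 2^-1 ^+ k <= K by apply: ga; lra.
have K0 : 0 <= K by apply: le_trans (HK 0%N); rewrite mulr_ge0.
have B0 : 0 <= B by have := zB 0%N 0%N; rewrite mulr1; apply: le_trans.
apply: (@series_ge0_limit _ (fun N m => a m * z N m) _ (8 * K * B) 4^-1).
- by rewrite !mulr_ge0.
- by rewrite invr_ge0.
- by rewrite invf_lt1 // ltr1n.
- move=> N [|m]; first by rewrite z0 mulr0 normr0 !mulr_ge0 ?exprn_ge0.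
  have -> : 8 * K * B * 4^-1 ^+ m.+1 = (K * 2 ^+ m.+1) * (B * 8^-1 ^+ m).
    rewrite (_ : 8^-1 = 4^-1 * 2^-1); last by field.
    have ? : 2 ^+ m != 0 :> R by rewrite expf_neq0.
    by rewrite !exprS exprMn exprVn [(2^-1) ^+ m]exprVn; field; rewrite ?expf_neq0.
  by rewrite normrM ler_pM // -ler_pdivrMr ?exprn_gt0 // -exprVn.
- move=> [|m]; rewrite coefXM /=; last by apply: cvgMr; exact: zl.
  rewrite (_ : (fun N => _) = cst 0); first by rewrite mulr0; exact: cvg_cst.
  by apply/funext => N; rewrite z0 mulr0.
exact: zge0.
Qed.

End Convolution.

Section HankelOfMonotone.
Variables (R : realType) (f : R -> R).
Hypothesis oamf : operator_absolutely_monotone (-1) 1 f.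

Definition taylor_coef k : R := derive1n k f 0 / k`!%:R.

Lemma taylor_coef_bounded : geo_bounded taylor_coef 1.
Proof.
apply: bernstein_bounded; first by case: oamf.
by move=> k x; exact: oam_derive1n_ge0.
Qed.

Lemma taylor_series x : `|x| < 1 -> f x = limn (pseries taylor_coef x).
Proof.
apply: bernstein; first by case: oamf.
by move=> k y; exact: oam_derive1n_ge0.
Qed.

Let words_coef_ge0 n (A X : 'M[R[i]]_n) k v : Msa (-1) 1 A -> psdmx X ->
  0 <= words_coef taylor_coef A X v k.
Proof.
move=> HA HX; have HXh : X \is hermsymmx by have /psdmxP[] := HX.
have [_ H] := oamf; have := H _ _ _ HA HX k.
by move=> /(psd_derive1n_fun_mx taylor_coef_bounded taylor_series k HA HXh).
Qed.

(* A convolution at most doubles the growth rate, so starting from 1/32 the rates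
   1/16 and 1/8 of the first and second order word sums stay below 1. *)
Lemma oam_hankel_pos : hankel_pos (fun k => taylor_coef k.+1).
Proof.
have q0 : 0 < 32^-1 :> R by rewrite invr_gt0.
have q1 : 32^-1 <= 1 :> R by rewrite invf_le1 // ler1n.
split.
- rewrite (_ : (fun k => _) = fun k => taylor_coef (k + 1)%N).
    exact: geo_bounded_shift taylor_coef_bounded.
  by apply/funext => k; rewrite addn1.
- move=> p; rewrite -momentMX.
  have [n [y [w [L [y01 wL wl dL dl]]]]] := exists_shrinking_nodes p q0 q1.
  pose A N : 'M[R[i]]_n.+1 := diag_mx (\row_l (y N l)%:C).
  pose u : 'rV[R[i]]_n.+1 := const_mx 1.
  pose v N : 'rV[R[i]]_n.+1 := \row_l (w N l)%:C.
  have MA N : Msa (-1) 1 (A N).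
    by apply: Msa_diag => l; have /andP[y0 yq] := y01 N l; rewrite ger0_norm // (lt_le_trans yq).
  have L0 : 0 <= L by have := wL 0%N 0%N; rewrite mulr1; apply: le_trans.
  apply: (@moment_ge0_limit _ _ (fun N m => qf (v N) (words (A N) (u ^t* *m u) m 1)) _ (2 * L * L)).
  + exact: taylor_coef_bounded.
  + by move=> N; rewrite qf0.
  + move=> N m; rewrite qf_words1.
    apply: le_trans (convolution_bound m (ltW q0) (wL N) (wL N)) _.
    rewrite ler_wpM2l ?mulr_ge0 ?L0 // lerXn2r ?nnegrE; lra.
  + move=> m; rewrite expr2 coefM.
    have -> : (fun N => qf (v N) (words (A N) (u ^t* *m u) m.+1 1)) =
        fun N => \sum_(i < m.+1) wsum (y N) (w N) i * wsum (y N) (w N) (m - i).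
      by apply/funext => N; exact: qf_words1.
       exact: (@convolution_cvg R _ _ _ _ m wl wl).
  + by move=> N; apply: words_coef_ge0 => //; exact: psd_ones.
- move=> p.
  have [n [y [w [L [y01 wL wl dL dl]]]]] := exists_shrinking_nodes p q0 q1.
  pose A N : 'M[R[i]]_n.+1 := diag_mx (\row_l (y N l)%:C).
  pose u : 'rV[R[i]]_n.+1 := const_mx 1.
  pose v N : 'rV[R[i]]_n.+1 := \row_l (w N l)%:C.
  have MA N : Msa (-1) 1 (A N).
    by apply: Msa_diag => l; have /andP[y0 yq] := y01 N l; rewrite ger0_norm // (lt_le_trans yq).
  have L0 : 0 <= L by have := wL 0%N 0%N; rewrite mulr1; apply: le_trans.
  (* The convolution bound 2 L L (1/16)^m sits at index m+1 of [mixed_sum], which costs a factor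
     16. *)
  pose M : R := 32 * L * L.
  have M0 : 0 <= M by rewrite !mulr_ge0.
  have mixB N m : `|mixed_sum (y N) (w N) m| <= M * 16^-1 ^+ m.
    case: m => [|m]; first by rewrite normr0 mulr_ge0 ?exprn_ge0.
    apply: le_trans (convolution_bound m (ltW q0) (dL N) (wL N)) _.
    rewrite (_ : 2 * 32^-1 = 16^-1); last by field.
    by rewrite exprS /M le_eqVlt; apply/orP; left; apply/eqP; field.
  have wL' N i : `|wsum (y N) (w N) i| <= L * 16^-1 ^+ i.
    by apply: le_trans (wL N i) _; rewrite ler_wpM2l // lerXn2r ?nnegrE; lra.
  have mixl m : (fun N => mixed_sum (y N) (w N) m) @ \oo --> (n.+1%:R *: ('X * p))`_m.
    rewrite coefZ coefXM; case: m => [|m] /=; first by rewrite mulr0; exact: cvg_cst.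
    have -> : n.+1%:R * p`_m = \sum_(i < m.+1) (if (i : nat) == 0%N then n.+1%:R else 0) * p`_(m - i).
      by rewrite big_ord_recl big1 ?addr0 ?subn0 // => i _; rewrite mul0r.
    exact: (@convolution_cvg R _ _ _ _ m dl wl).
  have n0 : 0 < n.+1%:R :> R by rewrite ltr0n.
  (* The polynomial is n+1 times X^2 p^2; one X is absorbed by the shift of the coefficients,
     leaving X p^2. *)
  suff : 0 <= moment taylor_coef ('X * (p * (n.+1%:R *: ('X * p)))).
    rewrite -scalerAr -scalerAr momentZ pmulr_rge0 // (momentMX _ (p * _)).
    by rewrite mulrCA expr2.
  apply: (@moment_ge0_limit _ _ (fun N m => qf (v N) (words (A N) (u ^t* *m u) m 2)) _ (2 * L * M)).
  + exact: taylor_coef_bounded.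
  + by move=> N; rewrite qf0.
  + move=> N m; rewrite qf_words2.
    have q16 : 0 <= 16^-1 :> R by rewrite invr_ge0.
    apply: le_trans (convolution_bound m q16 (wL' N) (mixB N)) _.
    by rewrite (_ : 2 * 16^-1 = 8^-1); last by field.
  + move=> m; rewrite coefM.
    have -> : (fun N => qf (v N) (words (A N) (u ^t* *m u) m.+1 2)) =
        fun N => \sum_(i < m.+1) wsum (y N) (w N) i * mixed_sum (y N) (w N) (m - i).
      by apply/funext => N; exact: qf_words2.
    exact: (@convolution_cvg R _ _ _ _ m wl mixl).
  + by move=> N; apply: words_coef_ge0 => //; exact: psd_ones.
Qed.

End HankelOfMonotone.

(** * Resolvents *)

Section ResolventIdentity.
Variable T : pzRingType.
Variables a b ra rb la lb : T.
Hypotheses (raE : ra * (1 - la) = 1) (rbE : (1 - lb) * rb = 1).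

Lemma resolvent_identity_mul : la * b = a * lb -> b * rb - ra * a = ra * (b - a) * rb.
Proof.
move=> lab; have -> : b - a = (1 - la) * b - a * (1 - lb).
  by rewrite mulrBl mul1r mulrBr mulr1 lab opprB addrA subrK.
by rewrite mulrBr (mulrBl _ (ra * _)) !mulrA raE mul1r -(mulrA _ _ rb) rbE mulr1.
Qed.

Lemma resolvent_identity : rb - ra = ra * (lb - la) * rb.
Proof.
have -> : lb - la = (1 - la) - (1 - lb) by rewrite opprB [RHS]addrC addrA subrK.
by rewrite mulrBr (mulrBl _ (ra * _)) raE mul1r -(mulrA ra) rbE mulr1.
Qed.

End ResolventIdentity.

Section Resolvent.
Variables (R : realType) (l : R) (n : nat).
Hypothesis l01 : 0 <= l <= 1.
Implicit Types (A B X : 'M[R[i]]_n) (x : R).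

Definition mobius x : R := x / (1 - l * x).
Definition resolvent A : 'M[R[i]]_n := fun_mx (fun x => (1 - l * x)^-1) A.

Lemma mobius_denom_gt0 x : -1 < x < 1 -> 0 < 1 - l * x.
Proof.
have /andP[l0 l1] := l01; move=> /andP[x0 x1]; rewrite subr_gt0.
have [xle|xge] := leP x 0; first by apply: le_lt_trans ltr01; rewrite mulr_ge0_le0.
by apply: le_lt_trans x1; rewrite ler_piMl // ltW.
Qed.

Let denom_neq0 A j : Msa (-1) 1 A -> 1 - l * spec A j != 0.
Proof. by move=> HA; rewrite gt_eqF // mobius_denom_gt0 // (Msa_spec j HA). Qed.

Let affineE A : A \is hermsymmx -> fun_mx (fun x => 1 - l * x) A = 1 - l%:C *: A.
Proof.
move=> HA; rewrite -[in RHS](fun_mx_id HA) fun_mxZ.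
have -> : (1 : 'M[R[i]]_n) = fun_mx (fun=> 1) A by rewrite fun_mx1.
apply/eqP; rewrite -subr_eq opprK; apply/eqP.
by rewrite fun_mxD; apply: eq_fun_mx => j; rewrite subrK.
Qed.

Lemma resolventVl A : Msa (-1) 1 A -> resolvent A * (1 - l%:C *: A) = 1.
Proof.
move=> HA; rewrite -affineE; last by case: HA.
rewrite [LHS]fun_mxM -[RHS](fun_mx1 A).
by apply: eq_fun_mx => j; rewrite mulVf // denom_neq0.
Qed.

Lemma resolventVr A : Msa (-1) 1 A -> (1 - l%:C *: A) * resolvent A = 1.
Proof.
move=> HA; rewrite -affineE; last by case: HA.
rewrite [LHS]fun_mxM -[RHS](fun_mx1 A).
by apply: eq_fun_mx => j; rewrite divff // denom_neq0.
Qed.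

Lemma fun_mx_mobius_l A : Msa (-1) 1 A -> fun_mx mobius A = A * resolvent A.
Proof. by case=> HA _; rewrite -{2}(fun_mx_id HA) [RHS]fun_mxM. Qed.

Lemma fun_mx_mobius_r A : Msa (-1) 1 A -> fun_mx mobius A = resolvent A * A.
Proof.
case=> HA _; rewrite -{3}(fun_mx_id HA) [RHS]fun_mxM.
by apply: eq_fun_mx => j; rewrite mulrC.
Qed.

Lemma fun_mx_mobiusB A B : Msa (-1) 1 A -> Msa (-1) 1 B ->
  fun_mx mobius B - fun_mx mobius A = resolvent A * (B - A) * resolvent B.
Proof.
move=> HA HB; rewrite (fun_mx_mobius_l HB) (fun_mx_mobius_r HA).
apply: (resolvent_identity_mul (resolventVl HA) (resolventVr HB)).
by rewrite -[LHS]/(_ *m _) -[RHS]/(_ *m _) -scalemxAl -scalemxAr.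
Qed.

Lemma resolventB A B : Msa (-1) 1 A -> Msa (-1) 1 B ->
  resolvent B - resolvent A = l%:C *: (resolvent A * (B - A) * resolvent B).
Proof.
move=> HA HB; rewrite (resolvent_identity (resolventVl HA) (resolventVr HB)).
rewrite -scalerBr -[RHS]/(_ *: (_ *m _)) scalemxAl.
by congr (_ *m _); rewrite -[LHS]/(_ *m _) -scalemxAr.
Qed.

Lemma herm_resolvent A : resolvent A ^t* = resolvent A.
Proof. by apply/herm_trC_eq; exact: herm_fun_mx. Qed.

Lemma qf_resolvent_ge0 A v : Msa (-1) 1 A -> 0 <= qf v (resolvent A).
Proof.
move=> HA; rewrite qf_fun_mx sumr_ge0 // => j _; rewrite mulr_ge0 ?spec_weight_ge0 //.
by rewrite invr_ge0 ltW // mobius_denom_gt0 // (Msa_spec j HA).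
Qed.

Lemma qf_sandwich (v : 'rV[R[i]]_n) (S M : 'M[R[i]]_n) : qf v (S * M * S ^t*) = qf (v *m S) M.
Proof. exact: qf_conj. Qed.

(** The resolvent identity gives R_A D R_B, which is not visibly symmetric. Substituting R_B = R_A +
    l R_B D R_A yields R_A D R_A plus l times the sandwich of R_B by R_A D. *)
Lemma mobius_monotone A B v : Msa (-1) 1 A -> Msa (-1) 1 B -> lemx A B ->
  0 <= qf v (fun_mx mobius B - fun_mx mobius A).
Proof.
move=> HA HB /psdmxP [HD D0]; rewrite fun_mx_mobiusB //; set D := B - A in HD D0 *.
have -> : resolvent B = resolvent A + l%:C *: (resolvent B * D * resolvent A).
  have -> : D = - (A - B) by rewrite opprB.
  by rewrite mulrN mulNr scalerN -resolventB // opprB addrC subrK.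
clearbody D; rewrite mulrDr qfD.
have mulZ (c : R[i]) (M N : 'M[R[i]]_n) : M * (c *: N) = c *: (M * N).
  by rewrite -[LHS]/(_ *m _) -scalemxAr.
rewrite mulZ qfZ addr_ge0 //.
  by rewrite -{2}herm_resolvent qf_sandwich.
have /andP[l0 _] := l01; rewrite mulr_ge0 //.
rewrite (_ : _ * _ = (resolvent A * D) * resolvent B * (resolvent A * D) ^t*).
  by rewrite qf_sandwich qf_resolvent_ge0.
have -> : (resolvent A * D) ^t* = D * resolvent A.
  by have := conjC_mxM (resolvent A) D; rewrite herm_resolvent (herm_trC_eq HD).
have mulA (a d b : 'M[R[i]]_n) : a * d * (b * d * a) = a * d * b * (d * a) by rewrite !mulrA.
exact: mulA.
Qed.

End Resolvent.

Lemma lim_series_shift (R : realType) (u : nat -> R) : u 0%N = 0 ->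
  cvgn (series (fun m => u m.+1)) -> series u @ \oo --> limn (series (fun m => u m.+1)).
Proof.
move=> u0 cu; rewrite -cvg_shiftS.
rewrite (_ : [sequence _]_n = series (fun m => u m.+1)) //.
apply/funext => n; rewrite /series /= big_nat_recl // u0 add0r.
by rewrite big_mkord.
Qed.

Section MobiusExpansion.
Variables (R : realType) (l : R).
Hypothesis l01 : 0 <= l <= 1.

Definition mobius_coef m : R := if m is m'.+1 then l ^+ m' else 0.

Lemma mobius_coef_bounded : geo_bounded mobius_coef 1.
Proof.
have /andP[l0 l1] := l01.
move=> s s0 s1; exists 1 => -[|k] /=; first by rewrite normr0 mul0r.
by rewrite ger0_norm ?exprn_ge0 // mulr_ile1 ?exprn_ge0 ?exprn_ile1 // ltW.
Qed.

Lemma mobius_series x : `|x| < 1 -> mobius l x = limn (pseries mobius_coef x).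
Proof.
have /andP[l0 l1] := l01.
move=> x1; apply/esym/cvg_lim => //.
have lx1 : `|l * x| < 1.
  by rewrite normrM ger0_norm // (le_lt_trans _ x1) // ler_piMl.
have C := @cvg_geometric_series _ x _ lx1.
have E : geometric x (l * x) = fun m => mobius_coef m.+1 * x ^+ m.+1.
  by apply/funext => m; rewrite /= exprMn exprS; ring.
rewrite /mobius -(cvg_lim _ C) // E.
apply: (@lim_series_shift _ (fun m => mobius_coef m * x ^+ m)); first exact: mul0r.
by rewrite -E; apply: cvgP C.
Qed.

Variables (n : nat) (A X : 'M[R[i]]_n).
Hypotheses (HA : Msa (-1) 1 A) (HX : psdmx X).

Let Rs := resolvent l A.
Let chain k := (Rs * X) ^+ k * Rs.
Let hX : X \is hermsymmx. Proof. by have /psdmxP[] := HX. Qed.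

(** Induction in steps of two, stripping [Rs * X] on the left and its adjoint on the right; the
    cores are R and R X R. *)
Lemma resolvent_chain_ge0 k v : 0 <= qf v ((Rs * X) ^+ k * Rs).
Proof.
have hR : Rs ^t* = Rs by exact: herm_resolvent.
have RX : (Rs * X) ^t* = X * Rs by rewrite conjC_mxM hR (herm_trC_eq hX).
elim/ltn_ind: k v => -[|[|k]] IH v.
- by rewrite expr0 mul1r; apply: qf_resolvent_ge0.
- have /psdmxP[_ X0] := HX.
  by rewrite expr1 -[X in qf v (_ * X)]hR qf_sandwich.
have -> : (Rs * X) ^+ k.+2 * Rs = (Rs * X) * ((Rs * X) ^+ k * Rs) * (Rs * X) ^t*.
  by rewrite RX (exprS _ k.+1) (exprSr _ k) !mulrA.
by rewrite qf_sandwich IH.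
Qed.

(** The Neumann series with exact remainder, from iterating the resolvent identity at the right
    end. *)
Let mobius_expand t N : Msa (-1) 1 (A + t%:C *: X) ->
  fun_mx (mobius l) (A + t%:C *: X) - fun_mx (mobius l) A =
  \sum_(k < N) (t ^+ k.+1 * l ^+ k)%:C *: chain k.+1 +
  (t ^+ N.+1 * l ^+ N)%:C *: ((Rs * X) ^+ N.+1 * resolvent l (A + t%:C *: X)).
Proof.
move=> HM; have dE : A + t%:C *: X - A = t%:C *: X by rewrite addrC addKr.
have mulZ (c : R[i]) (M P : 'M[R[i]]_n) : M * (c *: P) = c *: (M * P).
  by rewrite -[LHS]/(_ *m _) -scalemxAr.
have Zmul (c : R[i]) (M P : 'M[R[i]]_n) : (c *: M) * P = c *: (M * P).
  by rewrite -[LHS]/(_ *m _) -scalemxAl.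
elim: N => [|N IH].
  by rewrite big_ord0 add0r mulr1 expr1 fun_mx_mobiusB // dE mulZ Zmul.
rewrite IH big_ord_recr -addrA; congr (_ + _) => /=.
set Rt := resolvent l _.
have E : Rt = Rs + (l * t)%:C *: (Rs * X * Rt).
  have := resolventB l01 HA HM; rewrite dE mulZ Zmul scalerA -rmorphM => <-.
  by rewrite addrC subrK.
rewrite {1}E mulrDr scalerDr; congr (_ + _).
rewrite mulZ scalerA -rmorphM mulrA -exprSr; congr (_%:C *: _).
by rewrite !exprS; ring.
Qed.

(** The word expansion and the Neumann series expand the same function of t, so their coefficients
    agree through the derivatives at 0. *)
Lemma words_coef_mobius v k :
  words_coef mobius_coef A X v k.+1 = l ^+ k * qf v ((Rs * X) ^+ k.+1 * Rs).
Proof.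
have /andP[l0 l1] := l01.
have [r [r0 MA gr qr]] := exists_radius mobius_coef_bounded mobius_series HA hX.
pose d j := if j is j'.+1 then l ^+ j' * qf v (chain j'.+1) else qf v (fun_mx (mobius l) A).
have [x x0 Hx] := row_bounded_ex (Rs * X).
have [K K0 HK] := qf_row_bounded v.
have RXn j M y : 0 <= y -> row_bounded M y -> row_bounded ((Rs * X) ^+ j * M) (x ^+ j * y).
  move=> y0 HM; elim: j => [|j IH]; first by rewrite !mul1r.
  rewrite exprS -(mulrA (Rs * X)) (exprS x) -(mulrA x); apply: (row_boundedM Hx IH).
  by rewrite mulr_ge0 ?exprn_ge0.
have [y y0 Hy] := row_bounded_ex Rs.
(* The second bound makes |t| x < 1, where x bounds the norm of [Rs * X], so the Neumann remainder
   vanishes. *)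
pose e := Num.min r (x + 1)^-1.
have e0 : 0 < e by rewrite lt_min r0 invr_gt0 ltr_wpDl.
have d_bounded : geo_bounded d e.
  move=> s s0 se; exists (`|qf v (fun_mx (mobius l) A)| + K * y).
  have sx : s * x <= 1.
    move: se; rewrite lt_min => /andP[_]; rewrite -[_^-1]div1r ltr_pdivlMr ?ltr_wpDl //.
    by rewrite mulrDr mulr1; lra.
  move=> [|j] /=; first by rewrite expr0 mulr1 lerDl mulr_ge0.
  apply: (@le_trans _ _ (K * y)); last by rewrite lerDr.
  have := HK _ _ (RXn j.+1 _ _ y0 Hy); rewrite -/(chain j.+1) => H.
  rewrite normrM ger0_norm ?exprn_ge0 //.
  apply: (@le_trans _ _ (1 * (K * (x ^+ j.+1 * y)) * s ^+ j.+1)).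
    rewrite ler_wpM2r ?exprn_ge0 ?(ltW s0) //; apply: ler_pM => //.
      by rewrite exprn_ge0.
    by rewrite exprn_ile1.
  rewrite mul1r (_ : _ * _ * _ = K * y * (s * x) ^+ j.+1); last by rewrite exprMn; ring.
  by rewrite ler_piMr ?mulr_ge0 // exprn_ile1 // mulr_ge0 // ltW.
have d_series t : `|t| < e ->
    qf v (fun_mx (mobius l) (A + t%:C *: X)) = limn (pseries d t).
  rewrite lt_min => /andP[tr tx]; have HM := MA t tr.
  have q1 : `|t| * x < 1.
    move: tx; rewrite -[_^-1]div1r ltr_pdivlMr ?ltr_wpDl // mulrDr mulr1.
    by have := normr_ge0 t; lra.
  have q0 : 0 <= `|t| * x by rewrite mulr_ge0.
  have [z z0 Hz] := row_bounded_ex (resolvent l (A + t%:C *: X)).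
  apply/esym/cvg_lim => //; rewrite -cvg_shiftS.
  set H := qf v _.
  suff D : (fun N => H - pseries d t N.+1) @ \oo --> (0 : R).
    rewrite (_ : [sequence _]_n = fun N => H - (H - pseries d t N.+1)); last first.
      by apply/funext => N; rewrite opprB addrC subrK.
    by have := cvgB (cvg_cst H) D; rewrite subr0; exact.
  apply/norm_cvg0P.
  apply: (@squeeze_cvgr _ _ _ _ (cst 0) (geometric (K * z * (`|t| * x)) (`|t| * x))).
  - apply: nearW => N; rewrite normr_ge0 /=.
    have -> : H - pseries d t N.+1 = t ^+ N.+1 * l ^+ N *
        qf v ((Rs * X) ^+ N.+1 * resolvent l (A + t%:C *: X)).
      have := congr1 (qf v) (mobius_expand N HM); rewrite qfB qfD qfZ qf_sum -/H => ME.
      rewrite /pseries /series /= big_nat_recl // expr0 mulr1 big_mkord.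
      rewrite (eq_bigr (fun k : 'I_N => qf v ((t ^+ k.+1 * l ^+ k)%:C *: chain k.+1))); last first.
        by move=> j _; rewrite qfZ /=; ring.
      by rewrite opprD addrA ME addrC addKr.
    rewrite !normrM !normrX (ger0_norm l0).
    have := HK _ _ (RXn N.+1 _ _ z0 Hz) => HKN.
    apply: (@le_trans _ _ (`|t| ^+ N.+1 * 1 * (K * (x ^+ N.+1 * z)))).
      apply: ler_pM => //; first by rewrite mulr_ge0 ?exprn_ge0.
      by rewrite ler_wpM2l ?exprn_ge0 // exprn_ile1.
    rewrite le_eqVlt; apply/orP; left; apply/eqP.
    by rewrite !exprS exprMn; ring.
  - exact: cvg_cst.
  - by apply: cvg_geometric; rewrite ger0_norm.
have E1 := expands_derive r0 k.+1 (conj (gr v) (qr v)).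
have E2 := expands_derive e0 k.+1 (conj d_bounded d_series).
have kf : (k.+1)`!%:R != 0 :> R by rewrite pnatr_eq0 -lt0n fact_gt0.
by apply: (mulfI kf); rewrite -E1 E2.
Qed.

End MobiusExpansion.

(** * From complete monotonicity to operator monotonicity *)

Section Transfer.
Variable R : realType.

Lemma integrable01_expr (mu : {finite_measure set (measurableTypeR R) -> \bar R}) k :
  integrable01 mu (fun x => x ^+ k).
Proof.
by apply: integrable01_continuous; apply: continuous_subspaceT; exact: exprn_continuous.
Qed.

(** By Hausdorff's theorem [b] averages the sequences l^m. Limit and integral are not exchanged:
    each partial sum, uniformly in l, is at least minus a geometric tail, and this is integrated. *)
Lemma completely_monotone_transfer (b w : nat -> R) K q : completely_monotone b ->
  0 <= K -> 0 <= q -> q < 1 -> (forall m, `|w m| <= K * q ^+ m) ->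
  (forall l, 0 <= l <= 1 -> 0 <= limn (series (fun m => l ^+ m * w m))) ->
  0 <= limn (series (fun m => b m * w m)).
Proof.
move=> cb K0 q0 q1 wK wl; have [mu [_ mub]] := hausdorff_moment cb.
have M0 := mass01_ge0 mu.
have bM m : `|b m| <= mass01 mu.
  rewrite -mub ger0_norm; last by apply: int01_ge0 => x /andP[x0 _]; exact: exprn_ge0.
  rewrite -[leRHS]mul1r -int01_cst; apply: le_int01 => [||x /andP[x0 x1]].
  - exact: integrable01_expr.
  - exact: integrable01_cst.
  - exact: exprn_ile1.
have bwK m : `|b m * w m| <= (mass01 mu * K) * q ^+ m.
  by rewrite normrM -mulrA ler_pM.
have MK0 : 0 <= mass01 mu * K by exact: mulr_ge0.
have C := cvg_geometric_dominated MK0 q0 q1 bwK.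
apply: (ler_cvg_to (@cvg_geometric_tail _ (mass01 mu * K) _ q0 q1) C).
apply: nearW => n /=.
have int_m (m : 'I_n) : integrable01 mu (fun x => w m * x ^+ m).
  by apply: integrable01Z; exact: integrable01_expr.
have -> : series (fun m => b m * w m) n = int01 mu (fun x => \sum_(m < n) w m * x ^+ m).
  rewrite int01_sum // /series /= big_mkord; apply: eq_bigr => m _.
  by rewrite int01Z ?mub 1?mulrC //; exact: integrable01_expr.
have -> : - (mass01 mu * K * q ^+ n / (1 - q)) = int01 mu (fun=> - (K * q ^+ n / (1 - q))).
  by rewrite int01_cst; ring.
apply: le_int01 => [||x x01]; [exact: integrable01_cst|exact: integrable01_sum|].
have xw m : `|x ^+ m * w m| <= K * q ^+ m.
  rewrite normrM (le_trans _ (wK m)) // ler_piMl // normrX exprn_ile1 //.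
  by have /andP[? ?] := x01; rewrite ger0_norm.
have := lim_series_tail n K0 q0 q1 xw; rewrite /series /= big_mkord.
under [X in _ <= X -> _]eq_bigr do rewrite mulrC.
by apply: le_trans; rewrite lerBrDr addrC subrr; exact: wl.
Qed.

End Transfer.

Section FromSeries.
Variables (R : realType) (f : R -> R) (a : nat -> R).
Hypothesis a_bounded : geo_bounded a 1.
Hypothesis f_series : forall x, `|x| < 1 -> f x = limn (pseries a x).
Hypothesis a_cm : completely_monotone (fun k => a k.+1).

Lemma lim_series_behead (b z : nat -> R) K q : geo_bounded b 1 ->
  (forall m, `|z m| <= K * q ^+ m) -> 0 <= K -> 0 <= q -> q < 1 -> z 0%N = 0 ->
  limn (series (fun m => b m * z m)) = limn (series (fun m => b m.+1 * z m.+1)).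
Proof.
move=> gb zK K0 q0 q1 z0; apply/cvg_lim => //.
apply: (@lim_series_shift _ (fun m => b m * z m)); first by rewrite z0 mulr0.
have q1' : `|q| < 1 by rewrite ger0_norm.
have [L [p [L0 p0 p1 Hp]]] := geo_bounded_split gb q1'.
apply: (@cvg_geometric_dominated _ _ (K * L * p) p) => // [|m].
  by rewrite !mulr_ge0.
rewrite normrM -mulrA -exprS; apply: (@le_trans _ _ (`|b m.+1| * (K * q ^+ m.+1))).
  by rewrite ler_wpM2l.
rewrite mulrCA -mulrA ler_wpM2l //; apply: le_trans (Hp m.+1).
by rewrite normrM (ger0_norm (exprn_ge0 _ q0)).
Qed.

Lemma oam_of_completely_monotone : (forall x, x \in `]-1, 1[ -> 0 <= f x) ->
  operator_absolutely_monotone (-1) 1 f.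
Proof.
move=> f0; split.
  move=> k x; rewrite in_itv /= -ltr_norml => x1.
  by have [] := derive1n_pseries a_bounded f_series k x1.
move=> n A X HA HX k; have hX : X \is hermsymmx by have /psdmxP[] := HX.
apply/(psd_derive1n_fun_mx a_bounded f_series k HA hX) => v.
case: k => [|k].
  (* Complete monotonicity says nothing about [a 0], so order zero uses non-negativity of f on the
     spectrum. *)
  have -> : words_coef a A X v 0 = qf v (fun_mx f A).
    rewrite (qf_fun_mx_series a_bounded f_series v HA).
    by congr (limn (series _)); apply/funext => m; rewrite words0.
  rewrite qf_fun_mx sumr_ge0 // => l _; rewrite mulr_ge0 ?spec_weight_ge0 // f0 //.
  by rewrite in_itv /=; exact: Msa_spec.
have [K [q [K0 q0 q1 HK]]] := qf_words_bound X HA v k.+1.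
have z0 : qf v (words A X 0 k.+1) = 0 by rewrite qf0.
rewrite /words_coef (lim_series_behead a_bounded HK) //.
apply: (completely_monotone_transfer (K := K * q) (q := q)) => //.
- exact: mulr_ge0.
- by move=> m; rewrite -mulrA -exprS.
move=> l l01; have := words_coef_mobius l01 HA HX v k.
rewrite /words_coef (lim_series_behead (mobius_coef_bounded l01) HK) //= => ->.
have /andP[l0 _] := l01.
by rewrite mulr_ge0 ?exprn_ge0 //; exact: resolvent_chain_ge0.
Qed.

Lemma operator_monotone_of_completely_monotone : operator_monotone (-1) 1 f.
Proof.
move=> n A B HA HB HAB; apply/psdmxP; split.
  by apply: hermD; [|apply: hermN]; exact: herm_fun_mx.
move=> v; rewrite qfB.
(* Words without the second letter are the powers, so k = 0 gives a geometric bound for [A ^+ m]. *)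
have [K [q [K0 q0 q1 HK]]] := qf_words_bound A HA v 0.
have [L [p [L0 p0 p1 HL]]] := qf_words_bound B HB v 0.
pose z m := qf v (B ^+ m) - qf v (A ^+ m).
pose r := Num.max p q.
have r0 : 0 <= r by rewrite le_max p0.
have r1 : r < 1 by rewrite gt_max p1.
have zK m : `|z m| <= (L + K) * r ^+ m.
  rewrite mulrDl (le_trans (ler_normB _ _)) //; apply: lerD.
    have := HL m; rewrite words0 => /le_trans -> //.
    by rewrite ler_wpM2l // lerXn2r ?nnegrE // /r le_max lexx.
  have := HK m; rewrite words0 => /le_trans -> //.
  by rewrite ler_wpM2l // lerXn2r ?nnegrE // /r le_max lexx orbT.
have z0 : z 0%N = 0 by rewrite /z !expr0 subrr.
have LK0 : 0 <= L + K by exact: addr_ge0.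
(* The difference kills the constant coefficient and depends linearly on the shifted ones; the
   formula is needed both for f and for the extreme functions. *)
have diffE g c : geo_bounded c 1 -> (forall x, `|x| < 1 -> g x = limn (pseries c x)) ->
    qf v (fun_mx g B) - qf v (fun_mx g A) = limn (series (fun m => c m.+1 * z m.+1)).
  move=> gc cE; rewrite -(lim_series_behead gc zK) //.
  have cvgM C (y : R) M : 0 <= y -> y < 1 -> 0 <= C ->
      (forall m, `|qf v (words M M m 0)| <= C * y ^+ m) ->
      cvgn (series (fun m => c m * qf v ((M : 'M[R[i]]_n) ^+ m))).
    move=> y0 y1 C0 Hy; have y1' : `|y| < 1 by rewrite ger0_norm.
    have [D [d [D0 d0 d1 Hd]]] := geo_bounded_split gc y1'.
    apply: (@cvg_geometric_dominated _ _ (C * D) d) => // [|m]; first exact: mulr_ge0.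
    rewrite normrM; have := Hy m; rewrite words0 => Hm.
    apply: (@le_trans _ _ (`|c m| * (C * y ^+ m))); first by rewrite ler_wpM2l.
    rewrite mulrCA -mulrA ler_wpM2l //; apply: le_trans (Hd m).
    by rewrite normrM (ger0_norm (exprn_ge0 _ y0)).
  rewrite !(qf_fun_mx_series gc cE) //.
  rewrite -lim_seriesB; [|exact: cvgM p0 p1 L0 HL|exact: cvgM q0 q1 K0 HK].
  by congr (limn (series _)); apply/funext => m; rewrite [RHS]mulrBr.
rewrite (diffE f a) //.
apply: (completely_monotone_transfer (K := (L + K) * r) (q := r)) => //.
- exact: mulr_ge0.
- by move=> m; rewrite -mulrA -exprS.
move=> l l01.
have := diffE _ _ (mobius_coef_bounded l01) (mobius_series l01) => /= <-.
by rewrite -qfB; exact: mobius_monotone.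
Qed.

End FromSeries.

(** * Integral representations *)

Section Kernels.
Variable R : realType.
Implicit Types (mu : {finite_measure set (measurableTypeR R) -> \bar R}) (c : R -> R).

Lemma kernel_denom_gt0 (l x : R) : -1 <= l <= 1 -> `|x| < 1 -> 0 < 1 - l * x.
Proof.
move=> l1 x1; rewrite subr_gt0 (le_lt_trans (ler_norm _)) // normrM.
by rewrite (le_lt_trans _ x1) // ler_piMl // ler_norml.
Qed.

Lemma kernel_continuous (a b : R) c x : -1 <= a -> b <= 1 -> `|x| < 1 ->
  (forall l, l \in `[a, b] -> {for l, continuous c}) ->
  {within `[a, b], continuous (fun l => c l / (1 - l * x))}.
Proof.
move=> a1 b1 x1 cc; apply: continuous_in_subspaceT => l; rewrite mem_setE => lab.
apply: cvgM; first exact: cc.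
apply: cvgV; last first.
  by apply: cvgB; [exact: cvg_cst|apply: cvgMl; exact: cvg_id].
rewrite gt_eqF // kernel_denom_gt0 //.
by move: lab; rewrite in_itv /= => /andP[? ?]; lra.
Qed.

Section Weighted.
Variables (mu : {finite_measure set (measurableTypeR R) -> \bar R}) (c : R -> R) (C : R).
Hypothesis c_cont : forall l, l \in `[0, 1] -> {for l, continuous c}.
Hypothesis c_bound : forall l, 0 <= l <= 1 -> 0 <= c l <= C.

(** Moments of c dmu, kept as weighted integrals so that no measure with a density has to be built.
    The weights used are 1, 1+l and 1/(1+l). *)
Definition weighted_moment k := int01 mu (fun l => c l * l ^+ k).

Lemma integrable01_kernel x : `|x| < 1 -> integrable01 mu (fun l => c l / (1 - l * x)).
Proof. by move=> x1; apply: integrable_continuous_itv; apply: kernel_continuous => //; lra. Qed.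

Lemma integrable01_weighted_expr k : integrable01 mu (fun l => c l * l ^+ k).
Proof.
apply: integrable_continuous_itv; apply: continuous_in_subspaceT => l; rewrite mem_setE => l01.
by apply: cvgM; [exact: c_cont|exact: exprn_continuous].
Qed.

Let C0 : 0 <= C.
Proof. by have /andP[h1 h2] := @c_bound 0 ltac:(lra); exact: le_trans h2. Qed.

(** The geometric series in l x has the exact remainder c (l x)^N / (1 - l x), bounded uniformly in
    l by C |x|^N / (1 - |x|). *)
Lemma weighted_moment_series x : `|x| < 1 ->
  int01 mu (fun l => c l / (1 - l * x)) = limn (pseries weighted_moment x).
Proof.
move=> x1; apply/esym/cvg_lim => //.
have x10 : 0 < 1 - `|x| by rewrite subr_gt0.
have M0 := mass01_ge0 mu.
set I := int01 _ _.
suff D : (fun N => I - pseries weighted_moment x N) @ \oo --> (0 : R).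
  rewrite (_ : pseries _ _ = fun N => I - (I - pseries weighted_moment x N)); last first.
    by apply/funext => N; rewrite opprB addrC subrK.
  by have := cvgB (cvg_cst I) D; rewrite subr0; exact.
apply/norm_cvg0P.
apply: (@squeeze_cvgr _ _ _ _ (cst 0) (geometric (C / (1 - `|x|) * mass01 mu) `|x|)).
- apply: nearW => N; rewrite normr_ge0 /=.
  have iM (m : 'I_N) : integrable01 mu (fun l => x ^+ m * (c l * l ^+ m)).
    exact: integrable01Z (integrable01_weighted_expr m).
  have -> : pseries weighted_moment x N =
      int01 mu (fun l => \sum_(m < N) x ^+ m * (c l * l ^+ m)).
    rewrite int01_sum // /pseries /series /= big_mkord; apply: eq_bigr => m _.
    by rewrite int01Z 1?mulrC //; exact: integrable01_weighted_expr.
  rewrite mulrAC; apply: int01_dist_le.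
  + exact: integrable01_kernel.
  + exact: integrable01_sum.
  move=> l /[dup] l01 /c_bound /andP[c0 cC]; have /andP[l0 l1] := l01.
  have d0 : 0 < 1 - l * x by apply: kernel_denom_gt0 => //; lra.
  have dx : 1 - `|x| <= 1 - l * x.
    rewrite lerD2l lerN2 (le_trans (ler_norm _)) // normrM (ger0_norm l0).
    by rewrite ler_piMl.
  have -> : c l / (1 - l * x) - \sum_(m < N) x ^+ m * (c l * l ^+ m) =
      c l * (l * x) ^+ N / (1 - l * x).
    have -> : \sum_(m < N) x ^+ m * (c l * l ^+ m) = c l * \sum_(m < N) (l * x) ^+ m.
      by rewrite mulr_sumr; apply: eq_bigr => m _; rewrite exprMn; ring.
    have E := subrX1 (l * x) N; set S := \sum_(m < N) (l * x) ^+ m in E *.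
    apply: (mulIf (lt0r_neq0 d0)); rewrite mulrBl !divfK ?gt_eqF //.
    have -> : c l * S * (1 - l * x) = - (c l * ((l * x - 1) * S)) by ring.
    by rewrite -E; ring.
  rewrite !normrM normfV (ger0_norm c0) (gtr0_norm d0) mulrAC.
  apply: ler_pM => //.
  + by rewrite mulr_ge0 // invr_ge0 ltW.
  + by apply: ler_pM => //; [rewrite invr_ge0 ltW|rewrite lef_pV2 ?posrE].
  rewrite normrX lerXn2r ?nnegrE // normrM (ger0_norm l0).
  by rewrite ler_piMl.
- exact: cvg_cst.
- by apply: cvg_geometric; rewrite normr_id.
Qed.

Lemma moment_weighted p : moment weighted_moment p = int01 mu (fun l => c l * p.[l]).
Proof.
transitivity (int01 mu (fun l => \sum_(i < size p) p`_i * (c l * l ^+ i))).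
  rewrite int01_sum => [|i]; last exact: integrable01Z (integrable01_weighted_expr i).
  by apply: eq_bigr => i _; rewrite int01Z //; exact: integrable01_weighted_expr.
apply: int01_ext => l _.
by rewrite horner_coef mulr_sumr; apply: eq_bigr => i _; rewrite mulrCA.
Qed.

Lemma weighted_moment_cm : completely_monotone weighted_moment.
Proof.
move=> j m.
rewrite moment_weighted; apply: int01_ge0 => l l01; have /andP[c0 _] := c_bound l01.
have /andP[l0 l1] := l01.
by rewrite mulr_ge0 // !hornerE mulr_ge0 ?exprn_ge0 // subr_ge0.
Qed.

Lemma weighted_moment_le k : `|weighted_moment k| <= C * mass01 mu.
Proof.
rewrite ger0_norm; last first.
  apply: int01_ge0 => l l01; have /andP[c0 _] := c_bound l01.
  by have /andP[l0 _] := l01; rewrite mulr_ge0 // exprn_ge0.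
rewrite -int01_cst; apply: le_int01.
- exact: integrable01_weighted_expr.
- exact: integrable01_cst.
move=> l l01; have /andP[c0 cC] := c_bound l01; have /andP[l0 l1] := l01.
rewrite -[C]mulr1; apply: ler_pM => //; first exact: exprn_ge0.
exact: exprn_ile1.
Qed.

End Weighted.

Lemma pseries_behead (a : nat -> R) x : geo_bounded a 1 -> `|x| < 1 ->
  limn (pseries a x) = a 0%N + x * limn (pseries (fun k => a k.+1) x).
Proof.
move=> ga x1; have gb : geo_bounded (fun k => a k.+1) 1.
  rewrite (_ : (fun k => _) = fun k => a (k + 1)%N); first exact: geo_bounded_shift.
  by apply/funext => k; rewrite addn1.
apply/cvg_lim => //; rewrite -cvg_shiftS.
rewrite (_ : [sequence _]_n = fun n => a 0%N + x * pseries (fun k => a k.+1) x n); last first.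
  apply/funext => n; rewrite /pseries /series /= big_nat_recl // expr0 mulr1; congr (_ + _).
  by rewrite mulr_sumr; apply: eq_bigr => i _; rewrite exprS; ring.
by apply: cvgD; [exact: cvg_cst|apply: cvgMr; exact: geo_cvg gb x1].
Qed.

Lemma bounded_geo_bounded (a : nat -> R) K : (forall k, `|a k| <= K) -> geo_bounded a 1.
Proof.
move=> aK s s0 s1; exists K => k; apply: le_trans (aK k).
by rewrite ler_piMr // exprn_ile1 // ltW.
Qed.

End Kernels.

Section Representations.
Variables (R : realType) (f : R -> R).
Implicit Types mu : {finite_measure set (measurableTypeR R) -> \bar R}.

Lemma itv11E (x : R) : (x \in `]-1, 1[) = (`|x| < 1).
Proof. by rewrite in_itv /= -ltr_norml. Qed.

Section Kernel.
Variables (mu : {finite_measure set (measurableTypeR R) -> \bar R}) (c : R -> R) (C a0 : R).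
Hypothesis c_cont : forall l, l \in `[0, 1] -> {for l, continuous c}.
Hypothesis c_bound : forall l, 0 <= l <= 1 -> 0 <= c l <= C.
Hypothesis f_kernel : forall x, `|x| < 1 -> f x = a0 + x * int01 mu (fun l => c l / (1 - l * x)).

Let a k := if k is k'.+1 then weighted_moment mu c k' else a0.

Let a_bounded : geo_bounded a 1.
Proof.
apply: (@bounded_geo_bounded _ _ (`|a0| + C * mass01 mu)) => -[|k] /=.
  by rewrite lerDl (le_trans _ (weighted_moment_le mu c_cont c_bound 0)).
by rewrite (le_trans (weighted_moment_le mu c_cont c_bound k)) // lerDr.
Qed.

Let f_series x : `|x| < 1 -> f x = limn (pseries a x).
Proof.
by move=> x1; rewrite pseries_behead // f_kernel // (weighted_moment_series mu c_cont c_bound).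
Qed.

Lemma oam_of_kernel : (forall x, x \in `]-1, 1[ -> 0 <= f x) ->
  operator_absolutely_monotone (-1) 1 f.
Proof.
apply: (oam_of_completely_monotone a_bounded f_series).
exact: (weighted_moment_cm mu c_cont c_bound).
Qed.

Lemma weighted_moment_taylor k : weighted_moment mu c k = taylor_coef f k.+1.
Proof.
have kf : (k.+1)`!%:R != 0 :> R by rewrite pnatr_eq0 -lt0n fact_gt0.
by rewrite /taylor_coef (derive1n_pseries0 k.+1 ltr01 a_bounded f_series) mulrC mulKf.
Qed.

End Kernel.

Lemma cst_continuous01 (k : R) (l : R) : l \in `[0, 1] -> {for l, continuous (fun=> k)}.
Proof. by move=> _; exact: cvg_cst. Qed.

Lemma one_bound (l : R) : 0 <= l <= 1 -> 0 <= (1 : R) <= 1.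
Proof. by rewrite ler01 lexx. Qed.

Lemma integral_supported01 mu (g : R -> R) : supported_in mu `[0, 1] ->
  {within `[-1, 1], continuous g} ->
  (\int[mu]_(l in `[(-1)%R, 1%R]) (g l)%:E)%E = (int01 mu g)%:E.
Proof.
move=> mu01 cg; have ig := integrable_continuous_itv mu cg.
have mN : measurable (`[-1, 0[%classic : set (measurableTypeR R)) by exact: measurable_itv.
have m11 : measurable (`[-1, 1]%classic : set (measurableTypeR R)) by exact: measurable_itv.
have m01 : measurable (~` `[0, 1]%classic : set (measurableTypeR R)).
  by apply: measurableC; exact: measurable_itv.
have N0 : mu `[(-1)%R, 0%R[%classic = 0%E.
  apply: (subset_measure0 mN m01) => // l /=; rewrite !in_itv /= => /andP[_ l0].
  by rewrite leNgt l0.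
rewrite (negligible_integral mN m11 ig N0) -int01_expand; last first.
  apply: integrable_continuous_itv; apply: continuous_subspaceW cg => l /=.
  by rewrite !in_itv /= => /andP[l0 l1]; rewrite l1 andbT; lra.
congr (integral _ _ _); apply/seteqP; split=> l /=; rewrite I01E /setD /= !in_itv /=.
  by move=> [/andP[l1 ->] /negP]; rewrite negb_and l1 -leNgt andbT.
by move=> /andP[l0 l1]; split; [apply/andP; split; lra|apply/negP; rewrite negb_and -leNgt l0 orbT].
Qed.

Lemma oam_of_representing mu : (forall x, x \in `]-1, 1[ -> 0 <= f x) ->
  representing_measure f mu -> supported_in mu `[0, 1] ->
  operator_absolutely_monotone (-1) 1 f.
Proof.
move=> f0 [_ fE] mu01.
apply: (@oam_of_kernel mu (fun=> 1) 1 (f 0)) => //.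
- exact: cst_continuous01.
- exact: one_bound.
move=> x x1.
have := fE 0 x; rewrite !itv11E normr0 ltr01 x1 => /(_ isT isT).
have -> : (fun l : R => ((x - 0) / ((1 - l * x) * (1 - l * 0)))%:E) = fun l => (x / (1 - l * x))%:E.
  by apply/funext => l; rewrite subr0 mulr0 subr0 mulr1.
rewrite integral_supported01 //; last first.
  by apply: kernel_continuous => // l _; exact: cvg_cst.
rewrite -EFinD => -[->]; congr (_ + _).
rewrite -int01Z; last by apply: integrable01_kernel => //; exact: cst_continuous01.
by apply: int01_ext => l _; rewrite mulrA mulr1.
Qed.

Section IntegralExpression.
Variables (beta : R) (mu : {finite_measure set (measurableTypeR R) -> \bar R}).
Hypothesis f_expr : integral_expression f beta mu.

Let integrable_kernel x : `|x| < 1 -> integrable01 mu (fun l => (1 + x) / (1 - l * x)).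
Proof. by move=> x1; apply: integrable01_kernel => //; exact: cst_continuous01. Qed.

Let fE x : `|x| < 1 -> f x = beta + int01 mu (fun l => (1 + x) / (1 - l * x)).
Proof.
have [_ _ H] := f_expr; move=> x1; have := H x; rewrite itv11E x1 => /(_ isT).
by rewrite -/(@I01 R) int01_expand ?integrable_kernel // -EFinD => -[].
Qed.

Lemma succ_continuous (l : R) : l \in `[0, 1] -> {for l, continuous (fun l : R => 1 + l)}.
Proof. by move=> _; apply: cvgD; [exact: cvg_cst|exact: cvg_id]. Qed.

Lemma succ_bound (l : R) : 0 <= l <= 1 -> 0 <= 1 + l <= 2.
Proof. by lra. Qed.

(** Pointwise, (1+x)/(1-lx) = 1 + x(1+l)/(1-lx). *)
Lemma integral_expression_kernel x : `|x| < 1 ->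
  f x = (beta + mass01 mu) + x * int01 mu (fun l => (1 + l) / (1 - l * x)).
Proof.
move=> x1; have ik : integrable01 mu (fun l => (1 + l) / (1 - l * x)).
  by apply: integrable01_kernel => //; exact: succ_continuous.
rewrite fE // -addrA; congr (_ + _); rewrite -int01Z //.
rewrite -[mass01 mu]mul1r -int01_cst -int01D.
- apply: int01_ext => l l01.
  have d0 : 1 - l * x != 0 by rewrite gt_eqF // kernel_denom_gt0 //; lra.
  by field.
- exact: integrable01_cst.
- exact: integrable01Z.
Qed.

Lemma oam_of_integral_expression : operator_absolutely_monotone (-1) 1 f.
Proof.
apply: (oam_of_kernel succ_continuous succ_bound integral_expression_kernel) => x.
have [beta0 _ _] := f_expr.
rewrite itv11E => x1; rewrite fE // addr_ge0 //; apply: int01_ge0 => l l01.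
have d0 : 0 < 1 - l * x by apply: kernel_denom_gt0 => //; lra.
by rewrite divr_ge0 ?(ltW d0) //; move: x1; rewrite ltr_norml; lra.
Qed.

Lemma integral_expression_moments k :
  int01 mu (fun l => l ^+ k) + int01 mu (fun l => l ^+ k.+1) = taylor_coef f k.+1.
Proof.
rewrite -(weighted_moment_taylor succ_continuous succ_bound integral_expression_kernel).
rewrite -int01D; [|exact: integrable01_expr..].
by apply: int01_ext => l _; rewrite exprS; ring.
Qed.

End IntegralExpression.

Hypothesis oamf : operator_absolutely_monotone (-1) 1 f.

Lemma oam_completely_monotone : completely_monotone (fun k => taylor_coef f k.+1).
Proof. exact: completely_monotone_hankel (oam_hankel_pos oamf). Qed.

Lemma oam_ge0 x : x \in `]-1, 1[ -> 0 <= f x.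
Proof. exact: (oam_derive1n_ge0 oamf 0). Qed.

Lemma oam_operator_monotone : operator_monotone (-1) 1 f.
Proof.
apply: (operator_monotone_of_completely_monotone (taylor_coef_bounded oamf) (taylor_series oamf)).
exact: oam_completely_monotone.
Qed.

Lemma oam_kernel : exists mu, supported_in mu `[0, 1] /\
  forall x, `|x| < 1 -> f x = f 0 + x * int01 mu (fun l => 1 / (1 - l * x)).
Proof.
have [mu [mu01 muE]] := hausdorff_moment oam_completely_monotone.
exists mu; split => // x x1; rewrite (taylor_series oamf x1).
rewrite (pseries_behead (taylor_coef_bounded oamf) x1).
rewrite (weighted_moment_series mu (@cst_continuous01 1) one_bound x1).
have -> : weighted_moment mu (fun=> 1) = fun k => taylor_coef f k.+1.
  by apply/funext => k; rewrite -muE; apply: int01_ext => l _; exact: mul1r.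
by rewrite [X in X + _ = _]/taylor_coef fact0 divr1.
Qed.

(** Subtracting the formula at alpha from the one at x suffices, since x/(1-lx) - alpha/(1-l alpha)
    is the representing kernel. *)
Lemma oam_representing : exists mu, representing_measure f mu /\ supported_in mu `[0, 1].
Proof.
have [mu [mu01 muE]] := oam_kernel; exists mu; split => //; split.
  have m01 : measurable (~` `[0, 1]%classic : set (measurableTypeR R)).
    by apply: measurableC; exact: measurable_itv.
  have m11 : measurable (~` `[-1, 1]%classic : set (measurableTypeR R)).
    by apply: measurableC; exact: measurable_itv.
  apply: (subset_measure0 m11 m01) => // l /= nl l01; apply: nl.
  by move: l01; rewrite !in_itv /= => /andP[? ?]; apply/andP; split; lra.
move=> alpha x; rewrite !itv11E => alpha1 x1.
have -> : (fun l : R => ((x - alpha) / ((1 - l * x) * (1 - l * alpha)))%:E) =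
    fun l => ((x - alpha) / (1 - l * alpha) / (1 - l * x))%:E.
  by apply/funext => l; rewrite invfM mulrA mulrAC.
rewrite integral_supported01 //; last first.
  apply: kernel_continuous => // l lI.
  apply: cvgM; first exact: cvg_cst.
  apply: cvgV; last by apply: cvgB; [exact: cvg_cst|apply: cvgMl; exact: cvg_id].
  by rewrite gt_eqF // kernel_denom_gt0 //; move: lI; rewrite in_itv.
have ik y (k : R) : `|y| < 1 -> integrable01 mu (fun l => k / (1 - l * y)).
  by move=> y1; apply: integrable01_kernel => //; exact: cst_continuous01.
rewrite -EFinD muE // [in RHS]muE //; congr (_%:E); rewrite -addrA; congr (_ + _).
rewrite -!int01Z; [|exact: ik..]; apply/eqP; rewrite addrC -subr_eq; apply/eqP.
rewrite -int01B; [|exact: integrable01Z (ik _ _ _)..].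
apply: int01_ext => l l01.
have d0 y : `|y| < 1 -> 1 - l * y != 0.
  by move=> y1; rewrite gt_eqF // kernel_denom_gt0 //; lra.
have dx := d0 _ x1; have da := d0 _ alpha1.
by field; rewrite dx da.
Qed.

Lemma oam_integral_expression : exists beta mu, integral_expression f beta mu.
Proof.
have [mu [mu01 muE]] := oam_kernel.
(* The kernel identity requires (1+l) dnu = dmu; nu is recovered by Hausdorff's theorem from the
   moments of c dmu. *)
pose c (l : R) := (1 + l)^-1.
have cc l : l \in `[0, 1] -> {for l, continuous c}.
  rewrite in_itv /= => /andP[l0 _]; apply: cvgV; first by rewrite gt_eqF // ltr_wpDr.
  by apply: cvgD; [exact: cvg_cst|exact: cvg_id].
have cC l : 0 <= l <= 1 -> 0 <= c l <= 1.
  by move=> /andP[l0 l1]; rewrite invr_ge0 addr_ge0 //= invf_le1 ?lerDl // ltr_wpDr.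
have [nu [nu01 nuE]] := hausdorff_moment (weighted_moment_cm mu cc cC).
have ik m x (k : R) : `|x| < 1 -> integrable01 m (fun l => k / (1 - l * x)).
  by move=> x1; apply: integrable01_kernel => //; exact: cst_continuous01.
have nu_mu x : `|x| < 1 ->
    int01 nu (fun l => 1 / (1 - l * x)) = int01 mu (fun l => c l / (1 - l * x)).
  move=> x1; rewrite (weighted_moment_series mu cc cC x1).
  rewrite (weighted_moment_series nu (@cst_continuous01 1) one_bound x1).
  suff -> : weighted_moment nu (fun=> 1) = weighted_moment mu c by [].
  by apply/funext => k; rewrite -nuE; apply: int01_ext => l _; exact: mul1r.
(* Forced by evaluating the integral expression at x = 0. *)
pose beta := f 0 - mass01 nu.
have fE x : `|x| < 1 -> f x = beta + (1 + x) * int01 nu (fun l => 1 / (1 - l * x)).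
  move=> x1; rewrite muE // /beta -addrA; congr (_ + _).
  have -> : mass01 nu = int01 nu (fun l => 1 / (1 - l * 0)).
    by rewrite -[LHS]mul1r -int01_cst; apply: int01_ext => l _; rewrite mulr0 subr0 divr1.
  have z1 : `|0 : R| < 1 by rewrite normr0.
  rewrite !nu_mu //; apply/eqP; rewrite addrC -subr_eq opprK; apply/eqP.
  rewrite -!int01Z; [|exact: integrable01_kernel|exact: ik].
  rewrite -int01D; [|exact: integrable01Z (ik _ _ _ _)|exact: integrable01_kernel].
  apply: int01_ext => l l01.
  have d0 : 1 - l * x != 0 by rewrite gt_eqF // kernel_denom_gt0 //; lra.
  have d1 : 1 + l != 0 by rewrite gt_eqF //; lra.
  by rewrite /c; field; rewrite ?d0 ?d1.
exists beta, nu; split => //.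
  apply/ler_addgt0Pr => e e0.
  have M0 := mass01_ge0 nu.
  (* f is tested at x = d - 1 close to -1. There the kernel 1/(1-lx) is at most 1, so the integral
     part is at most d times the mass, hence at most e. *)
  pose d := Num.min 1 (e / (mass01 nu + 1)).
  have M1 : 0 < mass01 nu + 1 by rewrite ltr_wpDl.
  have d0 : 0 < d by rewrite lt_min ltr01 divr_gt0.
  have d1 : d <= 1 by rewrite ge_min lexx.
  have de : d * mass01 nu <= e.
    apply: (@le_trans _ _ (d * (mass01 nu + 1))); first by rewrite ler_wpM2l ?lerDl // ltW.
    by rewrite -ler_pdivlMr // ge_min lexx orbT.
  have x1 : `|d - 1| < 1 by rewrite ltr_norml; lra.
  have := oam_ge0 (x := d - 1); rewrite itv11E x1 => /(_ isT); rewrite fE //.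
  move=> /le_trans; apply; rewrite lerD2l addrC subrK (le_trans _ de) //.
  rewrite ler_wpM2l ?(ltW d0) // -[leRHS]mul1r -int01_cst; apply: le_int01.
  - exact: ik.
  - exact: integrable01_cst.
  move=> l /andP[l0 l1]; rewrite div1r invf_le1; nra.
move=> x; rewrite itv11E => x1.
rewrite -/(@I01 R) int01_expand ?ik // -EFinD fE //; congr (_ + _)%:E.
rewrite -int01Z; last exact: ik.
by apply: int01_ext => l _; rewrite mulrA mulr1.
Qed.

End Representations.

(** * Uniqueness of the measure *)

Section Uniqueness.
Variable R : realType.
Implicit Types mu : {finite_measure set (measurableTypeR R) -> \bar R}.

Lemma alternating_cvg_eq0 (d : nat -> R) : cvgn d -> (forall k, d k.+1 = - d k) ->
  forall k, d k = 0.
Proof.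
move=> cd dS.
have dl : d @ \oo --> limn d by exact: cd.
have l0 : limn d = 0.
  have dSl : (fun k => d k.+1) @ \oo --> limn d by rewrite (cvg_shiftS d).
  have dN : (fun k => d k.+1) @ \oo --> - limn d.
    by rewrite (_ : (fun k => _) = fun k => - d k); [exact: cvgN|apply/funext].
  have E : limn d = - limn d by exact: (@cvg_unique _ (@Rhausdorff R) _ _ _ _ dSl dN).
  by move: E; set l := limn d; lra.
move=> k; apply/eqP; rewrite -normr_eq0.
have dk n : `|d n| = `|d 0%N| by elim: n => // n <-; rewrite dS normrN.
have N0 : (fun n => `|d n|) @ \oo --> (0 : R).
  by rewrite l0 in dl; have := cvg_norm dl; rewrite normr0; exact.
have Nc : (fun n => `|d n|) @ \oo --> `|d 0%N|.
  by rewrite (_ : (fun n => _) = fun=> `|d 0%N|); [exact: cvg_cst|apply/funext].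
by rewrite dk; apply/eqP; exact: (@cvg_unique _ (@Rhausdorff R) _ _ _ _ Nc N0).
Qed.

Lemma moments_cvg mu : cvgn (fun k => int01 mu (fun l => l ^+ k)).
Proof.
apply: nonincreasing_is_cvgn.
  apply/nonincreasing_seqP => k; apply: le_int01; [exact: integrable01_expr..|].
  by move=> l /andP[l0 l1]; rewrite exprS ler_piMl // exprn_ge0.
exists 0 => _ [k _ <-]; apply: int01_ge0 => l /andP[l0 _]; exact: exprn_ge0.
Qed.

Lemma bernoulli_ge (y : R) N : 0 <= y <= 1 -> 1 - N%:R * y <= (1 - y) ^+ N.
Proof.
move=> /andP[y0 y1]; elim: N => [|N IH]; first by rewrite mul0r subr0 expr0.
rewrite exprS; apply: (@le_trans _ _ ((1 - y) * (1 - N%:R * y))); last first.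
  by rewrite ler_wpM2l // subr_ge0.
have N0 : 0 <= N%:R :> R by []. 
rewrite -natr1; nra.
Qed.

Lemma bernoulli_le (y : R) N : 0 <= y <= 1 -> (1 - y) ^+ N * (1 + N%:R * y) <= 1.
Proof.
move=> /andP[y0 y1]; elim: N => [|N IH]; first by rewrite mul0r addr0 expr0 mulr1.
apply: le_trans IH; rewrite exprSr -mulrA ler_wpM2l ?exprn_ge0 ?subr_ge0 //.
have N0 : 0 <= N%:R :> R by [].
rewrite -natr1; nra.
Qed.

(** Up to the factor q these are the terms of the differentiated geometric series, which
    converges. *)
Lemma cvg_succ_geo (q : R) : 0 <= q < 1 -> (fun n => n.+1%:R * q ^+ n.+1) @ \oo --> (0 : R).
Proof.
move=> /andP[q0 q1].
have g : geo_bounded (pseries_diffs (fun=> 1 : R)) 1.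
  by apply: geo_bounded_diffs; apply: (@bounded_geo_bounded _ _ 1) => k; rewrite normr1.
have := cvg_series_cvg_0 (geo_cvg g (_ : `|q| < 1)).
rewrite ger0_norm // => /(_ q1) H.
rewrite (_ : (fun n => _) = fun n => q * (pseries_diffs (fun=> 1 : R) n * q ^+ n)); last first.
  by apply/funext => n; rewrite /pseries_diffs exprS; ring.
by rewrite -[X in _ --> X](mulr0 q); apply: cvgMr; exact: H.
Qed.

(* For 0 < x < 1 the polynomials (1 - t^m)^(N m) do the job as soon as N m * x^m
   is about 1/m: then N m * t^m tends to 0 for t <= x and to infinity for t > x. *)
Lemma threshold_polys (x : R) : 0 <= x < 1 -> exists p : nat -> {poly R},
  (forall n (t : R), 0 <= t <= 1 -> 0 <= (p n).[t] <= 1) /\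
  forall t : R, 0 <= t <= 1 -> (fun n => (p n).[t]) @ \oo --> ((t <= x)%R%:R : R).
Proof.
move=> /andP[]; rewrite le_eqVlt => /predU1P[<- _|x0 x1].
  exists (fun n => (1 - 'X) ^+ n); split=> [n t t01|t t01].
    by rewrite !hornerE exprn_ge0 ?exprn_ile1 //; lra.
  have -> : (fun n => ((1 - 'X) ^+ n : {poly R}).[t]) = fun n => (1 - t) ^+ n.
    by apply/funext => n; rewrite !hornerE.
  case: (leP t 0) => t0.
    have -> : t = 0 by lra.
    rewrite (_ : (fun n => _) = fun=> 1); first exact: cvg_cst.
    by apply/funext => n; rewrite subr0 expr1n.
  by apply: cvg_expr; rewrite ger0_norm; lra.
pose y n := (x ^+ n.+1)^-1 / n.+1%:R.
pose N n := Num.truncn (y n).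
have xn n : 0 < x ^+ n.+1 by exact: exprn_gt0.
have y0 n : 0 <= y n by rewrite divr_ge0 // invr_ge0 ltW.
have NE n (t : R) : ((1 - 'X^(n.+1)) ^+ N n : {poly R}).[t] = (1 - t ^+ n.+1) ^+ N n.
  by rewrite !hornerE.
have tn (t : R) n : 0 <= t <= 1 -> 0 <= t ^+ n.+1 <= 1.
  by move=> /andP[t0 t1]; rewrite exprn_ge0 ?exprn_ile1.
exists (fun n => (1 - 'X^(n.+1)) ^+ N n); split=> [n t /tn - /(_ n) t01|t t01].
  by rewrite NE exprn_ge0 ?exprn_ile1 //; lra.
rewrite (_ : (fun n => _) = fun n => (1 - t ^+ n.+1) ^+ N n); last by apply/funext => n; rewrite NE.
have [t0 t1] := andP t01.
case: (leP t x) => tx /=.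
  (* For t <= x Bernoulli's inequality bounds the value below by 1 - N t^m >= 1 - 1/m, where m =
     n+1. *)
  apply: (@squeeze_cvgr _ _ _ _ (fun n => 1 - harmonic n) (cst 1)); last exact: cvg_cst.
    apply: nearW => n; have [h0 h1] := andP (tn t n t01).
    rewrite exprn_ile1 ?andbT; [|lra|lra].
    apply: le_trans (bernoulli_ge _ (tn t n t01)); rewrite lerD2l lerN2 /harmonic /=.
    apply: (@le_trans _ _ (y n * x ^+ n.+1)).
      apply: ler_pM => //; first by rewrite truncn_le.
      by rewrite lerXn2r ?nnegrE // ltW.
    by rewrite /y mulrAC mulVf ?mul1r ?gt_eqF //.
  by have := cvgB (cvg_cst (1 : R)) (@cvg_harmonic R); rewrite subr0; exact.
have t0' : 0 < t by exact: lt_trans tx.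
have q01 : 0 <= x / t < 1 by rewrite divr_ge0 ?(ltW x0) //= ltr_pdivrMr // mul1r.
(* For t > x the other Bernoulli bound and y <= N+1 give at most 1/(y t^m) = m (x/t)^m. *)
apply: (@squeeze_cvgr _ _ _ _ (cst 0) (fun n => n.+1%:R * (x / t) ^+ n.+1)); last first.
- exact: cvg_succ_geo.
- exact: cvg_cst.
apply: nearW => n; have [h0 h1] := andP (tn t n t01).
rewrite exprn_ge0 /=; last lra.
have tn0 : 0 < t ^+ n.+1 by exact: exprn_gt0.
have k0 : 0 < n.+1%:R :> R by [].
have B := bernoulli_le (N n) (tn t n t01).
have yN : y n <= (N n).+1%:R by rewrite ltW // truncnS_gt.
set p := _ ^+ N n in B *.
have p0 : 0 <= p by rewrite exprn_ge0 //; lra.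
have H : p * (y n * t ^+ n.+1) <= 1.
  apply: le_trans B; rewrite ler_wpM2l //.
  apply: (@le_trans _ _ ((N n).+1%:R * t ^+ n.+1)); first by rewrite ler_wpM2r.
  by rewrite -natr1 mulrDl mul1r addrC lerD2r.
have -> : n.+1%:R * (x / t) ^+ n.+1 = (y n * t ^+ n.+1)^-1.
  by rewrite /y expr_div_n; field; rewrite ?gt_eqF.
by rewrite -[leRHS]mul1r ler_pdivlMr // mulr_gt0 // divr_gt0 // invr_gt0.
Qed.

Section EqualMoments.
Variables mu mu' : {finite_measure set (measurableTypeR R) -> \bar R}.
Hypothesis moments_eq : forall k, int01 mu (fun l => l ^+ k) = int01 mu' (fun l => l ^+ k).

Lemma int01_horner (p : {poly R}) : int01 mu (fun l => p.[l]) = int01 mu' (fun l => p.[l]).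
Proof.
have E m : int01 m (fun l => p.[l]) = moment (fun k => int01 m (fun l => l ^+ k)) p.
  have -> : (fun k => int01 m (fun l => l ^+ k)) = weighted_moment m (fun=> 1).
    by apply/funext => k; apply: int01_ext => l _; rewrite mul1r.
  rewrite moment_weighted; last exact: cst_continuous01.
  by apply: int01_ext => l _; rewrite mul1r.
by rewrite !E; congr (moment _ p); apply/funext.
Qed.

Lemma measure_I01_eq : mu I01 = mu' I01.
Proof.
have E m : int01 m (fun l => l ^+ 0) = mass01 m.
  by rewrite -[RHS]mul1r -int01_cst; apply: int01_ext => l _; rewrite expr0.
have := moments_eq 0; rewrite !E /mass01 => Em.
rewrite -[LHS]fineK ?fin_num_measure // -[RHS]fineK ?fin_num_measure //.
by rewrite Em.
Qed.

(** Both measures agree on polynomials, and the threshold polynomials converge boundedly to the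
    indicator of [0, x]. *)
Lemma measure_itv0_eq (x : R) : 0 <= x < 1 -> mu `[0, x]%classic = mu' `[0, x]%classic.
Proof.
move=> x01; have [p [p01 px]] := threshold_polys x01.
have L m : (fun n => int01 m (fun t => (p n).[t])) @ \oo --> fine (m `[0, x]%classic).
  have [_ x1] := andP x01; rewrite -int01_indic ?(ltW x1) //.
  apply: fine_cvg.
  rewrite -int01_expand; last exact: integrable01_indic.
  apply: (@dominated_cvg _ _ _ _ _ _ _ _ (cst 1%E)) => //.
  - move=> n; apply/measurable_EFinP.
    apply: subspace_continuous_measurable_fun; first exact: measurable_I01.
    by apply: continuous_subspaceT => t; exact: continuous_horner.
  - move=> t; rewrite I01E => t01; apply: cvg_EFin; last exact: px.
    by apply: nearW.
  - by have := integrable01_cst m 1; exact.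
  - by move=> n t; rewrite I01E => /(p01 n) /andP[h0 h1]; rewrite abse_EFin lee_fin ger0_norm.
have mI : measurable (`[0, x]%classic : set (measurableTypeR R)) by exact: measurable_itv.
rewrite -[LHS]fineK ?fin_num_measure // -[RHS]fineK ?fin_num_measure //.
congr EFin.
have pE : (fun n => int01 mu (fun t => (p n).[t])) = fun n => int01 mu' (fun t => (p n).[t]).
  by apply/funext => n; exact: int01_horner.
have := L mu'; rewrite -pE => L'.
exact: (@cvg_unique _ (@Rhausdorff R) _ _ _ _ (L mu) L').
Qed.

(** Open rays form a generating pi-system, so agreement on rays suffices; inside [0,1] a ray is the
    complement of some [0, x], empty, or everything. *)
Lemma measure_eq_of_moments : supported_in mu `[0, 1] -> supported_in mu' `[0, 1] ->
  forall E : set (measurableTypeR R), measurable E -> mu E = mu' E.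
Proof.
move=> mu01 mu01'.
have trace (m : {finite_measure set (measurableTypeR R) -> \bar R}) E :
    supported_in m `[0, 1] -> measurable E -> m E = m (E `&` I01).
  move=> m01 mE; have mD : measurable (E `\` I01) by exact: measurableD.
  have E0 : m (E `\` I01) = 0%E.
    apply: (subset_measure0 mD _ _ m01); first exact: measurableC (@measurable_I01 R).
    by move=> t [].
  by rewrite [LHS](measureDI m mE (@measurable_I01 R)) [X in (X + _)%E]E0 add0e.
have ray (x : R) : mu `]x, +oo[%classic = mu' `]x, +oo[%classic.
  rewrite (trace mu) // (trace mu') //.
  have [x0|x0] := ltP x 0.
    rewrite (_ : _ `&` _ = I01); first exact: measure_I01_eq.
    apply/seteqP; split=> t; first by case.
    by move=> t01; split=> //; move: t01; rewrite I01E /= in_itv /=; lra.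
  have [x1|x1] := ltP x 1; last first.
    rewrite (_ : _ `&` _ = set0) ?measure0 //.
    by apply/seteqP; split=> t //; rewrite /setI /= I01E in_itv /=; lra.
  have mI : measurable (`[0, x]%classic : set (measurableTypeR R)) by exact: measurable_itv.
  rewrite (_ : _ `&` _ = I01 `\` `[0, x]); last first.
    by apply/seteqP; split=> t; rewrite /setI /setD /= I01E !in_itv /=; lra.
  have fI (m : {finite_measure set (measurableTypeR R) -> \bar R}) :
      m (I01 `\` `[0, x]) = (m I01 - m `[0%R, x]%classic)%E.
    rewrite measureD ?finite_I01 //; congr (_ - m _)%E.
    by apply/seteqP; split=> t; rewrite /setI /= I01E in_itv /=; lra.
  by rewrite !fI measure_I01_eq measure_itv0_eq // x0.
apply: (@measure_unique _ R (measurableTypeR R) (@RGenOInfty.G R)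
  (fun n => `](- n%:R : R), +oo[%classic) _ _ _ _ mu mu').
- exact: (RGenOInfty.measurableE R).
- move=> _ _ [x ->] [y ->]; exists (Num.max x y); apply/seteqP.
  by split=> t; rewrite /setI /= !in_itv /= !andbT gt_max => /andP.
- by move=> n; exists (- n%:R).
- apply/seteqP; split=> // t _; exists (Num.truncn `|t|).+1 => //=.
  rewrite in_itv /= andbT; have := truncnS_gt `|t|.
  by rewrite ltr_norml => /andP[].
- by move=> _ [x ->]; exact: ray.
- by move=> n; rewrite ltey_eq fin_num_measure.
Qed.

End EqualMoments.

Lemma integral_expression_unique (f : R -> R) beta beta' mu mu' :
  integral_expression f beta mu -> integral_expression f beta' mu' ->
  forall E : set (measurableTypeR R), measurable E -> mu E = mu' E.
Proof.
move=> h h'; have [_ s _] := h; have [_ s' _] := h'.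
apply: measure_eq_of_moments => // k; apply/eqP; rewrite -subr_eq0; apply/eqP.
apply: (@alternating_cvg_eq0 (fun k => int01 mu (fun l => l ^+ k) - int01 mu' (fun l => l ^+ k))).
  by apply: is_cvgB; exact: moments_cvg.
move=> j; have := integral_expression_moments h j.
by rewrite -(integral_expression_moments h' j); lra.
Qed.

End Uniqueness.

Theorem proposition4p4 (R : realType) (f : R -> R) :
  [/\ operator_absolutely_monotone (-1) 1 f <->
      [/\ forall x : R, x \in `]-1, 1[ -> 0 <= f x,
          operator_monotone (-1) 1 f &
          exists mu : {finite_measure set (measurableTypeR R) -> \bar R},
            representing_measure f mu /\ supported_in mu `[0, 1]],
      operator_absolutely_monotone (-1) 1 f <->
      (exists (beta : R)
              (mu : {finite_measure set (measurableTypeR R) -> \bar R}),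
         integral_expression f beta mu) &
      (* uniqueness of the measure in the integral expression *)
      forall (beta beta' : R)
             (mu mu' : {finite_measure set (measurableTypeR R) -> \bar R}),
        integral_expression f beta mu -> integral_expression f beta' mu' ->
        forall E : set (measurableTypeR R), measurable E -> mu E = mu' E].
Proof.
split.
- split=> [oamf|[f0 _ [mu [fmu mu01]]]]; last exact: oam_of_representing fmu mu01.
  by split; [exact: oam_ge0|exact: oam_operator_monotone|exact: oam_representing].
- split=> [|[beta [mu]]]; first exact: oam_integral_expression.
  exact: oam_of_integral_expression.
- by move=> beta beta' mu mu'; exact: integral_expression_unique.
Qed.
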